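(* For every $\alpha\in\left(\frac12,1\right]$ there is a constant $C_\alpha$ such that for every $T>0$ and every $f\in L^4(\Omega;L^{4/3}_{\mathcal{P}}([0,T]\times\mathbb{T}))$, $$\left\|\int_0^te^{-i(W_t-W_s)\Delta}f(s)\,ds\right\|_{L^4(\Omega\times[0,T]\times\mathbb{T})}\le C_\alpha\left(T^2+T^{2-\alpha}\right)^{1/4}\|f\|_{L^4(\Omega;L^{4/3}([0,T]\times\mathbb{T}))}.$$
   Context: $\mathbb{T}=\mathbb{R}/(2\pi\mathbb{Z})$. $(W_t)_{t\ge0}$ is a standard real Brownian motion with respect to a filtration $(\mathcal{F}_t)_{t\ge0}$ on a probability space $(\Omega,\mathcal{F},\mathbb{P})$. The operator $e^{-i(W_t-W_s)\Delta}$ is the Fourier multiplier on $\mathbb{T}$ with symbol $e^{ik^2(W_t-W_s)}$, $k\in\mathbb{Z}$. The subscript $\mathcal{P}$ means that $f$ is predictable with respect to $(\mathcal{F}_t)$: $L^4(\Omega;L^{4/3}_{\mathcal{P}}([0,T]\times\mathbb{T}))$ is the space of predictable processes $f$ with $\mathbb{E}\left(\int_0^T\int_{\mathbb{T}}|f|^{4/3}\,dx\,dt\right)^{3}<\infty$. The left-hand norm is taken over $(\omega,t,x)$ of the function of $t\in[0,T]$ defined by the integral. *)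

(* Defs.v *)
From HB Require Import structures.
From mathcomp Require Export all_boot all_order all_algebra.
From mathcomp Require Export complex.
From mathcomp Require Export all_classical all_reals all_analysis.

Set Implicit Arguments.
Unset Strict Implicit.
Unset Printing Implicit Defensive.

Export Order.TTheory GRing.Theory Num.Theory.
Export numFieldNormedType.Exports.

#[export] Set Implicit Arguments.
#[export] Unset Strict Implicit.
#[export] Unset Printing Implicit Defensive.

Open Scope classical_set_scope.
Open Scope ring_scope.
Open Scope complex_scope.

Notation leb := lebesgue_measure.

Section ComplexIntegration.
Context d (T : measurableType d) (R : realType).
Implicit Types (D : set T) (g : T -> R[i]).

Definition cmeasurable_fun D g : Prop :=
  measurable_fun D (fun x => complex.Re (g x)) /\
  measurable_fun D (fun x => complex.Im (g x)).

Definition cintegrable (mu : {measure set T -> \bar R}) D g : Prop :=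
  mu.-integrable D (fun x => (complex.Re (g x))%:E) /\
  mu.-integrable D (fun x => (complex.Im (g x))%:E).

Definition cintegral (mu : {measure set T -> \bar R}) D g : R[i] :=
  Rintegral mu D (fun x => complex.Re (g x)) +i*
  Rintegral mu D (fun x => complex.Im (g x)).

(* The real-valued modulus; [`|z|] would land in [R[i]]. *)
Definition modulus (z : R[i]) : R := ComplexField.Normc.normc z.

End ComplexIntegration.

Section Torus.
Variable R : realType.

(* R / (2 pi Z) is identified with its fundamental domain: a function on the
   torus is a function on R of which only the values on [circle] matter, and
   dx is Lebesgue measure there (total mass 2 pi). *)
Definition circle : set R := `[0, 2 * pi[.

(* e^{i x} *)
Definition cis (x : R) : R[i] := cos x +i* sin x.

Definition fourier_coef (g : R -> R[i]) (k : int) : R[i] :=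
  ((2 * pi)^-1)%:C * cintegral leb circle (fun x : R => cis (- (k%:~R * x)) * g x).

(* Distributions on the torus are handled through their Fourier coefficients,
   as elements of [int -> R[i]]; [represents g c] says that the distribution
   with coefficients [c] is the function [g] of L^1(torus). *)
Definition represents (g : R -> R[i]) (c : int -> R[i]) : Prop :=
  cintegrable leb circle g /\ forall k, fourier_coef g k = c k.

Definition fourier_multiplier (m c : int -> R[i]) : int -> R[i] :=
  fun k => m k * c k.

(* e^{- i tau Delta}: Delta has symbol - k^2. *)
Definition schrodinger (tau : R) : (int -> R[i]) -> int -> R[i] :=
  fourier_multiplier (fun k => cis ((k%:~R) ^+ 2 * tau)).

End Torus.

Section Stochastic.
Context d (Omega : measurableType d) (R : realType).

(* Only the indices t >= 0 are meaningful.  The usual conditions are not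
   assumed. *)
Definition is_filtration (F : R -> set (set Omega)) : Prop :=
  (forall t : R, 0 <= t -> sigma_algebra setT (F t) /\ F t `<=` measurable) /\
  (forall s t : R, 0 <= s -> s <= t -> F s `<=` F t).

Definition increment (W : R -> Omega -> R) (s t : R) (w : Omega) : R :=
  W t w - W s w.

(* [normal_prob] takes the standard deviation as second parameter. *)
Record is_brownian_motion (P : probability Omega R)
    (F : R -> set (set Omega)) (W : R -> Omega -> R) : Prop := {
  bm_filtration : is_filtration F;
  bm_adapted : forall t : R, 0 <= t ->
    forall B : set R, measurable B -> F t (W t @^-1` B);
  bm_start : {ae P, forall w, W 0 w = 0};
  bm_continuous : {ae P, forall w,
    {within `[0, +oo[, continuous (fun t => W t w)}};
  bm_gaussian : forall s t : R, 0 <= s -> s < t ->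
    forall B : set R, measurable B ->
    P (increment W s t @^-1` B) = normal_prob 0 (Num.sqrt (t - s)) B;
  bm_independent : forall s t : R, 0 <= s -> s < t ->
    forall (A : set Omega) (B : set R), F s A -> measurable B ->
    P (A `&` increment W s t @^-1` B) =
    (P A * P (increment W s t @^-1` B))%E
}.

(* Generators of the predictable sigma-algebra on Omega x [0, +oo[. *)
Definition predictable_rectangle (F : R -> set (set Omega)) :
    set (set (Omega * R)) :=
  [set Q | exists2 A, F 0 A & Q = A `*` [set 0]] `|`
  [set Q | exists (s t : R) A, [/\ 0 <= s, s <= t, F s A & Q = A `*` `]s, t]]].

Definition spacetime (T : R) : set (R * R) := `[0, T] `*` @circle R.

Definition sample_spacetime (T : R) : set (Omega * R * R) :=
  ([set: Omega] `*` `[0, T]) `*` @circle R.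

(* Measurability on Omega x [0, T] x torus for the product of the predictable
   and the Borel sigma-algebras. *)
Definition predictable (F : R -> set (set Omega)) (T : R)
    (f : Omega -> R -> R -> R[i]) : Prop :=
  @cmeasurable_fun _ (g_sigma_algebraType (predictable_rectangle F) * R)%type R
    (sample_spacetime T) (fun z => f z.1.1 z.1.2 z.2).

(* The norm of L^4(Omega; L^{4/3}([0, T] x torus)). *)
Definition norm_L4_L43 (P : probability Omega R) (T : R)
    (f : Omega -> R -> R -> R[i]) : \bar R :=
  Lnorm P 4%:E (fun w => Lnorm (leb \x leb)%E (4 / 3)%:E
    ((fun z => (modulus (f w z.1 z.2))%:E) \_ (spacetime T))).

(* The norm of L^4(Omega x [0, T] x torus). *)
Definition norm_L4 (P : probability Omega R) (T : R)
    (u : Omega -> R -> R -> R[i]) : \bar R :=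
  Lnorm ((P \x leb) \x leb)%E 4%:E
    ((fun z => (modulus (u z.1.1 z.1.2 z.2))%:E) \_ (sample_spacetime T)).

(* int_0^t e^{- i (W_t - W_s) Delta} f(s) ds as a distribution on the torus.
   The integral is taken coefficientwise, because e^{- i tau Delta} does not
   preserve L^{4/3}. *)
Definition stochastic_duhamel (W : R -> Omega -> R)
    (f : Omega -> R -> R -> R[i]) (w : Omega) (t : R) (k : int) : R[i] :=
  cintegral leb `[0, t]
    (fun s : R => schrodinger (increment W s t w) (fourier_coef (f w s)) k).

(* [u] is a jointly measurable version of the distribution-valued process
   [c] on Omega x [0, T]. *)
Definition is_version (P : probability Omega R) (T : R)
    (c : Omega -> R -> int -> R[i]) (u : Omega -> R -> R -> R[i]) : Prop :=
  cmeasurable_fun (sample_spacetime T) (fun z : Omega * R * R => u z.1.1 z.1.2 z.2) /\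
  {ae (P \x leb)%E, forall z : Omega * R,
    z.2 \in `[0, T] -> represents (u z.1 z.2) (c z.1 z.2)}.

End Stochastic.

(* Main.v *)
From HB Require Import structures.
Require Import Defs.
From mathcomp Require Import ring lra zify measurable_realfun.

(** In Fourier coefficients the Duhamel integral is a phase times a primitive in
    time: with [f_k] the coefficients of the source,
    [c_k t = cis (k ^+ 2 * W t) * \int_0^t cis (- (k ^+ 2 * W s)) * f_k s ds].
    Up to the factor [2 * pi], the fourth power of the L^4 norm in space of
    [\sum_k c_k t * cis (k * x)] is the sum of [c_i * c_j^* * c_k * c_l^*] over
    the balanced quadruples of modes, [i - j + k - l = 0] ([trigpoly_L4]).
    Such a product is an oscillating factor [cis (nu * W t)] times a product of
    four primitives, which is itself the primitive of an adapted density
    ([primitiveM], [interaction_primitive]), and on a balanced quadruple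
    [nu = i ^+ 2 - j ^+ 2 + k ^+ 2 - l ^+ 2 = 2 * (i - j) * (i - l)].

    The quadruples with [nu = 0] sum to at most twice the fourth power of the
    L^2 norm in space. They are estimated on each path: by the energy identity
    the squared L^2 norm is at most the pairing of the source with the solution
    ([energy_le]), hence by Hoelder's inequality at most the product of the
    L^{4/3} norm of the source and the L^4 norm of the solution, and the latter
    is absorbed ([field4_le]). This yields the term [T ^+ 2].

    For [nu != 0] the noise gives decay. The density at time [s] depends on the
    past of [s] only, so that averaging [cis (nu * (W t - W s))] over the
    increment produces a factor [expR (- (c * nu ^+ 2 * (t - s)))]
    ([charfun_decay], where a crude constant [c > 0] is enough). Its integral
    over [t] is at most [T] and at most the inverse of [c * nu ^+ 2], hence at
    most [T `^ (1 - alpha)] times the power [- alpha] of [c * nu ^+ 2]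
    ([nonresonant_expectation]). Since [2 * alpha > 1] the resulting weights of
    the gaps [i - j] and [i - l] are summable and a Schur test
    ([balanced_schur]) leaves the sum over [k] of the fourth powers of
    [\int_0^T |f_k|]. An inequality of Hausdorff-Young and Minkowski type
    ([mass_coef_l4]) bounds that sum by [T] times the fourth power of the
    L^{4/3} norm of the source, which yields the term [T `^ (2 - alpha)].

    All of this is done for bounded sources, finitely many modes, and a jointly
    measurable version of the Brownian path ([mean_field4_le]). A predictable
    source is truncated in size and Fatou's lemma removes the truncation
    ([coefficient_L4_le]). The bound being uniform in the finite set of modes,
    the Fourier series converges along a subsequence of its partial sums to a
    jointly measurable function with the same bound ([riesz_fischer]). *)

(** * Complex numbers and bounded measurable complex functions *)

Section ModulusAlgebra.
Variable R : realType.
Implicit Types (a b c z w : R[i]) (x y : R).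

Lemma modulusM z w : modulus (z * w) = modulus z * modulus w.
Proof. exact: ComplexField.Normc.normcM. Qed.

Lemma modulusD z w : modulus (z + w) <= modulus z + modulus w.
Proof. exact: le_normcD. Qed.

Lemma modulus_sqr z : modulus z ^+ 2 = complex.Re z ^+ 2 + complex.Im z ^+ 2.
Proof.
by case: z => ? ?; rewrite /modulus /= sqr_sqrtr// addr_ge0// sqr_ge0.
Qed.

Lemma modulus_ge0 z : 0 <= modulus z.
Proof. by case: z => a b; rewrite /modulus /= sqrtr_ge0. Qed.

Lemma modulus0 : modulus (0 : R[i]) = 0.
Proof. exact: ComplexField.Normc.normc0. Qed.

Lemma modulus_conj z : modulus z^*%C = modulus z.
Proof. by case: z => a b; rewrite /modulus /= sqrrN. Qed.

Lemma modulus_quartic a b c z :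
  modulus (a * b^*%C * (c * z^*%C)) = modulus a * modulus b * (modulus c * modulus z).
Proof. by rewrite !modulusM !modulus_conj. Qed.

Lemma modulus_real x : modulus x%:C = `|x|.
Proof. by rewrite /modulus /= expr0n addr0 sqrtr_sqr. Qed.

Lemma modulus_cis x : modulus (cis x) = 1.
Proof. by rewrite /modulus /cis /= cos2Dsin2 sqrtr1. Qed.

Lemma normr_Re_le z : `|complex.Re z| <= modulus z.
Proof.
rewrite -(@ler_pXn2r _ 2)// ?nnegrE ?modulus_ge0//.
by rewrite modulus_sqr real_normK ?num_real// lerDl sqr_ge0.
Qed.

Lemma normr_Im_le z : `|complex.Im z| <= modulus z.
Proof.
rewrite -(@ler_pXn2r _ 2)// ?nnegrE ?modulus_ge0//.
by rewrite modulus_sqr real_normK ?num_real// lerDr sqr_ge0.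
Qed.

Lemma Re_le_modulus z : complex.Re z <= modulus z.
Proof. exact: le_trans (ler_norm _) (normr_Re_le z). Qed.

Lemma modulus_sum (I : Type) (r : seq I) (P : pred I) (F : I -> R[i]) :
  modulus (\sum_(i <- r | P i) F i) <= \sum_(i <- r | P i) modulus (F i).
Proof.
elim/big_rec2: _ => [|i x y _ le]; first by rewrite modulus0.
exact: le_trans (modulusD _ _) (lerD (lexx _) le).
Qed.

Lemma mul_conj z : z * z^*%C = (modulus z ^+ 2)%:C.
Proof.
rewrite modulus_sqr; case: z => a b /=; apply/eqP; rewrite eq_complex /=.
by apply/andP; split; apply/eqP; ring.
Qed.

Lemma cisD x y : cis (x + y) = cis x * cis y.
Proof.
rewrite /cis cosD sinD; apply/eqP; rewrite eq_complex /=.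
by apply/andP; split; apply/eqP; ring.
Qed.

Lemma cis0 : cis (0 : R) = 1.
Proof. by rewrite /cis cos0 sin0. Qed.

Lemma conj_cis x : (cis x)^*%C = cis (- x).
Proof. by rewrite /cis /= cosN sinN. Qed.

Lemma conjM z w : (z * w)^*%C = z^*%C * w^*%C.
Proof. exact: rmorphM. Qed.

Lemma conj_sum (J : Type) (r : seq J) (P : pred J) (F : J -> R[i]) :
  (\sum_(i <- r | P i) F i)^*%C = \sum_(i <- r | P i) (F i)^*%C.
Proof. exact: rmorph_sum. Qed.

Lemma ReM z w : complex.Re (z * w) =
  complex.Re z * complex.Re w - complex.Im z * complex.Im w.
Proof. by case: z w => [a b] [c d]. Qed.

Lemma ImM z w : complex.Im (z * w) =
  complex.Re z * complex.Im w + complex.Im z * complex.Re w.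
Proof. by case: z w => [a b] [c d] /=; ring. Qed.

Lemma ReD z w : complex.Re (z + w) = complex.Re z + complex.Re w.
Proof. by case: z w => [a b] [c d]. Qed.

Lemma ImD z w : complex.Im (z + w) = complex.Im z + complex.Im w.
Proof. by case: z w => [a b] [c d]. Qed.

Lemma Re_conj z : complex.Re z^*%C = complex.Re z.
Proof. by case: z. Qed.

Lemma Im_conj z : complex.Im z^*%C = - complex.Im z.
Proof. by case: z. Qed.

Lemma complex_ext z w : complex.Re z = complex.Re w ->
  complex.Im z = complex.Im w -> z = w.
Proof. by case: z w => [a b] [c d] /= -> ->. Qed.

(** Multiplying by this unimodular factor turns a complex number into its
    modulus; it is the dual element in the Hausdorff-Young argument. *)
Definition unphase z : R[i] := z^*%C * ((modulus z)^-1)%:C.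

Lemma unphase_le1 z : modulus (unphase z) <= 1.
Proof.
rewrite /unphase modulusM modulus_conj modulus_real ger0_norm ?invr_ge0 ?modulus_ge0//.
have [->|z0] := eqVneq (modulus z) 0; first by rewrite mul0r.
by rewrite divff.
Qed.

Lemma unphaseM z : unphase z * z = (modulus z)%:C.
Proof.
rewrite /unphase mulrAC [z^*%C * z]mulrC mul_conj -rmorphM/=.
have [->|z0] := eqVneq (modulus z) 0; first by rewrite expr0n/= mul0r.
by rewrite expr2 -mulrA divff// mulr1.
Qed.

End ModulusAlgebra.

Arguments cis : simpl never.
Arguments conjc : simpl never.
Arguments modulus : simpl never.

Section ComplexMeasurability.
Context d (T : measurableType d) (R : realType).
Implicit Types (D : set T) (g h : T -> R[i]).

Lemma cmeasurable_cst D (c : R[i]) : cmeasurable_fun D (fun _ => c).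
Proof. by split; exact: measurable_cst. Qed.

Lemma cmeasurable_real D (f : T -> R) : measurable_fun D f ->
  cmeasurable_fun D (fun x => (f x)%:C).
Proof. by split => //=; exact: measurable_cst. Qed.

Lemma cmeasurable_cis D (f : T -> R) : measurable_fun D f ->
  cmeasurable_fun D (fun x => cis (f x)).
Proof.
move=> mf; split; rewrite /cis /=.
- apply: (measurableT_comp _ mf); apply: continuous_measurable_fun.
  exact: continuous_cos.
- apply: (measurableT_comp _ mf); apply: continuous_measurable_fun.
  exact: continuous_sin.
Qed.

Lemma cmeasurableD D g h : cmeasurable_fun D g -> cmeasurable_fun D h ->
  cmeasurable_fun D (fun x => g x + h x).
Proof.
move=> [g1 g2] [h1 h2]; split.
- under eq_fun do rewrite ReD; exact: measurable_funD.
- under eq_fun do rewrite ImD; exact: measurable_funD.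
Qed.

Lemma cmeasurableM D g h : cmeasurable_fun D g -> cmeasurable_fun D h ->
  cmeasurable_fun D (fun x => g x * h x).
Proof.
move=> [g1 g2] [h1 h2]; split.
- under eq_fun do rewrite ReM.
  by apply: measurable_funB; exact: measurable_funM.
- under eq_fun do rewrite ImM.
  by apply: measurable_funD; exact: measurable_funM.
Qed.

Lemma cmeasurable_conj D g : cmeasurable_fun D g ->
  cmeasurable_fun D (fun x => (g x)^*%C).
Proof.
move=> [g1 g2]; split; first by under eq_fun do rewrite Re_conj.
under eq_fun do rewrite Im_conj.
exact: measurable_funN.
Qed.

Lemma cmeasurable_sum D (I : Type) (r : seq I) (P : pred I)
    (F : I -> T -> R[i]) :
  (forall i, cmeasurable_fun D (F i)) ->
  cmeasurable_fun D (fun x => \sum_(i <- r | P i) F i x).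
Proof.
move=> mF; elim: r => [|i r IH].
  by under eq_fun do rewrite big_nil; exact: cmeasurable_cst.
under eq_fun do rewrite big_cons.
by case: (P i) => //; apply: cmeasurableD.
Qed.

Lemma measurable_modulus D g : cmeasurable_fun D g ->
  measurable_fun D (fun x => modulus (g x)).
Proof.
move=> [g1 g2].
have -> : (fun x => modulus (g x)) =
    Num.sqrt \o (fun x => complex.Re (g x) ^+ 2 + complex.Im (g x) ^+ 2).
  by apply/funext => x /=; rewrite -modulus_sqr sqrtr_sqr ger0_norm// modulus_ge0.
apply: measurableT_comp.
  by apply: continuous_measurable_fun; exact: sqrt_continuous.
by apply: measurable_funD; exact: measurable_funX.
Qed.

Lemma cmeasurable_unphase D g : cmeasurable_fun D g ->
  cmeasurable_fun D (fun x => unphase (g x)).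
Proof.
move=> mg; apply: cmeasurableM; first exact: cmeasurable_conj.
apply: cmeasurable_real.
rewrite (_ : (fun x => _) = (@powR R ^~ (-1)) \o (fun x => modulus (g x))).
  by apply: measurableT_comp; [exact: measurable_powR|exact: measurable_modulus].
by apply/funext => x /=; rewrite powR_inv1// modulus_ge0.
Qed.

End ComplexMeasurability.

Lemma cmeasurable_comp d1 d2 (T1 : measurableType d1) (T2 : measurableType d2)
    (R : realType) (g : T2 -> R[i]) (phi : T1 -> T2) :
  measurable_fun setT phi -> cmeasurable_fun setT g ->
  cmeasurable_fun setT (g \o phi).
Proof.
by move=> mphi [g1 g2]; split; [exact: (measurableT_comp g1)|exact: (measurableT_comp g2)].
Qed.

(** Bounded measurable complex functions: on finite measure spaces these are
    integrable, and the class is stable under every operation used below. *)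
Definition cbounded_measurable d (T : measurableType d) (R : realType)
    (g : T -> R[i]) : Prop :=
  cmeasurable_fun setT g /\ exists M : R, forall x, modulus (g x) <= M.

Section BoundedMeasurable.
Context d (T : measurableType d) (R : realType).
Implicit Types (g h : T -> R[i]).
Notation bm := (@cbounded_measurable d T R).

Lemma cbounded_cst (c : R[i]) : bm (fun _ => c).
Proof. by split; [exact: cmeasurable_cst|exists (modulus c)]. Qed.

Lemma cboundedD g h : bm g -> bm h -> bm (fun x => g x + h x).
Proof.
move=> [mg [M gM]] [mh [N hN]]; split; first exact: cmeasurableD.
by exists (M + N) => x; apply: le_trans (modulusD _ _) (lerD _ _).
Qed.

Lemma cboundedM g h : bm g -> bm h -> bm (fun x => g x * h x).
Proof.
move=> [mg [M gM]] [mh [N hN]]; split; first exact: cmeasurableM.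
by exists (M * N) => x; rewrite modulusM ler_pM ?modulus_ge0.
Qed.

Lemma cbounded_conj g : bm g -> bm (fun x => (g x)^*%C).
Proof.
move=> [mg [M gM]]; split; first exact: cmeasurable_conj.
by exists M => x; rewrite modulus_conj.
Qed.

Lemma cbounded_sum (I : finType) (P : pred I) (F : I -> T -> R[i]) :
  (forall i, bm (F i)) -> bm (fun x => \sum_(i | P i) F i x).
Proof.
move=> bF; split; first by apply: cmeasurable_sum => i; have [] := bF i.
have /choice[M FM] : forall i, exists M, forall x, modulus (F i x) <= M.
  by move=> i; have [_ [M FM]] := bF i; exists M.
exists (\sum_(i | P i) M i) => x.
exact: le_trans (modulus_sum _ _ _) (ler_sum _ _).
Qed.

Lemma cbounded_cis (f : T -> R) : measurable_fun setT f ->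
  bm (fun x => cis (f x)).
Proof.
move=> mf; split; first exact: cmeasurable_cis.
by exists 1 => x; rewrite modulus_cis.
Qed.

Lemma cbounded_unphase g : cmeasurable_fun setT g -> bm (fun x => unphase (g x)).
Proof.
move=> mg; split; first exact: cmeasurable_unphase.
by exists 1 => x; exact: unphase_le1.
Qed.

Lemma cbounded_real (f : T -> R) (M : R) : measurable_fun setT f ->
  (forall x, `|f x| <= M) -> bm (fun x => (f x)%:C).
Proof.
move=> mf fM; split; first exact: cmeasurable_real.
by exists M => x; rewrite modulus_real.
Qed.

Lemma cbounded_comp d' (T' : measurableType d') (phi : T' -> T) g :
  measurable_fun setT phi -> bm g -> cbounded_measurable (g \o phi).
Proof.
move=> mphi [mg [M gM]]; split; first exact: cmeasurable_comp.
by exists M => x; exact: gM.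
Qed.

End BoundedMeasurable.

(** * Integration of bounded complex functions *)

Section FiniteProduct.
Local Open Scope ereal_scope.
Context d1 d2 (T1 : measurableType d1) (T2 : measurableType d2) (R : realType).
Variable m1 : {finite_measure set T1 -> \bar R}.
Variable m2 : {finite_measure set T2 -> \bar R}.

(** A copy of [m1 \x m2] under its own name, which is canonically a finite
    measure for arbitrary finite factors. *)
Definition finite_product : set (T1 * T2) -> \bar R := m1 \x m2.

HB.instance Definition _ := Measure.on finite_product.

Let finite_product_fin : fin_num_fun finite_product.
Proof.
have prodT : (m1 \x m2) setT < +oo.
  rewrite -setXTT product_measure1E// lte_mul_pinfty//.
  - by rewrite fin_num_measure.
  - by rewrite ltey_eq fin_num_measure.
exact: (lty_fin_num_fun prodT).
Qed.

HB.instance Definition _ := Measure_isFinite.Build _ _ _ finite_product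
  finite_product_fin.

End FiniteProduct.

Section BoundedReal.
Context d (T : measurableType d) (R : realType).
Variable mu : {finite_measure set T -> \bar R}.
Implicit Types f g : T -> R.

Lemma bounded_integrable f (M : R) : measurable_fun setT f ->
  (forall x, `|f x| <= M) -> mu.-integrable setT (EFin \o f).
Proof.
move=> mf fM; apply: measurable_bounded_integrable => //.
  by rewrite ltey_eq fin_num_measure.
exists M; split; first exact: num_real.
by move=> N MN x _; exact: le_trans (fM x) (ltW MN).
Qed.

Lemma Rintegral_le_bound f (M : R) : measurable_fun setT f ->
  (forall x, `|f x| <= M) ->
  `|Rintegral mu setT f| <= M * fine (mu setT).
Proof.
move=> mf fM; have fi := bounded_integrable mf fM.
apply: le_trans (le_normr_Rintegral _ fi) _ => //.
rewrite -Rintegral_cst//; apply: le_Rintegral => //.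
- by apply: (@bounded_integrable _ M) => //; [exact: measurableT_comp|move=> x; rewrite normr_id].
- exact: finite_measure_integrable_cst.
Qed.

End BoundedReal.

Section RealIntegrals.
Context d (T : measurableType d) (R : realType).
Variable mu : {measure set T -> \bar R}.
Implicit Types f g : T -> R.
Notation integ f := (mu.-integrable setT (EFin \o f)).

Lemma integrable_addR f g : integ f -> integ g -> integ (fun x => f x + g x).
Proof.
move=> fi gi; rewrite (_ : EFin \o _ = (EFin \o f) \+ (EFin \o g))%E; first exact: integrableD.
by apply/funext => x /=; rewrite EFinD.
Qed.

Lemma integrable_scaleR (c : R) f : integ f -> integ (fun x => c * f x).
Proof.
move=> fi; rewrite (_ : EFin \o _ = fun x => c%:E * (f x)%:E)%E; first exact: integrableZl.
by apply/funext => x /=; rewrite EFinM.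
Qed.

Lemma integrable_sumR (I : Type) (r : seq I) (F : I -> T -> R) :
  (forall i, integ (F i)) -> integ (fun x => \sum_(i <- r) F i x).
Proof.
move=> iF; elim: r => [|i r IH].
  by under eq_fun do rewrite big_nil; exact: integrable0.
by under eq_fun do rewrite big_cons; exact: integrable_addR.
Qed.

Lemma Rintegral_sum (I : Type) (r : seq I) (F : I -> T -> R) :
  (forall i, integ (F i)) ->
  \int[mu]_x (\sum_(i <- r) F i x) = \sum_(i <- r) \int[mu]_x F i x.
Proof.
move=> iF; elim: r => [|i r IH].
  by rewrite big_nil; under eq_Rintegral do rewrite big_nil; rewrite Rintegral_cst// mul0r.
rewrite big_cons -IH; under eq_Rintegral do rewrite big_cons.
by rewrite RintegralD//; exact: integrable_sumR.
Qed.

End RealIntegrals.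

Section ParametricIntegral.
Context d1 d2 (T1 : measurableType d1) (T2 : measurableType d2) (R : realType).
Variable m2 : {sigma_finite_measure set T2 -> \bar R}.

Lemma measurable_integral_section (f : T1 * T2 -> \bar R) :
  measurable_fun setT f -> measurable_fun setT (fun x => \int[m2]_y f (x, y))%E.
Proof.
move=> mf; rewrite -/(fubini_F m2 f) (_ : fubini_F m2 f =
    fubini_F m2 f^\+ \- fubini_F m2 f^\-)%E; last first.
  apply/funext => x; rewrite [LHS]integralE.
  under eq_integral do rewrite funepos_comp/=.
  by under [X in (_ - X)%E = _]eq_integral do rewrite funeneg_comp/=.
apply: emeasurable_funB.
- by apply: measurable_fun_fubini_tonelli_F => //; exact: measurable_funepos.
- by apply: measurable_fun_fubini_tonelli_F => //; exact: measurable_funeneg.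
Qed.

Lemma measurable_Rintegral_section (f : T1 * T2 -> R) :
  measurable_fun setT f -> measurable_fun setT (fun x => \int[m2]_y f (x, y)).
Proof.
move=> mf; apply: measurableT_comp => //.
by apply: (measurable_integral_section (f := EFin \o f)); exact/measurable_EFinP.
Qed.

Lemma cmeasurable_cintegral_section (g : T1 * T2 -> R[i]) :
  cmeasurable_fun setT g ->
  cmeasurable_fun setT (fun x => cintegral m2 setT (fun y => g (x, y))).
Proof.
move=> [g1 g2]; split; rewrite /cintegral /=.
- exact: (measurable_Rintegral_section g1).
- exact: (measurable_Rintegral_section g2).
Qed.

End ParametricIntegral.

Section RealFubini.
Context d1 d2 (T1 : measurableType d1) (T2 : measurableType d2) (R : realType).
Variable m1 : {finite_measure set T1 -> \bar R}.
Variable m2 : {finite_measure set T2 -> \bar R}.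
Variables (f : T1 * T2 -> R) (M : R).
Hypotheses (mf : measurable_fun setT f) (fM : forall z, `|f z| <= M).

Let fi := @bounded_integrable _ _ _ (finite_product m1 m2) f M mf fM.

Lemma section_integrable1 x : m2.-integrable setT (EFin \o (fun y => f (x, y))).
Proof. by apply: (@bounded_integrable _ _ _ _ _ M) => //; exact: measurableT_comp. Qed.

Lemma section_integrable2 y : m1.-integrable setT (EFin \o (fun x => f (x, y))).
Proof. by apply: (@bounded_integrable _ _ _ _ _ M) => //; exact: measurableT_comp. Qed.

Lemma Rintegral_prod12 :
  \int[finite_product m1 m2]_z f z = \int[m1]_x \int[m2]_y f (x, y).
Proof.
rewrite /Rintegral -integral12_prod_meas1//; congr fine.
apply: eq_integral => x _; rewrite fineK//.
exact: (integrable_fin_num _ (section_integrable1 x)).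
Qed.

Lemma Rintegral_prod21 :
  \int[finite_product m1 m2]_z f z = \int[m2]_y \int[m1]_x f (x, y).
Proof.
rewrite /Rintegral -integral21_prod_meas1//; congr fine.
apply: eq_integral => x _; rewrite fineK//.
exact: (integrable_fin_num _ (section_integrable2 x)).
Qed.

Lemma Rintegral_swap :
  \int[m1]_x \int[m2]_y f (x, y) = \int[m2]_y \int[m1]_x f (x, y).
Proof. by rewrite -Rintegral_prod12 Rintegral_prod21. Qed.

End RealFubini.

Notation "\cint[ mu ]_ x f" := (cintegral mu setT (fun x => f))
  (at level 36, x name, f at level 36, format "'[' \cint[ mu ]_ x '/  '  f ']'").

Section ComplexIntegral.
Context d (T : measurableType d) (R : realType).
Variable mu : {finite_measure set T -> \bar R}.
Implicit Types g h : T -> R[i].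
Notation bm := (@cbounded_measurable d T R).

Lemma cbounded_Re g : bm g -> exists2 M : R, measurable_fun setT (fun x => complex.Re (g x)) &
  forall x, `|complex.Re (g x)| <= M.
Proof.
move=> [[m _] [M gM]]; exists M => // x; exact: le_trans (normr_Re_le _) (gM x).
Qed.

Lemma cbounded_Im g : bm g -> exists2 M : R, measurable_fun setT (fun x => complex.Im (g x)) &
  forall x, `|complex.Im (g x)| <= M.
Proof.
move=> [[_ m] [M gM]]; exists M => // x; exact: le_trans (normr_Im_le _) (gM x).
Qed.

Lemma cbounded_modulusE g : bm g -> exists2 M : R, measurable_fun setT (fun x => modulus (g x)) &
  forall x, `|modulus (g x)| <= M.
Proof.
move=> [m [M gM]]; exists M; first exact: measurable_modulus.
by move=> x; rewrite ger0_norm// modulus_ge0.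
Qed.

Lemma cbounded_modulusX g n : bm g -> exists2 M : R,
  measurable_fun setT (fun x => modulus (g x) ^+ n) &
  forall x, `|modulus (g x) ^+ n| <= M.
Proof.
move=> [m [M gM]]; exists (M ^+ n).
  by apply: measurable_funX; exact: measurable_modulus.
move=> x; rewrite normrX ger0_norm ?modulus_ge0// lerXn2r// nnegrE ?modulus_ge0//.
exact: le_trans (modulus_ge0 _) (gM x).
Qed.

Lemma cbounded_integrable g : bm g -> cintegrable mu setT g.
Proof.
move=> bg; have [M ? ?] := cbounded_Re bg; have [N ? ?] := cbounded_Im bg.
by split; [exact: (@bounded_integrable _ _ _ _ _ M)|exact: (@bounded_integrable _ _ _ _ _ N)].
Qed.

Lemma modulus_integrable g : bm g -> mu.-integrable setT (EFin \o (fun x => modulus (g x))).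
Proof. by move=> /cbounded_modulusE[M m gM]; exact: (@bounded_integrable _ _ _ mu _ M). Qed.

Lemma cintegralD g h : cintegrable mu setT g -> cintegrable mu setT h ->
  \cint[mu]_x (g x + h x) = \cint[mu]_x (g x) + \cint[mu]_x (h x).
Proof.
move=> [g1 g2] [h1 h2]; apply: complex_ext; rewrite /cintegral /=.
- by under eq_Rintegral do rewrite ReD; rewrite RintegralD.
- by under eq_Rintegral do rewrite ImD; rewrite RintegralD.
Qed.

Lemma cintegrableD g h : cintegrable mu setT g -> cintegrable mu setT h ->
  cintegrable mu setT (fun x => g x + h x).
Proof.
move=> [g1 g2] [h1 h2]; split.
- by under eq_fun do rewrite ReD EFinD; exact: integrableD.
- by under eq_fun do rewrite ImD EFinD; exact: integrableD.
Qed.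

Lemma cintegrable_cst0 : cintegrable mu setT (fun _ => 0).
Proof. by split => /=; exact: integrable0. Qed.

Lemma cintegral0 : \cint[mu]_x (0 : R[i]) = 0.
Proof.
by apply: complex_ext; rewrite /cintegral /= Rintegral_cst// mul0r.
Qed.

Lemma cintegrable_sum (I : Type) (r : seq I) (P : pred I) (F : I -> T -> R[i]) :
  (forall i, cintegrable mu setT (F i)) ->
  cintegrable mu setT (fun x => \sum_(i <- r | P i) F i x).
Proof.
move=> iF; elim: r => [|i r IH].
  by under eq_fun do rewrite big_nil; exact: cintegrable_cst0.
under eq_fun do rewrite big_cons.
case: (P i) => //; apply: cintegrableD => //; exact: iF.
Qed.

Lemma cintegral_sum (I : Type) (r : seq I) (P : pred I) (F : I -> T -> R[i]) :
  (forall i, cintegrable mu setT (F i)) ->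
  \cint[mu]_x (\sum_(i <- r | P i) F i x) = \sum_(i <- r | P i) \cint[mu]_x (F i x).
Proof.
move=> iF; elim: r => [|i r IH].
  rewrite [RHS]big_nil -[RHS]cintegral0; congr cintegral.
  by apply/funext => x; rewrite big_nil.
rewrite big_cons -IH.
under [X in cintegral _ _ X]eq_fun do rewrite big_cons.
by case: (P i) => //; rewrite cintegralD//; exact: cintegrable_sum.
Qed.

Lemma cintegralZl (c : R[i]) g : cintegrable mu setT g ->
  \cint[mu]_x (c * g x) = c * \cint[mu]_x (g x).
Proof.
move=> [g1 g2]; apply: complex_ext; rewrite /cintegral ?ReM ?ImM /=.
- under eq_Rintegral do rewrite ReM.
  rewrite RintegralB//; [|exact: integrable_scaleR|exact: integrable_scaleR].
  by rewrite !RintegralZl.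
- under eq_Rintegral do rewrite ImM.
  rewrite RintegralD//; [|exact: integrable_scaleR|exact: integrable_scaleR].
  by rewrite !RintegralZl.
Qed.

Lemma cintegralZr (c : R[i]) g : cintegrable mu setT g ->
  \cint[mu]_x (g x * c) = \cint[mu]_x (g x) * c.
Proof.
by move=> ig; rewrite mulrC -cintegralZl//; congr cintegral; apply/funext => x; rewrite mulrC.
Qed.

Lemma cintegral_real (f : T -> R) : \cint[mu]_x (f x)%:C = (\int[mu]_x f x)%:C.
Proof. by apply: complex_ext; rewrite /cintegral //= Rintegral_cst// mul0r. Qed.

Lemma eq_cintegral g h : g =1 h -> \cint[mu]_x (g x) = \cint[mu]_x (h x).
Proof. by move=> gh; congr cintegral; apply/funext. Qed.

Lemma cintegral_conj g : cintegrable mu setT g ->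
  \cint[mu]_x (g x)^*%C = (\cint[mu]_x (g x))^*%C.
Proof.
move=> [g1 g2]; apply: complex_ext; rewrite /cintegral /=.
  by apply: eq_Rintegral => x _; rewrite Re_conj.
under eq_Rintegral do rewrite Im_conj -mulN1r.
by rewrite RintegralZl// mulN1r.
Qed.

(** Rotating the integral onto the positive half-line reduces this to
    monotonicity for real integrands. *)
Lemma modulus_cintegral g : bm g ->
  modulus (\cint[mu]_x (g x)) <= \int[mu]_x modulus (g x).
Proof.
move=> bg; set z := cintegral _ _ _.
have bug : bm (fun x => unphase z * g x).
  by apply: cboundedM => //; exact: cbounded_cst.
have -> : modulus z = \int[mu]_x complex.Re (unphase z * g x).
  have := cintegralZl (unphase z) (cbounded_integrable bg).
  rewrite -/z unphaseM => /(congr1 (@complex.Re _)) /= <-.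
  by apply: eq_Rintegral.
apply: le_Rintegral => //.
- by have [] := cbounded_integrable bug.
- exact: modulus_integrable.
move=> x _; apply: le_trans (Re_le_modulus _) _.
by rewrite modulusM ler_piMl ?modulus_ge0// unphase_le1.
Qed.

Lemma modulus_cintegral_le g (M : R) : cmeasurable_fun setT g ->
  (forall x, modulus (g x) <= M) ->
  modulus (\cint[mu]_x (g x)) <= M * fine (mu setT).
Proof.
move=> mg gM; have bg : bm g by split => //; exists M.
apply: le_trans (modulus_cintegral bg) _.
rewrite -Rintegral_cst//; apply: le_Rintegral => //.
- exact: modulus_integrable.
- exact: finite_measure_integrable_cst.
Qed.

End ComplexIntegral.

Section ComplexFubini.
Context d1 d2 (T1 : measurableType d1) (T2 : measurableType d2) (R : realType).
Variable m1 : {finite_measure set T1 -> \bar R}.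
Variable m2 : {finite_measure set T2 -> \bar R}.
Variable g : T1 * T2 -> R[i].
Hypothesis bg : cbounded_measurable g.

Lemma cbounded_section1 x : cbounded_measurable (fun y => g (x, y)).
Proof.
by apply: (cbounded_comp (phi := fun y => (x, y)) _ bg); exact: pair1_measurable.
Qed.

Lemma cbounded_section2 y : cbounded_measurable (fun x => g (x, y)).
Proof.
by apply: (cbounded_comp (phi := fun x => (x, y)) _ bg); exact: pair2_measurable.
Qed.

Lemma cbounded_cintegral : cbounded_measurable (fun x => \cint[m2]_y (g (x, y))).
Proof.
have [mg [K gK]] := bg; split; first exact: cmeasurable_cintegral_section.
exists (K * fine (m2 setT)) => x.
by apply: modulus_cintegral_le => //; have [] := cbounded_section1 x.
Qed.

Lemma cintegral_swap : \cint[m1]_x \cint[m2]_y (g (x, y)) =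
  \cint[m2]_y \cint[m1]_x (g (x, y)).
Proof.
have [M m1' b1] := cbounded_Re bg; have [N m2' b2] := cbounded_Im bg.
apply: complex_ext; rewrite /cintegral /=.
- exact: (Rintegral_swap _ _ m1' b1).
- exact: (Rintegral_swap _ _ m2' b2).
Qed.

Lemma cintegral_prod : \cint[finite_product m1 m2]_z (g z) =
  \cint[m1]_x \cint[m2]_y (g (x, y)).
Proof.
have [M m1' b1] := cbounded_Re bg; have [N m2' b2] := cbounded_Im bg.
apply: complex_ext; rewrite /cintegral /=.
- exact: (Rintegral_prod12 _ _ m1' b1).
- exact: (Rintegral_prod12 _ _ m2' b2).
Qed.

End ComplexFubini.

(** * Balanced quadruples of modes *)

Section Combinatorics.
Variable R : realType.

Lemma amgm4 (x y z w : R) :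
  x * y * z * w <= (x ^+ 4 + y ^+ 4 + z ^+ 4 + w ^+ 4) / 4.
Proof.
have h1 := sqr_ge0 (x ^+ 2 - y ^+ 2); have h2 := sqr_ge0 (z ^+ 2 - w ^+ 2).
have h3 := sqr_ge0 (x * y - z * w).
rewrite ler_pdivlMr//; nra.
Qed.

Lemma ler_sum_inj (J K : finType) (P : pred J) (pi : J -> K) (F : K -> R) :
  {in P &, injective pi} -> (forall k, 0 <= F k) ->
  \sum_(q | P q) F (pi q) <= \sum_k F k.
Proof.
move=> injpi F0.
have -> : \sum_(q | P q) F (pi q) = \sum_(k in pi @: finset P) F k.
  rewrite big_imset /=; last by move=> x y; rewrite !inE; exact: injpi.
  by apply: eq_bigl => q; rewrite inE.
rewrite big_mkcond; apply: ler_sum => k _.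
by case: ifP.
Qed.

Lemma sum_triple (I : finType) (F G H : I -> R) :
  \sum_(t : I * I * I) F t.1.1 * G t.1.2 * H t.2 =
  (\sum_i F i) * (\sum_i G i) * (\sum_i H i).
Proof.
rewrite [X in X * _]big_distrlr /= pair_big /= big_distrlr /= pair_big /=.
by apply: eq_bigr => -[[i j] k] _.
Qed.

Section Quadruples.
Variables (I : finType) (e : I -> int).
Hypothesis inje : injective e.

(** The quadruples of modes that interact in the fourth moment of a
    trigonometric polynomial. *)
Definition balanced (q : (I * I) * (I * I)) : bool :=
  e q.1.1 - e q.1.2 + (e q.2.1 - e q.2.2) == 0.

Let proj123 (q : (I * I) * (I * I)) := (q.1.1, q.1.2, q.2.1).
Let proj124 (q : (I * I) * (I * I)) := (q.1.1, q.1.2, q.2.2).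
Let proj213 (q : (I * I) * (I * I)) := (q.1.2, q.1.1, q.2.1).
Let proj342 (q : (I * I) * (I * I)) := (q.2.1, q.2.2, q.1.2).
Let proj431 (q : (I * I) * (I * I)) := (q.2.2, q.2.1, q.1.1).
Let proj134 (q : (I * I) * (I * I)) := (q.1.1, q.2.1, q.2.2).
Let proj234 (q : (I * I) * (I * I)) := (q.1.2, q.2.1, q.2.2).

Let injtac (pi : (I * I) * (I * I) -> I * I * I) :
  (forall a b c d a' b' c' d', balanced (a, b, (c, d)) -> balanced (a', b', (c', d')) ->
    pi (a, b, (c, d)) = pi (a', b', (c', d')) -> [/\ e a = e a', e b = e b', e c = e c' & e d = e d']) ->
  {in balanced &, injective pi}.
Proof.
move=> H [[a b] [c d]] [[a' b'] [c' d']] Hq Hq' E.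
by have [/inje-> /inje-> /inje-> /inje->] := H _ _ _ _ _ _ _ _ Hq Hq' E.
Qed.

Let inj123 : {in balanced &, injective proj123}.
Proof. by apply: injtac => a b c d a' b' c' d' /eqP/= h /eqP/= h' [E1 E2 E3]; subst; split => //; lia. Qed.
Let inj124 : {in balanced &, injective proj124}.
Proof. by apply: injtac => a b c d a' b' c' d' /eqP/= h /eqP/= h' [E1 E2 E3]; subst; split => //; lia. Qed.
Let inj134 : {in balanced &, injective proj134}.
Proof. by apply: injtac => a b c d a' b' c' d' /eqP/= h /eqP/= h' [E1 E2 E3]; subst; split => //; lia. Qed.
Let inj234 : {in balanced &, injective proj234}.
Proof. by apply: injtac => a b c d a' b' c' d' /eqP/= h /eqP/= h' [E1 E2 E3]; subst; split => //; lia. Qed.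
Let inj213 : {in balanced &, injective proj213}.
Proof. by apply: injtac => a b c d a' b' c' d' /eqP/= h /eqP/= h' [E1 E2 E3]; subst; split => //; lia. Qed.
Let inj342 : {in balanced &, injective proj342}.
Proof. by apply: injtac => a b c d a' b' c' d' /eqP/= h /eqP/= h' [E1 E2 E3]; subst; split => //; lia. Qed.
Let inj431 : {in balanced &, injective proj431}.
Proof. by apply: injtac => a b c d a' b' c' d' /eqP/= h /eqP/= h' [E1 E2 E3]; subst; split => //; lia. Qed.

(** Young's inequality for the convolution l^{4/3} * l^{4/3} -> l^2, with
    [a ^+ 3] in place of the sequences: the product of four cubes is the
    geometric mean of the four triple products of fourth powers, and on
    balanced quadruples any three entries determine the fourth. *)
Lemma balanced_cubes (a : I -> R) : (forall i, 0 <= a i) ->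
  \sum_(q | balanced q) (a q.1.1 ^+ 3 * a q.1.2 ^+ 3 * (a q.2.1 ^+ 3 * a q.2.2 ^+ 3))
  <= (\sum_i a i ^+ 4) ^+ 3.
Proof.
move=> a0.
pose F (t : I * I * I) := a t.1.1 ^+ 4 * a t.1.2 ^+ 4 * a t.2 ^+ 4.
have F0 t : 0 <= F t by rewrite /F !mulr_ge0 ?exprn_ge0.
have SF : \sum_t F t = (\sum_i a i ^+ 4) ^+ 3 by rewrite /F (sum_triple (fun i => a i ^+ 4) (fun i => a i ^+ 4) (fun i => a i ^+ 4)); ring.
apply: (@le_trans _ _ (\sum_(q | balanced q)
  (F (proj123 q) + F (proj124 q) + F (proj134 q) + F (proj234 q)) / 4)).
  apply: ler_sum => -[[i j] [k l]] _ /=; rewrite /F /=.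
  have := amgm4 (a i * a j * a k) (a i * a j * a l) (a i * a k * a l) (a j * a k * a l).
  by rewrite !exprMn; apply: le_trans; rewrite le_eqVlt; apply/orP; left; apply/eqP; ring.
rewrite -mulr_suml !big_split /= ler_pdivrMr//.
have := ler_sum_inj inj123 F0; have := ler_sum_inj inj124 F0.
have := ler_sum_inj inj134 F0; have := ler_sum_inj inj234 F0.
rewrite SF; lra.
Qed.

(** A Schur test on the balanced quadruples: in terms of the two gaps that
    appear in the phase, one entry of the quadruple is free and the gaps
    determine the others. *)
Lemma balanced_schur (phi : int -> R) (b : I -> R) (Z : R) :
  (forall n, 0 <= phi n) -> (forall n, phi (- n) = phi n) ->
  (forall i, 0 <= b i) ->
  (forall n, \sum_j phi (n - e j) <= Z) ->
  \sum_(q | balanced q) (phi (e q.1.1 - e q.1.2) * phi (e q.1.1 - e q.2.2) *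
    (b q.1.1 + b q.1.2 + b q.2.1 + b q.2.2)) <= 4 * Z ^+ 2 * \sum_i b i.
Proof.
move=> phi0 phiN b0 phiZ.
have Z0 : 0 <= Z by apply: le_trans (phiZ 0); apply: sumr_ge0.
pose F (t : I * I * I) := b t.1.1 * phi (e t.1.1 - e t.1.2) * phi (e t.1.1 - e t.2).
have F0 t : 0 <= F t by rewrite /F !mulr_ge0.
have SF : \sum_t F t <= Z ^+ 2 * \sum_i b i.
  have -> : \sum_t F t = \sum_i b i * ((\sum_j phi (e i - e j)) * (\sum_j phi (e i - e j))).
    rewrite -(pair_big predT predT (fun ij k => F (ij, k))) /=.
    rewrite -(pair_big predT predT (fun i j => \sum_k F (i, j, k))) /=.
    apply: eq_bigr => i _; rewrite big_distrlr mulr_sumr /=; apply: eq_bigr => j _.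
    by rewrite mulr_sumr; apply: eq_bigr => k _; rewrite /F /= mulrA.
  rewrite mulr_sumr; apply: ler_sum => i _; rewrite mulrC ler_wpM2r//.
  by rewrite expr2 ler_pM ?sumr_ge0.
apply: (@le_trans _ _ (\sum_(q | balanced q)
  (F (proj124 q) + F (proj213 q) + F (proj342 q) + F (proj431 q)))).
  apply: ler_sum => -[[i j] [k l]] /eqP /= bq; rewrite /F /=.
  have {}bq : (e i - e j + (e k - e l))%R = 0 :> int by [].
  have -> : e j - e i = - (e i - e j) by lia.
  have -> : e j - e k = e i - e l by lia.
  have -> : e k - e l = - (e i - e j) by lia.
  have -> : e k - e j = - (e i - e l) by lia.
  have -> : e l - e k = e i - e j by lia.
  have -> : e l - e i = - (e i - e l) by lia.
  by rewrite !phiN; rewrite le_eqVlt; apply/orP; left; apply/eqP; ring.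
rewrite !big_split /=.
have := ler_sum_inj inj124 F0; have := ler_sum_inj inj213 F0.
have := ler_sum_inj inj342 F0; have := ler_sum_inj inj431 F0.
rewrite -mulrA; move: SF; set z := Z ^+ 2 * _; lra.
Qed.

(** The phase of a balanced quadruple is twice the product of its two gaps, so
    a decay in the phase is a decay in each gap separately. *)
Lemma balanced_phase q : balanced q ->
  e q.1.1 ^+ 2 - e q.1.2 ^+ 2 + (e q.2.1 ^+ 2 - e q.2.2 ^+ 2) =
  2 * (e q.1.1 - e q.1.2) * (e q.1.1 - e q.2.2).
Proof.
case: q => [[i j] [k l]] /eqP /= bq.
have -> : e k = e j - e i + e l by lia.
ring.
Qed.

(** A balanced quadruple with a vanishing gap has a vanishing phase; as [e] is
    injective, these degenerate quadruples form a family with two free modes. *)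
Lemma balanced_pair12 i j k l : balanced (i, j, (k, l)) -> i = j -> k = l.
Proof. by move=> /eqP /= b ij; apply: inje; subst; lia. Qed.

Lemma balanced_pair14 i j k l : balanced (i, j, (k, l)) -> i = l -> j = k.
Proof. by move=> /eqP /= b ij; apply: inje; subst; lia. Qed.

End Quadruples.
End Combinatorics.

(** * Restricted measures and the circle *)

Section RestrictedMeasure.
Context d (T : measurableType d) (R : realType).
Variables (mu : {measure set T -> \bar R}) (D : set T) (mD : measurable D).
Hypothesis moo : (mu D < +oo)%E.

Definition restricted_measure : {finite_measure set T -> \bar R} := mfrestr mD moo.
Local Notation nu := restricted_measure.

Lemma ge0_integral_mfrestr (f : T -> \bar R) : measurable_fun setT f ->
  (forall x, (0 <= f x)%E) -> (\int[nu]_x f x = \int[mu]_(x in D) f x)%E.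
Proof.
move=> mf f0.
have mDC : measurable (~` D) by exact: measurableC.
have nDC : nu (~` D) = 0%E by rewrite /= /mfrestr /mrestr setICl.
rewrite (@ge0_negligible_integral _ _ _ nu setT (~` D))//.
rewrite setTD setCK; apply: eq_measure_integral => A mA AD.
by rewrite /= /mfrestr /mrestr setIidl.
Qed.

Lemma integral_mfrestr (f : T -> \bar R) : measurable_fun setT f ->
  (\int[nu]_x f x = \int[mu]_(x in D) f x)%E.
Proof.
move=> mf; rewrite [LHS]integralE [RHS]integralE.
by rewrite !ge0_integral_mfrestr//; [exact: measurable_funeneg|exact: measurable_funepos].
Qed.

Lemma integrable_mfrestr (f : T -> \bar R) : measurable_fun setT f ->
  nu.-integrable setT f <-> mu.-integrable D f.
Proof.
move=> mf; have E := @ge0_integral_mfrestr (abse \o f) (measurableT_comp _ mf) (fun x => abse_ge0 _).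
split => /integrableP[_ foo]; apply/integrableP; split => //.
- exact: measurable_funTS.
- by rewrite -E.
- by rewrite E.
Qed.

Lemma cintegral_mfrestr (g : T -> R[i]) : cmeasurable_fun setT g ->
  cintegral nu setT g = cintegral mu D g.
Proof.
move=> [g1 g2]; rewrite /cintegral /Rintegral.
by rewrite !integral_mfrestr//; exact/measurable_EFinP.
Qed.

End RestrictedMeasure.

Section CircleMeasure.
Variable R : realType.

Lemma measurable_circle : measurable (@circle R).
Proof. exact: measurable_itv. Qed.

Lemma leb_circle : lebesgue_measure (@circle R) = (2 * pi)%:E.
Proof.
rewrite /circle lebesgue_measure_itv /= lte_fin mulr_gt0 ?pi_gt0//.
by rewrite oppr0 adde0.
Qed.

Lemma leb_circle_lty : (lebesgue_measure (@circle R) < +oo)%E.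
Proof. by rewrite leb_circle ltry. Qed.

Definition circle_measure : {finite_measure set (measurableTypeR R) -> \bar R} :=
  @restricted_measure _ _ R lebesgue_measure _ measurable_circle leb_circle_lty.

Lemma circle_measureT : circle_measure setT = (2 * pi)%:E.
Proof. by rewrite /= /mfrestr /mrestr setTI leb_circle. Qed.

Lemma cis_int_pi (m : int) : cis (m%:~R * (2 * pi)) = 1 :> R[i].
Proof.
have nat_case (n : nat) : cis (n%:R * (2 * pi)) = 1 :> R[i].
  elim: n => [|n IH]; first by rewrite mul0r cis0.
  rewrite -natr1 mulrDl mul1r cisD IH mul1r /cis [2 * pi]mulr_natl.
  by rewrite -[pi *+ 2]add0r cosD2pi sinD2pi cos0 sin0.
case: m => n; first exact: nat_case.
by rewrite NegzE mulrNz mulNr -conj_cis nat_case conjc1.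
Qed.

(** For [m != 0] the antiderivatives take the same value at both ends of the
    period. *)
Lemma cintegral_character (m : int) :
  \cint[circle_measure]_x cis (m%:~R * x : R) = (if m == 0 then 2 * pi else 0)%:C.
Proof.
case: eqVneq => [->|m0].
  transitivity (\cint[circle_measure]_x ((1 : R)%:C : R[i])).
    by apply: eq_cintegral => x; rewrite mul0r cis0.
  by rewrite cintegral_real Rintegral_cst// [X in fine X]circle_measureT mul1r.
have mR : (m%:~R : R) != 0 by rewrite intr_eq0.
rewrite cintegral_mfrestr; last first.
  by apply: cmeasurable_cis; exact: mulrl_measurable.
have pi2 : (0 : R) < 2 * pi by rewrite mulr_gt0 ?pi_gt0.
have dm (x : R) : is_derive x 1 (fun x : R => m%:~R * x : R) m%:~R.
  have := @is_deriveZ R R _ id m%:~R x 1 _ (is_derive_id _ _).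
  by rewrite /GRing.scale /= mulr1.
have key (f F : R -> R) : (forall x : R, is_derive x 1 F (f x)) -> continuous f ->
    F 0 = F (2 * pi) -> \int[leb]_(x in @circle R) f x = 0.
  move=> dF cf F0.
  have cF : continuous F by move=> x; apply: differentiable_continuous; apply/derivable1_diffP.
  rewrite /Rintegral /circle integral_itv_bndo_bndc; last first.
    by apply/measurable_EFinP/measurable_funTS; exact: continuous_measurable_fun.
  rewrite (@continuous_FTC2 _ f F)//.
  - by rewrite -EFinB F0 subrr.
  - by apply: continuous_subspaceT.
  - split.
    + by move=> x _; have [] := dF x.
    + by apply: cvg_at_right_filter; exact: cF.
    + by apply: cvg_at_left_filter; exact: cF.
  - by move=> x _; rewrite derive1E; apply: derive_val.
apply: complex_ext; rewrite /cintegral /cis /=.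
- apply: (key _ (fun x => m%:~R^-1 * sin (m%:~R * x))).
  + move=> x.
    have D1 := is_derive1_comp (is_derive_sin (m%:~R * x)) (dm x).
    have := @is_deriveZ R R R _ m%:~R^-1 x 1 _ D1.
    by rewrite /GRing.scale /= mulrCA mulVf// mulr1.
  + move=> x. apply: continuous_comp; [exact: mulrl_continuous|exact: continuous_cos].
  + by have [_ ->] := cis_int_pi m; rewrite mulr0 sin0.
- apply: (key _ (fun x => - (m%:~R^-1 * cos (m%:~R * x)))).
  + move=> x.
    have D1 := is_derive1_comp (is_derive_cos (m%:~R * x)) (dm x).
    have := is_deriveN (@is_deriveZ R R R _ m%:~R^-1 x 1 _ D1).
    by rewrite /GRing.scale /= mulrCA mulVf// mulr1 opprK.
  + move=> x. apply: continuous_comp; [exact: mulrl_continuous|exact: continuous_sin].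
  + by have [-> _] := cis_int_pi m; rewrite mulr0 cos0.
Qed.
End CircleMeasure.

(** * Trigonometric polynomials and the inequality of Hoelder *)

Section TrigonometricPolynomials.
Variables (R : realType) (I : finType) (e : I -> int).
Hypothesis inje : injective e.
Implicit Types (a : I -> R[i]) (x : R).
Notation mc := (circle_measure R).

Definition trigpoly a x : R[i] := \sum_i a i * cis ((e i)%:~R * x).

Lemma cbounded_trigpoly a : cbounded_measurable (trigpoly a : measurableTypeR R -> R[i]).
Proof.
apply: cbounded_sum => i; apply: cboundedM; first exact: cbounded_cst.
by apply: cbounded_cis; exact: mulrl_measurable.
Qed.

Lemma cbounded_character (m : int) :
  cbounded_measurable (fun x : measurableTypeR R => cis (m%:~R * x) : R[i]).
Proof. by apply: cbounded_cis; exact: mulrl_measurable. Qed.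

Lemma trigpoly_mul_conj a x : trigpoly a x * (trigpoly a x)^*%C =
  \sum_(p : I * I) a p.1 * (a p.2)^*%C * cis ((e p.1 - e p.2)%:~R * x).
Proof.
rewrite /trigpoly conj_sum big_distrlr /= pair_big /=.
apply: eq_bigr => -[i j] _ /=; rewrite conjM conj_cis intrB mulrBl cisD.
ring.
Qed.

Lemma modulus4 (z : R[i]) : (modulus z ^+ 4)%:C = (z * z^*%C) * (z * z^*%C).
Proof. by rewrite !mul_conj -rmorphM /= -exprD. Qed.

Lemma trigpoly_L4 a : (\int[mc]_x modulus (trigpoly a x) ^+ 4)%:C =
  (2 * pi)%:C * \sum_(q | balanced e q)
    (a q.1.1 * (a q.1.2)^*%C * (a q.2.1 * (a q.2.2)^*%C)).
Proof.
rewrite -cintegral_real.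
transitivity (\cint[mc]_x (\sum_(q : (I * I) * (I * I))
    (a q.1.1 * (a q.1.2)^*%C * (a q.2.1 * (a q.2.2)^*%C)) *
     cis ((e q.1.1 - e q.1.2 + (e q.2.1 - e q.2.2))%:~R * x))).
  apply: eq_cintegral => x.
  rewrite modulus4 trigpoly_mul_conj big_distrlr /= pair_big /=.
  by apply: eq_bigr => -[[i j] [k l]] _ /=; rewrite [in RHS]intrD mulrDl cisD; ring.
rewrite cintegral_sum; last first.
  move=> q; apply: cbounded_integrable; apply: cboundedM; first exact: cbounded_cst.
  exact: cbounded_character.
rewrite mulr_sumr [RHS]big_mkcond /=; apply: eq_bigr => q _.
rewrite cintegralZl; last by apply: cbounded_integrable; exact: cbounded_character.
rewrite cintegral_character /balanced.
by case: ifP => _; rewrite ?mulr0// mulrC.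
Qed.

Lemma trigpoly_L2 a : \int[mc]_x (modulus (trigpoly a x) ^+ 2) =
  2 * pi * \sum_i modulus (a i) ^+ 2.
Proof.
suff : (\int[mc]_x modulus (trigpoly a x) ^+ 2)%:C =
    ((2 * pi) * \sum_i modulus (a i) ^+ 2)%:C by move=> [].
rewrite -cintegral_real.
transitivity (\cint[mc]_x (\sum_(p : I * I)
    (a p.1 * (a p.2)^*%C) * cis ((e p.1 - e p.2)%:~R * x))).
  by apply: eq_cintegral => x; rewrite -mul_conj trigpoly_mul_conj.
rewrite cintegral_sum; last first.
  move=> q; apply: cbounded_integrable; apply: cboundedM; first exact: cbounded_cst.
  exact: cbounded_character.
rewrite mulr_sumr rmorph_sum -(pair_big predT predT (fun i j =>
  cintegral mc setT (fun x => a i * (a j)^*%C * cis ((e i - e j)%:~R * x)))) /=.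
apply: eq_bigr => i _; rewrite (bigD1 i)//= [X in _ + X]big1 ?addr0.
  rewrite cintegralZl; last by apply: cbounded_integrable; exact: cbounded_character.
  by rewrite cintegral_character subrr eqxx mul_conj -rmorphM mulrC.
move=> j ji; rewrite cintegralZl; last by apply: cbounded_integrable; exact: cbounded_character.
rewrite cintegral_character subr_eq0 (inj_eq inje) eq_sym (negbTE ji).
by rewrite mulr0.
Qed.

Lemma trigpoly_L4_le a : \int[mc]_x (modulus (trigpoly a x) ^+ 4) <=
  2 * pi * \sum_(q | balanced e q) (modulus (a q.1.1) * modulus (a q.1.2) *
    (modulus (a q.2.1) * modulus (a q.2.2))).
Proof.
have := congr1 (@complex.Re R) (trigpoly_L4 a); rewrite /= => ->.
rewrite ReM /= mul0r subr0 ler_pM2l ?mulr_gt0 ?pi_gt0//.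
apply: le_trans (Re_le_modulus _) _.
apply: le_trans (modulus_sum _ _ _) _; apply: ler_sum => q _.
by rewrite !modulusM !modulus_conj.
Qed.

Definition nonresonant (q : (I * I) * (I * I)) : bool :=
  balanced e q && ((q.1.1 != q.1.2) && (q.1.1 != q.2.2)).

Definition interaction a (q : (I * I) * (I * I)) : R[i] :=
  a q.1.1 * (a q.1.2)^*%C * (a q.2.1 * (a q.2.2)^*%C).

(** The resonant interactions pair up the entries, which leaves the square of
    the l^2 norm, once for each of the two pairings. *)
Lemma Re_balanced_le a : complex.Re (\sum_(q | balanced e q) interaction a q) <=
  2 * (\sum_i modulus (a i) ^+ 2) ^+ 2 + complex.Re (\sum_(q | nonresonant q) interaction a q).
Proof.
rewrite (bigID (fun q : (I * I) * (I * I) => (q.1.1 != q.1.2) && (q.1.1 != q.2.2))) /=.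
rewrite ReD addrC lerD2r.
apply: le_trans (Re_le_modulus _) _; apply: le_trans (modulus_sum _ _ _) _.
pose F (p : I * I) : R := modulus (a p.1) ^+ 2 * modulus (a p.2) ^+ 2.
have F0 p : 0 <= F p by rewrite mulr_ge0 ?sqr_ge0.
have SF : \sum_p F p = (\sum_i modulus (a i) ^+ 2) ^+ 2.
  by rewrite expr2 big_distrlr /= pair_big.
have mI q : modulus (interaction a q) = modulus (a q.1.1) * modulus (a q.1.2) *
    (modulus (a q.2.1) * modulus (a q.2.2)).
  exact: modulus_quartic.
rewrite (bigID (fun q : (I * I) * (I * I) => q.1.1 == q.1.2)) /= mulr_natl mulr2n -SF.
apply: lerD.
- apply: (@le_trans _ _ (\sum_(q | balanced e q && (q.1.1 == q.1.2)) F (q.1.1, q.2.1))).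
    rewrite big_mkcond [leRHS]big_mkcond; apply: ler_sum => -[[i j] [k l]] _ /=.
    have [bq|] := boolP (balanced e (i, j, (k, l))) => //=.
    have [ij|] := eqVneq i j; last by rewrite !andbF.
    rewrite andbT /= mI /=; move: bq; rewrite ij => bq.
    by rewrite -(balanced_pair12 inje bq erefl) -!expr2.
  apply: (ler_sum_inj (pi := fun q : (I * I) * (I * I) => (q.1.1, q.2.1))) => //.
  move=> [[i j] [k l]] [[i' j'] [k' l']] /andP[bq /eqP/= ij] /andP[bq' /eqP/= ij'] [ii kk].
  subst; have := balanced_pair12 inje bq erefl; have := balanced_pair12 inje bq' erefl.
  by move=> <- <-.
- apply: (@le_trans _ _ (\sum_(q | balanced e q && (q.1.1 == q.2.2)) F (q.1.1, q.1.2))).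
    rewrite big_mkcond [leRHS]big_mkcond; apply: ler_sum => -[[i j] [k l]] _ /=.
    have [bq|] := boolP (balanced e (i, j, (k, l))) => //=.
    have [il|] := eqVneq i l; last first.
      by case: (eqVneq i j) => //=.
    rewrite andbF /= mI /=; move: bq; rewrite -il => bq.
    case: ifP => _; last exact: F0.
    by rewrite -(balanced_pair14 inje bq erefl) le_eqVlt /F /=; apply/orP; left; apply/eqP; ring.
  apply: (ler_sum_inj (pi := fun q : (I * I) * (I * I) => (q.1.1, q.1.2))) => //.
  move=> [[i j] [k l]] [[i' j'] [k' l']] /andP[bq /eqP/= ij] /andP[bq' /eqP/= ij'] [ii kk].
  subst; have := balanced_pair14 inje bq erefl; have := balanced_pair14 inje bq' erefl.
  by move=> <- <-.
Qed.

End TrigonometricPolynomials.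

Section Hoelder.
Context d (T : measurableType d) (R : realType).
Variable mu : {finite_measure set T -> \bar R}.

Lemma Lnorm_bounded (f : T -> R) (M r : R) : 0 < r ->
  measurable_fun setT f -> (forall x, 0 <= f x <= M) ->
  Lnorm mu r%:E (EFin \o f) = ((\int[mu]_x (f x `^ r)) `^ r^-1)%:E.
Proof.
move=> r0 mf f0; rewrite unlock /=.
have fi : mu.-integrable setT (EFin \o (fun x => f x `^ r)).
  apply: (@bounded_integrable _ _ _ _ _ (M `^ r)).
    exact: (measurableT_comp (@measurable_powR R r) mf).
  move=> x; have /andP[? fM] := f0 x; rewrite ger0_norm ?powR_ge0//.
  by rewrite ge0_ler_powR ?nnegrE ?(ltW r0)// (le_trans _ fM).
rewrite (_ : (\int[mu]_x _)%E = (\int[mu]_x (f x `^ r))%:E); first by rewrite poweR_EFin.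
rewrite /Rintegral fineK; last exact: integrable_fin_num.
apply: eq_integral => x _ /=; rewrite ger0_norm ?poweR_EFin//.
by have /andP[] := f0 x.
Qed.

(** Hoelder's inequality for the exponents 4/3 and 4, raised to the fourth
    power so that only integer powers of the two integrals remain. *)
Lemma hoelder43 (p q : T -> R) (M N : R) :
  measurable_fun setT p -> (forall x, 0 <= p x <= M) ->
  measurable_fun setT q -> (forall x, 0 <= q x <= N) ->
  (\int[mu]_x (p x * q x)) ^+ 4 <=
  (\int[mu]_x (p x `^ (4 / 3))) ^+ 3 * \int[mu]_x (q x ^+ 4).
Proof.
move=> mp p0 mq q0.
have e43 : (0 : R) < 4 / 3 by rewrite divr_gt0.
have econj : (4 / 3)^-1 + 4^-1 = 1 :> R by rewrite invf_div; field.
have e3 : (4 / 3)^-1 * 4 = 3 :> R by rewrite invf_div; field.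
have := @hoelder _ _ _ mu p q (4 / 3) 4 mp mq.
rewrite (Lnorm_bounded _ mp p0)// (Lnorm_bounded _ mq q0)//.
have pq0 x : 0 <= p x * q x <= M * N.
  have /andP[? ?] := p0 x; have /andP[? ?] := q0 x.
  by rewrite mulr_ge0//= ler_pM.
rewrite (Lnorm_bounded _ _ pq0)//; last exact: measurable_funM.
rewrite -EFinM lee_fin invr1 [X in X <= _]powRr1; last first.
  by apply: Rintegral_ge0 => x _; exact: powR_ge0.
under eq_Rintegral do rewrite powRr1 ?(proj1 (andP (pq0 _)))//.
have -> : \int[mu]_x (q x `^ 4) = \int[mu]_x (q x ^+ 4).
  by apply: eq_Rintegral => x _; rewrite -powR_mulrn// (proj1 (andP (q0 x))).
move=> /(_ e43 (ltr0n _ 4) econj) h.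
have B0 : 0 <= \int[mu]_x (q x ^+ 4).
  by apply: Rintegral_ge0 => x _; rewrite exprn_ge0// (proj1 (andP (q0 x))).
have A0 : 0 <= \int[mu]_x (p x `^ (4 / 3)).
  by apply: Rintegral_ge0 => x _; exact: powR_ge0.
have C0 : 0 <= \int[mu]_x (p x * q x).
  by apply: Rintegral_ge0 => x _; rewrite (proj1 (andP (pq0 x))).
apply: (@le_trans _ _ (((\int[mu]_x (p x `^ (4 / 3))) `^ (4 / 3)^-1 *
   (\int[mu]_x (q x ^+ 4)) `^ 4^-1) ^+ 4)).
  by apply: lerXn2r => //; rewrite nnegrE mulr_ge0 ?powR_ge0.
have r4 (x r : R) : (x `^ r) ^+ 4 = x `^ (r * 4) by rewrite -powR_mulrn ?powR_ge0// -powRrM.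
by rewrite exprMn !r4 mulVf// powRr1// e3 (powR_mulrn 3 A0).
Qed.

End Hoelder.

(** * Primitives in time *)

Section Primitives.
Variable R : realType.
Notation RR := (measurableTypeR R).
Variable lam : {finite_measure set RR -> \bar R}.
Hypothesis atomless : forall s : R, lam [set s] = 0.
Notation bm := (@cbounded_measurable _ RR R).
Implicit Types h : R -> R[i].

Definition step (s t : R) : R := if (0 <= s) && (s <= t) then 1 else 0.

Definition primitive h (t : R) : R[i] := \cint[lam]_s ((step s t)%:C * h s).

Definition mass h : R := \int[lam]_s modulus (h s).

(** The derivative of a product of primitives. *)
Definition leibniz (a b : R -> R[i]) (s : R) : R[i] :=
  a s * primitive b s + primitive a s * b s.

Lemma measurable_step : measurable_fun setT (fun z : RR * RR => step z.1 z.2).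
Proof.
apply: measurable_fun_ifT => //; apply: measurable_and.
  by apply: measurable_fun_ler => //; exact: measurable_fst.
apply: measurable_fun_ler; [exact: measurable_fst|exact: measurable_snd].
Qed.

Lemma step_ge0 s t : 0 <= step s t.
Proof. by rewrite /step; case: ifP. Qed.

Lemma step_le1 s t : `|step s t| <= 1.
Proof. by rewrite /step; case: ifP; rewrite ?normr1 ?normr0. Qed.

Lemma cbounded_step : cbounded_measurable (fun z : RR * RR => (step z.1 z.2)%:C).
Proof. by apply: (@cbounded_real _ _ _ _ 1); [exact: measurable_step|move=> z; exact: step_le1]. Qed.

Lemma cbounded_step1 t : bm (fun s => (step s t)%:C).
Proof. exact: (cbounded_section2 cbounded_step t). Qed.

Lemma cbounded_param_primitive d (X : measurableType d) (h : X * RR -> R[i]) :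
  cbounded_measurable h ->
  cbounded_measurable (fun z : X * RR => primitive (fun s => h (z.1, s)) z.2).
Proof.
move=> bh.
have b : cbounded_measurable
    (fun z : X * RR * RR => (step z.2 z.1.2)%:C * h (z.1.1, z.2)); last first.
  exact: (cbounded_cintegral lam b).
apply: cboundedM.
  apply: (cbounded_comp (phi := fun z : (X * RR) * RR => (z.2, z.1.2)) _ cbounded_step).
  apply: measurable_fun_pair; first exact: measurable_snd.
  by apply: (measurableT_comp measurable_snd); exact: measurable_fst.
apply: (cbounded_comp (phi := fun z : (X * RR) * RR => (z.1.1, z.2)) _ bh).
apply: measurable_fun_pair; last exact: measurable_snd.
by apply: (measurableT_comp measurable_fst); exact: measurable_fst.
Qed.

Lemma cbounded_primitive h : bm h -> bm (primitive h).
Proof.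
move=> bh; have b : cbounded_measurable
    (fun z : RR * RR => (step z.2 z.1)%:C * h z.2); last first.
  exact: (cbounded_cintegral lam b).
apply: cboundedM.
  apply: (cbounded_comp (phi := fun z : RR * RR => (z.2, z.1)) _ cbounded_step).
  by apply: measurable_fun_pair; [exact: measurable_snd|exact: measurable_fst].
by apply: (cbounded_comp (phi := fun z : RR * RR => z.2) _ bh); exact: measurable_snd.
Qed.

Lemma cbounded_leibniz a b : bm a -> bm b -> bm (leibniz a b).
Proof.
by move=> ba bb; apply: cboundedD; apply: cboundedM => //; exact: cbounded_primitive.
Qed.

Lemma mass_ge0 h : 0 <= mass h.
Proof. by apply: Rintegral_ge0 => s _; exact: modulus_ge0. Qed.

Lemma modulus_primitive_le_int h t : bm h ->
  modulus (primitive h t) <= mass h.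
Proof.
move=> bh; have bsh : bm (fun s => (step s t)%:C * h s).
  by apply: cboundedM => //; exact: cbounded_step1.
apply: le_trans (modulus_cintegral _ bsh) _; apply: le_Rintegral => //.
- exact: modulus_integrable.
- exact: modulus_integrable.
by move=> s _; rewrite modulusM modulus_real ler_piMl ?modulus_ge0// step_le1.
Qed.

Lemma mass_leibniz a b : bm a -> bm b -> mass (leibniz a b) <= 2 * mass a * mass b.
Proof.
move=> ba bb.
have mi h : bm h -> lam.-integrable setT (EFin \o (fun x => modulus (h x))).
  by move=> bh; exact: modulus_integrable.
have iZ (c : R) h : bm h -> lam.-integrable setT (EFin \o (fun s => c * modulus (h s))).
  move=> bh; rewrite (_ : EFin \o _ = fun x => c%:E * (modulus (h x))%:E)%E; last first.
    by apply/funext => x /=; rewrite EFinM.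
  by apply: integrableZl => //; exact: mi.
apply: (@le_trans _ _ (\int[lam]_s (mass b * modulus (a s) + mass a * modulus (b s)))).
  apply: le_Rintegral => //.
  - by apply: mi; exact: cbounded_leibniz.
  - rewrite (_ : EFin \o _ = (EFin \o (fun s => mass b * modulus (a s))%R) \+
      (EFin \o (fun s => mass a * modulus (b s))%R))%E; last by apply/funext => s /=; rewrite EFinD.
    by apply: integrableD => //; exact: iZ.
  move=> s _; apply: le_trans (modulusD _ _) _; rewrite !modulusM; apply: lerD.
    by rewrite mulrC ler_wpM2r ?modulus_ge0// modulus_primitive_le_int.
  by rewrite ler_wpM2r ?modulus_ge0// modulus_primitive_le_int.
rewrite RintegralD//; [|exact: iZ|exact: iZ].
rewrite !RintegralZl//; [|exact: mi|exact: mi].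
by rewrite -/(mass a) -/(mass b) le_eqVlt; apply/orP; left; apply/eqP; ring.
Qed.

(** Both factors are integrals over [s <= t]; the square [[s, r <= t]] is cut
    along its diagonal, which is a null set. *)
Lemma primitiveM a b t : bm a -> bm b ->
  primitive a t * primitive b t = primitive (leibniz a b) t.
Proof.
move=> ba bb.
have st := cbounded_step1 t.
have bpa := cbounded_primitive ba; have bpb := cbounded_primitive bb.
have bsa : bm (fun s => (step s t)%:C * a s) by exact: cboundedM.
have bsb r : bm (fun s => (step s r)%:C * b s) by apply: cboundedM => //; exact: cbounded_step1.
have bsa' r : bm (fun s => (step s r)%:C * a s) by apply: cboundedM => //; exact: cbounded_step1.
have c1 : measurable_fun setT (fst : RR * RR -> RR) by exact: measurable_fst.
have c2 : measurable_fun setT (snd : RR * RR -> RR) by exact: measurable_snd.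
have mswap : measurable_fun setT (fun z : RR * RR => (z.2, z.1)) by exact: measurable_fun_pair.
pose k1 (z : RR * RR) : R[i] := (step z.1 t)%:C * (step z.2 z.1)%:C * (a z.1 * b z.2).
pose k2 (z : RR * RR) : R[i] := (step z.2 t)%:C * (step z.1 z.2)%:C * (a z.1 * b z.2).
have bz : cbounded_measurable (fun z : RR * RR => a z.1 * b z.2).
  apply: cboundedM; first exact: (cbounded_comp c1 ba).
  exact: (cbounded_comp c2 bb).
have bk1 : cbounded_measurable k1.
  apply: cboundedM => //; apply: cboundedM; first exact: (cbounded_comp c1 st).
  exact: (cbounded_comp mswap cbounded_step).
have bk2 : cbounded_measurable k2.
  apply: cboundedM => //; apply: cboundedM; first exact: (cbounded_comp c2 st).
  exact: cbounded_step.
have E1 : primitive (fun s => a s * primitive b s) t =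
    \cint[lam]_s \cint[lam]_r (k1 (s, r)).
  apply: eq_cintegral => s; rewrite mulrA /primitive -cintegralZl; last exact: cbounded_integrable.
  by apply: eq_cintegral => r; rewrite /k1 /=; ring.
have E2 : primitive (fun s => primitive a s * b s) t =
    \cint[lam]_s \cint[lam]_r (k2 (s, r)).
  rewrite (cintegral_swap _ _ bk2).
  apply: eq_cintegral => s; rewrite /primitive [X in _ * X]mulrC mulrA -cintegralZl; last exact: cbounded_integrable.
  by apply: eq_cintegral => r; rewrite /k2 /=; ring.
have -> : primitive (leibniz a b) t =
    primitive (fun s => a s * primitive b s) t + primitive (fun s => primitive a s * b s) t.
  rewrite /primitive -cintegralD; last 2 first.
  - by apply: cbounded_integrable; do 2 apply: cboundedM => //.
  - by apply: cbounded_integrable; do 2 apply: cboundedM => //.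
  by apply: eq_cintegral => s; rewrite mulrDr.
rewrite E1 E2 -cintegralD; last 2 first.
- apply: cbounded_integrable; exact: (cbounded_cintegral _ bk1).
- apply: cbounded_integrable; exact: (cbounded_cintegral _ bk2).
rewrite /primitive -cintegralZr; last exact: cbounded_integrable.
apply: eq_cintegral => s.
rewrite -cintegralZl; last exact: cbounded_integrable.
rewrite -cintegralD; last 2 first.
- by apply: cbounded_integrable; exact: (cbounded_section1 bk1).
- by apply: cbounded_integrable; exact: (cbounded_section1 bk2).
(* the two kernels overlap only at r = s *)
pose dg (r : R) : R[i] := (step s t)%:C * a s * b s * (\1_[set s] r)%:C.
have bdg : bm dg.
  apply: cboundedM; first exact: cbounded_cst.
  apply: (@cbounded_real _ _ _ _ 1); first exact: measurable_indic.
  by move=> r; rewrite indicE; case: (r \in _); rewrite ?normr1 ?normr0.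
have dg0 : \cint[lam]_r (dg r) = 0.
  rewrite /dg cintegralZl; last first.
    apply: cbounded_integrable; apply: (@cbounded_real _ _ _ _ 1); first exact: measurable_indic.
    by move=> r; rewrite indicE; case: (r \in _); rewrite ?normr1 ?normr0.
  rewrite cintegral_real /Rintegral integral_indic//= setIT [X in fine X]atomless.
  by rewrite mulr0.
rewrite -[LHS]addr0 -dg0 -cintegralD; last 2 first.
- by apply: cbounded_integrable; apply: cboundedM => //; exact: cbounded_cst.
- exact: cbounded_integrable.
apply: eq_cintegral => r; rewrite /k1 /k2 /dg /= indicE in_set1.
have [->|rs] := eqVneq r s.
  have s1 : (step s t)%:C * (step s s)%:C = (step s t)%:C :> R[i].
    rewrite -rmorphM /step lexx andbT.
    by case: (0 <= s); rewrite /= ?mul0r ?mulr1.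
  have s2 : (step s t)%:C * (step s t)%:C = (step s t)%:C :> R[i].
    by rewrite -rmorphM /step; case: ifP; rewrite ?mulr1 ?mulr0.
  by rewrite rmorph1 /= s1 mulrACA s2; ring.
have K : (step r t)%:C * (step s t)%:C =
    (step s t)%:C * (step r s)%:C + (step r t)%:C * (step s r)%:C :> R[i].
  rewrite -!rmorphM -rmorphD; congr (_%:C); move: rs; rewrite /step.
  case: (leP 0 r) => r0; case: (leP 0 s) => s0; rewrite /= ?(mulr0, mul0r, addr0)//.
  case: (ltgtP r s) => // [rs|sr] _; rewrite mulr1 mulr0 ?addr0 ?add0r.
    by case: (leP s t) => st'; rewrite ?mulr0// (le_trans (ltW rs) st') mulr1.
  by case: (leP r t) => rt; rewrite ?mul0r// (le_trans (ltW sr) rt) mulr1.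
by rewrite (_ : (false%:R)%:C = 0 :> R[i])// mulr0 addr0 -mulrDl -K; ring.
Qed.

Lemma primitive_conj h t : bm h -> (primitive h t)^*%C = primitive (fun s => (h s)^*%C) t.
Proof.
move=> bh; rewrite /primitive -cintegral_conj; last first.
  by apply: cbounded_integrable; apply: cboundedM => //; exact: cbounded_step1.
by apply: eq_cintegral => s; rewrite conjM; congr (_ * _); apply: complex_ext; rewrite /= ?oppr0.
Qed.

End Primitives.

Arguments primitive : simpl never.
Arguments leibniz : simpl never.

(** * The Duhamel integral of a bounded source along one path *)

Section Pathwise.
Variables (R : realType) (I : finType) (e : I -> int).
Hypothesis inje : injective e.
Notation RR := (measurableTypeR R).
Variable lam : {finite_measure set RR -> \bar R}.
Hypothesis atomless : forall s : R, lam [set s] = 0.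
Notation mc := (circle_measure R).
Notation ltime := (fine (lam setT)).
Notation c0 := ((2 * pi)^-1 : R).
Notation bm := (@cbounded_measurable _ RR R).
Variable f : RR * RR -> R[i].
Hypothesis bf : cbounded_measurable f.
Variable W : RR -> R.
Hypothesis mW : measurable_fun setT W.

Definition coef (k : int) (s : RR) : R[i] :=
  c0%:C * \cint[mc]_x (cis (- (k%:~R * x)) * f (s, x)).

(** The Duhamel integral in the interaction picture: conjugating by the
    propagator leaves a primitive in time. *)
Definition twisted_coef (k : int) (s : RR) : R[i] :=
  cis (- (k%:~R ^+ 2 * W s)) * coef k s.

Definition duhamel (k : int) (t : RR) : R[i] :=
  cis (k%:~R ^+ 2 * W t) * primitive lam (twisted_coef k) t.

Definition field (t x : RR) : R[i] := trigpoly e (fun i => duhamel (e i) t) x.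

Definition source43 : R :=
  (\int[finite_product lam mc]_z (modulus (f z) `^ (4 / 3))) ^+ 3.

Definition field4 : R :=
  \int[finite_product lam mc]_z (modulus (field z.1 z.2) ^+ 4).

Let c0_gt0 : 0 < c0. Proof. by rewrite invr_gt0 mulr_gt0 ?pi_gt0. Qed.

Lemma cbounded_coef k : bm (coef k).
Proof.
apply: cboundedM; first exact: cbounded_cst.
have b : cbounded_measurable (fun z : RR * RR => cis (- (k%:~R * z.2)) * f z).
  apply: cboundedM => //; apply: cbounded_cis; apply: measurableT_comp => //.
  by apply: measurable_funM => //; exact: measurable_snd.
exact: (cbounded_cintegral mc b).
Qed.

Lemma cbounded_twisted_coef k : bm (twisted_coef k).
Proof.
apply: cboundedM; last exact: cbounded_coef.
by apply: cbounded_cis; apply: measurableT_comp => //; exact: measurable_funM.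
Qed.

Lemma cbounded_duhamel k : bm (duhamel k).
Proof.
apply: cboundedM; last by apply: cbounded_primitive; exact: cbounded_twisted_coef.
by apply: cbounded_cis; exact: measurable_funM.
Qed.

Lemma modulus_twisted_coef k s : modulus (twisted_coef k s) = modulus (coef k s).
Proof. by rewrite modulusM modulus_cis mul1r. Qed.

Lemma mass_twisted_coef k : mass lam (twisted_coef k) = mass lam (coef k).
Proof. by apply: eq_Rintegral => s _; exact: modulus_twisted_coef. Qed.

Lemma cbounded_field : cbounded_measurable (fun z : RR * RR => field z.1 z.2).
Proof.
apply: cbounded_sum => i; apply: cboundedM.
  exact: (cbounded_comp measurable_fst (cbounded_duhamel _)).
apply: cbounded_cis; apply: measurable_funM => //; exact: measurable_snd.
Qed.

Lemma source43_ge0 : 0 <= source43.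
Proof. by rewrite exprn_ge0// Rintegral_ge0// => z _; exact: powR_ge0. Qed.

Lemma field4_ge0 : 0 <= field4.
Proof. by rewrite Rintegral_ge0// => z _; rewrite exprn_ge0 ?modulus_ge0. Qed.

(** Hoelder's inequality against the source, in time and space at once. *)
Lemma source_pairing (g : RR * RR -> R[i]) : cbounded_measurable g ->
  (\int[finite_product lam mc]_z (modulus (f z) * modulus (g z))) ^+ 4 <=
  source43 * \int[finite_product lam mc]_z (modulus (g z) ^+ 4).
Proof.
move=> bg; have [mf [M fM]] := bf; have [mg [N gN]] := bg.
have h := @hoelder43 _ _ _ (finite_product lam mc) (fun z => modulus (f z))
  (fun z => modulus (g z)) M N (measurable_modulus mf) _ (measurable_modulus mg) _.
apply: h => z; rewrite modulus_ge0 /=; [exact: fM|exact: gN].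
Qed.

Lemma modulus_double_integral (g : RR * RR -> R[i]) : cbounded_measurable g ->
  modulus (\cint[lam]_s \cint[mc]_x (g (s, x))) <=
  \int[finite_product lam mc]_z modulus (g z).
Proof.
by move=> bg; rewrite -(cintegral_prod _ _ bg); exact: (modulus_cintegral (finite_product lam mc)).
Qed.

(** Hausdorff-Young in space and Minkowski in time, in one step: the dual
    exponent 4 is even, so testing the coefficients against their own cubes
    leads to the fourth moment of a trigonometric polynomial, which
    [balanced_cubes] controls. *)
Lemma mass_coef_l4 : \sum_i mass lam (coef (e i)) ^+ 4 <=
  c0 ^+ 4 * (2 * pi) * ltime * source43.
Proof.
set S := \sum_i _.
have S0 : 0 <= S by apply: sumr_ge0 => i _; rewrite exprn_ge0 ?mass_ge0.
pose a (i : I) (s : RR) : R[i] := ((mass lam (coef (e i))) ^+ 3)%:C * unphase (coef (e i) s).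
pose G (z : RR * RR) : R[i] := \sum_i a i z.1 * cis (- ((e i)%:~R * z.2)).
have ba i : bm (a i).
  apply: cboundedM; first exact: cbounded_cst.
  by apply: cbounded_unphase; have [] := cbounded_coef (e i).
have bchar (k : int) : cbounded_measurable (fun z : RR * RR => cis (- (k%:~R * z.2)) : R[i]).
  apply: cbounded_cis; apply: measurableT_comp => //.
  by apply: measurable_funM => //; exact: measurable_snd.
have bG : cbounded_measurable G.
  apply: cbounded_sum => i; apply: cboundedM => //.
  exact: (cbounded_comp measurable_fst (ba i)).
have bGf : cbounded_measurable (fun z => f z * G z) by exact: cboundedM.
have SE : S%:C = c0%:C * \cint[lam]_s \cint[mc]_x (f (s, x) * G (s, x)).
  rewrite -cintegralZl; last first.
    by apply: cbounded_integrable; exact: (cbounded_cintegral mc bGf).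
  transitivity (\cint[lam]_s (\sum_i a i s * coef (e i) s)).
    rewrite cintegral_sum; last by move=> i; apply: cbounded_integrable; exact: cboundedM (ba i) (cbounded_coef _).
    rewrite /S rmorph_sum; apply: eq_bigr => i _.
    transitivity (\cint[lam]_s ((mass lam (coef (e i)) ^+ 3 * modulus (coef (e i) s))%:C)).
      rewrite cintegral_real RintegralZl//; last exact: modulus_integrable (cbounded_coef _).
      by rewrite -/(mass lam (coef (e i))) -exprSr.
    by apply: eq_cintegral => s; rewrite /a -mulrA unphaseM -rmorphM.
  apply: eq_cintegral => s; rewrite /G /=.
  under [X in _ = _ * cintegral _ _ X]eq_fun do rewrite mulr_sumr.
  rewrite cintegral_sum; last first.
    move=> i; apply: cbounded_integrable; apply: cboundedM; first exact: (cbounded_section1 bf).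
    by apply: cboundedM; [exact: cbounded_cst|exact: (cbounded_section1 (bchar (e i)) s)].
  rewrite mulr_sumr; apply: eq_bigr => i _; rewrite /coef mulrCA; congr (_ * _).
  rewrite -cintegralZl; last first.
    apply: cbounded_integrable; apply: cboundedM; last exact: (cbounded_section1 bf).
    exact: (cbounded_section1 (bchar (e i)) s).
  by apply: eq_cintegral => x /=; ring.
have SQ : S <= c0 * \int[finite_product lam mc]_z (modulus (f z) * modulus (G z)).
  have -> : S = modulus S%:C by rewrite modulus_real ger0_norm.
  rewrite SE modulusM modulus_real gtr0_norm// ler_pM2l//.
  apply: le_trans (modulus_double_integral bGf) _.
  by under eq_Rintegral do rewrite modulusM.
have G4 : \int[finite_product lam mc]_z (modulus (G z) ^+ 4) <= 2 * pi * S ^+ 3 * ltime.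
  have [N mG4 GN] := cbounded_modulusX 4 bG.
  rewrite (Rintegral_prod12 _ _ mG4 GN) -Rintegral_cst//.
  apply: le_Rintegral => //.
  - apply: (@bounded_integrable _ _ _ _ _ (N * fine (mc setT))).
      exact: (measurable_Rintegral_section _ mG4).
    move=> s; apply: Rintegral_le_bound => //.
    exact: (measurableT_comp mG4 (pair1_measurable s)).
  - exact: finite_measure_integrable_cst.
  move=> s _.
  have -> : \int[mc]_x (modulus (G (s, x)) ^+ 4) =
      \int[mc]_x (modulus (trigpoly e (fun i => (a i s)^*%C) x) ^+ 4).
    apply: eq_Rintegral => x _; congr (_ ^+ 4); rewrite /G /= -modulus_conj /trigpoly.
    by rewrite conj_sum; congr modulus; apply: eq_bigr => i _; rewrite conjM conj_cis opprK.
  apply: le_trans (trigpoly_L4_le e _) _; rewrite ler_pM2l ?mulr_gt0 ?pi_gt0//.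
  apply: le_trans (balanced_cubes inje (fun i => mass_ge0 lam (coef (e i)))).
  apply: ler_sum => q _; rewrite !modulus_conj.
  have am i : modulus (a i s) <= mass lam (coef (e i)) ^+ 3.
    rewrite /a modulusM modulus_real ger0_norm ?exprn_ge0 ?mass_ge0//.
    by rewrite ler_piMr ?exprn_ge0 ?mass_ge0// unphase_le1.
  have mm i j : modulus (a i s) * modulus (a j s) <=
      mass lam (coef (e i)) ^+ 3 * mass lam (coef (e j)) ^+ 3.
    by apply: ler_pM => //; exact: modulus_ge0.
  by apply: ler_pM; [exact: mulr_ge0 (modulus_ge0 _) (modulus_ge0 _)|exact: mulr_ge0 (modulus_ge0 _) (modulus_ge0 _)|exact: mm|exact: mm].
have lt0 : 0 <= ltime by rewrite fine_ge0.
set B := c0 ^+ 4 * _ * _ * _.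
have B0 : 0 <= B.
  apply: mulr_ge0 source43_ge0; apply: mulr_ge0 lt0.
  by rewrite mulr_ge0 ?exprn_ge0 ?(ltW c0_gt0)// mulr_ge0 ?pi_ge0.
have S4 : S ^+ 4 <= B * S ^+ 3.
  apply: (@le_trans _ _ ((c0 * \int[finite_product lam mc]_z (modulus (f z) * modulus (G z))) ^+ 4)).
    by apply: lerXn2r => //; rewrite nnegrE (le_trans S0).
  rewrite exprMn.
  apply: (@le_trans _ _ (c0 ^+ 4 * (source43 * (2 * pi * S ^+ 3 * ltime)))).
    rewrite ler_pM2l ?exprn_gt0//; apply: le_trans (source_pairing bG) _.
    by rewrite ler_wpM2l// source43_ge0.
  by rewrite /B le_eqVlt; apply/orP; left; apply/eqP; ring.
have [->|Sn0] := eqVneq S 0; first by [].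
have Sp : 0 < S by rewrite lt_neqAle eq_sym Sn0.
by move: S4; rewrite exprS ler_pM2r ?exprn_gt0.
Qed.

End Pathwise.

Arguments coef : simpl never.
Arguments twisted_coef : simpl never.
Arguments duhamel : simpl never.

(** * Energy identity and resonant interactions *)

Section PathwiseEnergy.
Variables (R : realType) (I : finType) (e : I -> int).
Hypothesis inje : injective e.
Notation RR := (measurableTypeR R).
Variable lam : {finite_measure set RR -> \bar R}.
Hypothesis atomless : forall s : R, lam [set s] = 0.
Notation mc := (circle_measure R).
Notation ltime := (fine (lam setT)).
Notation c0 := ((2 * pi)^-1 : R).
Notation bm := (@cbounded_measurable _ RR R).
Variable f : RR * RR -> R[i].
Hypothesis bf : cbounded_measurable f.
Variable W : RR -> R.
Hypothesis mW : measurable_fun setT W.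
Notation field := (field e lam f W).
Notation field4 := (field4 e lam f W).
Notation source43 := (source43 lam f).
Notation d i t := (duhamel lam f W (e i) t).
Notation h i := (twisted_coef f W (e i)).
Notation v i := (primitive lam (twisted_coef f W (e i))).
Notation hc i := (fun s => (twisted_coef f W (e i) s)^*%C).

Let c0_gt0 : 0 < c0. Proof. by rewrite invr_gt0 mulr_gt0 ?pi_gt0. Qed.
Let bh i : bm (h i). Proof. exact: cbounded_twisted_coef. Qed.
Let bhc i : bm (hc i). Proof. by apply: cbounded_conj. Qed.
Let bd i : bm (fun t => d i t). Proof. exact: cbounded_duhamel. Qed.
Let bu : cbounded_measurable (fun z : RR * RR => field z.1 z.2).
Proof. exact: cbounded_field. Qed.

Definition energy (t : RR) : R := \sum_i modulus (d i t) ^+ 2.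

Lemma energy_ge0 t : 0 <= energy t.
Proof. by apply: sumr_ge0 => i _; rewrite sqr_ge0. Qed.

Lemma coef_pairing s : \sum_i h i s * (v i s)^*%C =
  c0%:C * \cint[mc]_x (f (s, x) * (field s x)^*%C).
Proof.
have bchar (k : int) : bm (fun x => cis (- (k%:~R * x)) : R[i]).
  apply: cbounded_cis; apply: (measurable_funN (f := fun x : RR => k%:~R * x)).
  exact: mulrl_measurable.
transitivity (\sum_i c0%:C * \cint[mc]_x (cis (- ((e i)%:~R * x)) * f (s, x) * (d i s)^*%C)).
  apply: eq_bigr => i _; rewrite cintegralZr; last first.
    by apply: cbounded_integrable; apply: cboundedM => //; exact: (cbounded_section1 bf).
  rewrite mulrA -/(coef f (e i) s) [twisted_coef f W (e i) s]/twisted_coef /duhamel conjM conj_cis.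
  by ring.
rewrite -mulr_sumr -cintegral_sum; last first.
  move=> i; apply: cbounded_integrable; apply: cboundedM; last exact: cbounded_cst.
  by apply: cboundedM => //; exact: (cbounded_section1 bf).
congr (_ * _); apply: eq_cintegral => x.
rewrite /field /trigpoly conj_sum mulr_sumr; apply: eq_bigr => i _.
by rewrite [in RHS]conjM conj_cis; ring.
Qed.

(** Energy identity: the time derivative of the squared L^2 norm is the
    pairing of the source with the solution, which Hoelder's inequality bounds
    by the L^{4/3} norm of the one and the L^4 norm of the other. *)
Lemma energy_le t : energy t <=
  2 * c0 * \int[finite_product lam mc]_z (modulus (f z) * modulus (field z.1 z.2)).
Proof.
pose k (z : RR * RR) : R[i] := f z * (field z.1 z.2)^*%C.
have bk : cbounded_measurable k by apply: cboundedM => //; exact: cbounded_conj.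
pose K (z : RR * RR) : R[i] := (step z.1 t)%:C * c0%:C * (k z + (k z)^*%C).
have bK : cbounded_measurable K.
  apply: cboundedM; last by apply: cboundedD => //; exact: cbounded_conj.
  apply: cboundedM; last exact: cbounded_cst.
  exact: (cbounded_comp measurable_fst (cbounded_step1 t)).
have E : (energy t)%:C = \cint[lam]_s \cint[mc]_x (K (s, x)).
  transitivity (\sum_i primitive lam (leibniz lam (h i) (hc i)) t).
    rewrite /energy rmorph_sum; apply: eq_bigr => i _.
    rewrite -primitiveM// -primitive_conj// [LHS](esym (mul_conj _)) /duhamel conjM conj_cis.
    by rewrite mulrACA -cisD subrr cis0 mul1r.
  rewrite /primitive -cintegral_sum; last first.
    move=> i; apply: cbounded_integrable; apply: cboundedM; first exact: cbounded_step1.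
    exact: cbounded_leibniz.
  apply: eq_cintegral => s; rewrite -mulr_sumr.
  transitivity ((step s t)%:C * (\sum_i h i s * (v i s)^*%C + (\sum_i h i s * (v i s)^*%C)^*%C)).
    congr (_ * _); rewrite conj_sum -big_split /=; apply: eq_bigr => i _.
    by rewrite /leibniz -primitive_conj// [in RHS]conjM conjcK [X in _ = _ + X]mulrC.
  rewrite coef_pairing conjM conjc_real -mulrDr mulrA -cintegral_conj; last first.
    by apply: cbounded_integrable; exact: (cbounded_section1 bk).
  rewrite -cintegralD; last 2 first.
  - by apply: cbounded_integrable; exact: (cbounded_section1 bk).
  - by apply: cbounded_integrable; apply: cbounded_conj; exact: (cbounded_section1 bk).
  rewrite -cintegralZl//; apply: cbounded_integrable; apply: cboundedD.
    exact: (cbounded_section1 bk).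
  by apply: cbounded_conj; exact: (cbounded_section1 bk).
have -> : energy t = modulus (energy t)%:C by rewrite modulus_real ger0_norm ?energy_ge0.
rewrite E; apply: le_trans (modulus_double_integral lam bK) _.
have bfu := modulus_integrable (finite_product lam mc) (cboundedM bf bu).
have bfu' : (finite_product lam mc).-integrable setT
    (EFin \o (fun z => modulus (f z) * modulus (field z.1 z.2))).
  by move: bfu; under eq_fun do rewrite modulusM.
rewrite -RintegralZl//; apply: le_Rintegral => //.
- exact: modulus_integrable.
- rewrite (_ : EFin \o _ = fun z => (2 * c0)%:E * (modulus (f z) * modulus (field z.1 z.2))%:E)%E; last first.
    by apply/funext => z /=; rewrite EFinM.
  exact: integrableZl.
move=> z _; rewrite /K !modulusM !modulus_real (gtr0_norm c0_gt0).
rewrite -mulrA -[leRHS]mulrA mulrCA [leRHS]mulrCA ler_pM2l//.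
have kz : modulus (k z + (k z)^*%C) <= 2 * (modulus (f z) * modulus (field z.1 z.2)).
  apply: le_trans (modulusD _ _) _; rewrite modulus_conj /k modulusM modulus_conj.
  by rewrite mulr_natl.
by apply: le_trans kz; rewrite ler_piMl ?modulus_ge0// step_le1.
Qed.

Notation fu := (\int[finite_product lam mc]_z (modulus (f z) * modulus (field z.1 z.2))).
Notation inter q t := (interaction (fun i => d i t) q).

Lemma cbounded_interaction q : bm (fun t => inter q t).
Proof. by do 2 apply: cboundedM => //; exact: cbounded_conj. Qed.

Let pairing_ge0 : 0 <= fu.
Proof. by apply: Rintegral_ge0 => z _; rewrite mulr_ge0 ?modulus_ge0. Qed.

Let ltime_ge0 : 0 <= ltime. Proof. by rewrite fine_ge0. Qed.

Lemma field4_le_interaction : field4 <= 2 * pi * (2 * ltime * (2 * c0 * fu) ^+ 2 +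
  complex.Re (\cint[lam]_t (\sum_(q | nonresonant e q) inter q t))).
Proof.
have [N mu4 uN] := cbounded_modulusX 4 bu.
rewrite /field4 (Rintegral_prod12 _ _ mu4 uN) /=.
have bN : bm (fun t => \sum_(q | nonresonant e q) inter q t).
  by apply: cbounded_sum => q; exact: cbounded_interaction.
have bK : bm (fun t => (2 * pi)%:C * ((2 * (2 * c0 * fu) ^+ 2)%:C +
    \sum_(q | nonresonant e q) inter q t)).
  by apply: cboundedM; [exact: cbounded_cst|apply: cboundedD => //; exact: cbounded_cst].
apply: (@le_trans _ _ (\int[lam]_t complex.Re ((2 * pi)%:C * ((2 * (2 * c0 * fu) ^+ 2)%:C +
    \sum_(q | nonresonant e q) inter q t)))).
  apply: le_Rintegral => //.
  - apply: (@bounded_integrable _ _ _ _ _ (N * fine (mc setT))).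
      exact: (measurable_Rintegral_section _ mu4).
    move=> s; apply: Rintegral_le_bound => //.
      exact: (measurableT_comp mu4 (pair1_measurable s)).
    by move=> x; exact: (uN (s, x)).
  - exact: (cbounded_integrable lam bK).1.
  move=> t _.
  have -> : \int[mc]_x (modulus (field t x) ^+ 4) =
      complex.Re ((2 * pi)%:C * \sum_(q | balanced e q) inter q t).
    exact: (congr1 (@complex.Re R) (trigpoly_L4 e (fun i => d i t))).
  rewrite !ReM /= !mul0r !subr0 ler_pM2l ?mulr_gt0 ?pi_gt0//.
  apply: le_trans (Re_balanced_le inje _) _; rewrite ReD lerD2r ler_pM2l//.
  apply: lerXn2r; rewrite ?nnegrE; [exact: energy_ge0| |exact: energy_le].
  by rewrite !mulr_ge0 ?(ltW c0_gt0).
have -> : \int[lam]_t complex.Re ((2 * pi)%:C * ((2 * (2 * c0 * fu) ^+ 2)%:C +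
    \sum_(q | nonresonant e q) inter q t)) =
    complex.Re (\cint[lam]_t ((2 * pi)%:C * ((2 * (2 * c0 * fu) ^+ 2)%:C +
    \sum_(q | nonresonant e q) inter q t))) by [].
rewrite cintegralZl; last first.
  by apply: cbounded_integrable; apply: cboundedD => //; exact: cbounded_cst.
rewrite cintegralD; [|by apply: cbounded_integrable; exact: cbounded_cst|exact: cbounded_integrable].
rewrite cintegral_real Rintegral_cst// ReM ReD /= mul0r subr0.
by rewrite le_eqVlt; apply/orP; left; apply/eqP; ring.
Qed.

(** Closing the resonant part: it is at most a constant times the square root
    of [source43 * field4], and this is absorbed into the left-hand side. *)
Lemma field4_le : field4 <= 256 * pi ^+ 2 * c0 ^+ 4 * ltime ^+ 2 * source43 +
  4 * pi * complex.Re (\cint[lam]_t (\sum_(q | nonresonant e q) inter q t)).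
Proof.
have := field4_le_interaction; set NR := complex.Re _; set X := field4.
set Q := fu.
have Q4 : Q ^+ 4 <= source43 * X by exact: (source_pairing _ bf bu).
have X0 : 0 <= X by exact: field4_ge0.
have A0 : 0 <= source43 by exact: source43_ge0.
set Y := 2 * pi * (2 * ltime * (2 * c0 * Q) ^+ 2).
set B := 256 * pi ^+ 2 * c0 ^+ 4 * ltime ^+ 2 * source43.
have Y0 : 0 <= Y.
  apply: mulr_ge0; first by rewrite mulr_ge0 ?pi_ge0.
  by apply: mulr_ge0 (sqr_ge0 _); exact: mulr_ge0.
have K0 : 0 <= 256 * pi ^+ 2 * c0 ^+ 4 * ltime ^+ 2.
  apply: mulr_ge0 (sqr_ge0 _); apply: mulr_ge0 (exprn_ge0 _ (ltW c0_gt0)).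
  exact: mulr_ge0 (ler0n _ _) (sqr_ge0 _).
have B0 : 0 <= B by exact: mulr_ge0.
have Y2 : Y ^+ 2 <= B * X.
  have -> : Y ^+ 2 = 256 * pi ^+ 2 * c0 ^+ 4 * ltime ^+ 2 * Q ^+ 4 by rewrite /Y; ring.
  by rewrite /B -[leRHS]mulrA ler_wpM2l.
have Yle : Y <= (X + B) / 2.
  rewrite -(@ler_pXn2r _ 2)// ?nnegrE ?divr_ge0 ?addr_ge0//.
  apply: le_trans Y2 _; rewrite expr_div_n ler_pdivlMr ?exprn_gt0//.
  have := sqr_ge0 (X - B); rewrite sqrrB sqrrD; lra.
rewrite mulrDr -/Y; lra.
Qed.

End PathwiseEnergy.

(** * Independence of the increments from the past *)

Section Transfer.
Context d1 d2 (X : measurableType d1) (Y : measurableType d2) (R : realType).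
Variables (P : probability X R) (phi : {mfun X >-> Y}).

Lemma cintegral_distribution (g : Y -> R[i]) : cbounded_measurable g ->
  cintegral (distribution P phi) setT g = \cint[P]_x (g (phi x)).
Proof.
move=> bg; have bgp : cbounded_measurable (g \o phi) by exact: cbounded_comp.
have [[g1 g2] _] := bg; have [i1 i2] := cbounded_integrable P bgp.
by rewrite /cintegral /Rintegral !integral_pushforward//; exact/measurable_EFinP.
Qed.

End Transfer.

Section Independence.
Context d dS dY (Omega : measurableType d) (S : measurableType dS)
  (Y : measurableType dY) (R : realType).
Variables (P : probability Omega R) (X : {mfun Omega >-> S}) (Z : {mfun Omega >-> Y}).
Hypothesis indep : forall (A : set S) (B : set Y), measurable A -> measurable B ->
  P (X @^-1` A `&` Z @^-1` B) = (P (X @^-1` A) * P (Z @^-1` B))%E.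

(** The joint law is a product measure because it is one on rectangles. *)
Lemma cintegral_indep (g : S -> R[i]) (h : Y -> R[i]) :
  cbounded_measurable g -> cbounded_measurable h ->
  \cint[P]_w (g (X w) * h (Z w)) =
  \cint[P]_w (g (X w)) * cintegral (distribution P Z) setT h.
Proof.
move=> bg bh.
have mXZ : measurable_fun setT (fun w => (X w, Z w)) by exact: measurable_fun_pair.
pose XZ : {mfun Omega >-> (S * Y)%type} :=
  HB.pack (fun w => (X w, Z w)) (isMeasurableFun.Build _ _ _ _ _ mXZ).
pose k (z : S * Y) := g z.1 * h z.2.
have bk : cbounded_measurable k.
  apply: cboundedM; first exact: (cbounded_comp measurable_fst bg).
  exact: (cbounded_comp measurable_snd bh).
transitivity (cintegral (distribution P XZ) setT k).
  by rewrite cintegral_distribution.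
transitivity (cintegral (finite_product (distribution P X) (distribution P Z)) setT k).
  rewrite /cintegral /Rintegral; congr (fine _ +i* fine _);
  apply: eq_measure_integral => A mA _; apply/esym;
  apply: (@product_measure_unique _ _ _ _ _ (distribution P X) (distribution P Z)
    (distribution P XZ)) => // B C mB mC;
  rewrite -indep//; congr (P _); apply/seteqP; split => w //.
rewrite (cintegral_prod _ _ bk) /k /=.
transitivity (cintegral (distribution P X) setT
    (fun x => g x * cintegral (distribution P Z) setT h)).
  by apply: eq_cintegral => x; rewrite cintegralZl//; exact: cbounded_integrable.
rewrite cintegralZr; last exact: cbounded_integrable.
by congr (_ * _); exact: cintegral_distribution.
Qed.

End Independence.

Section RegularBrownianMotion.
Context d (Omega : measurableType d) (R : realType).
Notation RR := (measurableTypeR R).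
Variables (P : probability Omega R) (F : R -> set (set Omega)) (W : R -> Omega -> R).
Notation FS s := (g_sigma_algebraType (F s)).

(** The properties of Brownian motion that the estimate relies on, with
    measurability in all variables in place of continuity of the paths: for
    every s, [W] on [[0, s]] is jointly measurable for [F s]. *)
Record regular_brownian : Prop := {
  rb_filtration : is_filtration F;
  rb_measurable : measurable_fun setT (fun z : Omega * RR => W z.2 z.1);
  rb_progressive : forall s : R, 0 <= s ->
    measurable_fun setT (fun z : FS s * RR => W (Num.min z.2 s) z.1);
  rb_gaussian : forall s t : R, 0 <= s -> s < t ->
    forall B : set R, measurable B ->
    P (increment W s t @^-1` B) = normal_prob 0 (Num.sqrt (t - s)) B;
  rb_independent : forall s t : R, 0 <= s -> s < t ->
    forall (A : set Omega) (B : set R), F s A -> measurable B ->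
    P (A `&` increment W s t @^-1` B) =
    (P A * P (increment W s t @^-1` B))%E }.

Hypothesis rW : regular_brownian.

(** Stopping the time at [s] expresses the measurability on [[0, s]] while all
    processes keep the same domain. *)
Definition progressive (h : Omega * RR -> R[i]) : Prop :=
  cbounded_measurable h /\ forall s : R, 0 <= s ->
  cmeasurable_fun setT (fun z : FS s * RR => h (z.1, Num.min z.2 s)).

Lemma progressiveM g h : progressive g -> progressive h ->
  progressive (fun z => g z * h z).
Proof.
move=> [bg pg] [bh ph]; split; first exact: cboundedM.
by move=> s s0; apply: cmeasurableM; [exact: pg|exact: ph].
Qed.

Lemma progressiveD g h : progressive g -> progressive h ->
  progressive (fun z => g z + h z).
Proof.
move=> [bg pg] [bh ph]; split; first exact: cboundedD.
by move=> s s0; apply: cmeasurableD; [exact: pg|exact: ph].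
Qed.

Lemma progressive_conj g : progressive g -> progressive (fun z => (g z)^*%C).
Proof.
move=> [bg pg]; split; first exact: cbounded_conj.
by move=> s s0; apply: cmeasurable_conj; exact: pg.
Qed.

Lemma progressive_cis (c : R) : progressive (fun z => cis (c * W z.2 z.1)).
Proof.
split.
  apply: cbounded_cis; apply: measurable_funM => //; exact: rb_measurable rW.
move=> s s0; apply: cmeasurable_cis; apply: measurable_funM => //.
exact: (rb_progressive rW s0).
Qed.

Variable lam : {finite_measure set RR -> \bar R}.

Lemma progressive_primitive h : progressive h ->
  progressive (fun z => primitive lam (fun s => h (z.1, s)) z.2).
Proof.
move=> [bh ph]; split; first exact: cbounded_param_primitive.
move=> s s0.
have E : (fun z : FS s * RR =>
      primitive lam (fun r => h (z.1, r)) (Num.min z.2 s)) =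
    (fun z : FS s * RR => \cint[lam]_r ((step r (Num.min z.2 s))%:C * h (z.1, Num.min r s))).
  apply/funext => z; apply: eq_cintegral => r; rewrite /step.
  case: ifPn => rs; last by rewrite !mul0r.
  by rewrite (min_idPl _)//; move: rs; rewrite le_min => /and3P[].
rewrite E.
apply: (cmeasurable_cintegral_section lam
  (g := fun z : (FS s * RR) * RR => (step z.2 (Num.min z.1.2 s))%:C * h (z.1.1, Num.min z.2 s))).
apply: cmeasurableM.
  have m1 : measurable_fun setT (fun z : (FS s * RR) * RR => (z.2, Num.min z.1.2 s)).
    apply: measurable_fun_pair; first exact: measurable_snd.
    apply: measurable_minr => //.
    by apply: (measurableT_comp measurable_snd); exact: measurable_fst.
  exact: (cmeasurable_comp m1 (cbounded_step R).1).
have m2 : measurable_fun setT (fun z : (FS s * RR) * RR => (z.1.1, z.2)).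
  apply: measurable_fun_pair; last exact: measurable_snd.
  by apply: (measurableT_comp measurable_fst); exact: measurable_fst.
exact: (cmeasurable_comp m2 (ph s s0)).
Qed.

Lemma progressive_leibniz a b : progressive a -> progressive b ->
  progressive (fun z => leibniz lam (fun s => a (z.1, s)) (fun s => b (z.1, s)) z.2).
Proof.
move=> pa pb; apply: progressiveD; apply: progressiveM.
- by case: pa => *; split => //; under eq_fun do rewrite -surjective_pairing.
- exact: progressive_primitive.
- exact: progressive_primitive.
- by case: pb => *; split => //; under eq_fun do rewrite -surjective_pairing.
Qed.

(** The law of an increment is Gaussian and independent of the past. *)
Lemma increment_factor (s t : R) (h : Omega * RR -> R[i]) (phi : RR -> R[i]) :
  0 <= s -> s < t -> progressive h -> cbounded_measurable phi ->
  \cint[P]_w (h (w, s) * phi (increment W s t w)) =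
  \cint[P]_w (h (w, s)) * cintegral (normal_prob 0 (Num.sqrt (t - s))) setT phi.
Proof.
move=> s0 st [bh ph] bphi.
have [Fsig Fmon] := rb_filtration rW; have [sF Fm] := Fsig s s0.
have mid : measurable_fun setT (id : Omega -> FS s).
  by move=> _ A mA; rewrite setTI preimage_id; apply: Fm; move: mA; rewrite /measurable /= sigma_algebra_id.
have mW r : measurable_fun setT (W r).
  exact: (measurableT_comp (rb_measurable rW) (pair2_measurable (r : RR))).
have minc : measurable_fun setT (increment W s t) by exact: measurable_funB.
have minc' : @measurable_fun _ _ Omega RR setT (increment W s t) by exact: minc.
pose X : {mfun Omega >-> FS s} := HB.pack (id : Omega -> FS s) (isMeasurableFun.Build _ _ _ _ _ mid).
pose Z : {mfun Omega >-> RR} := HB.pack (increment W s t : Omega -> RR) (isMeasurableFun.Build _ _ _ _ _ minc').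
have ind (A : set (FS s)) (B : set RR) : measurable A -> measurable B ->
    P (X @^-1` A `&` Z @^-1` B) = (P (X @^-1` A) * P (Z @^-1` B))%E.
  move=> mA mB.
  have FA : F s A by move: mA; rewrite /measurable /= sigma_algebra_id.
  exact: (rb_independent rW s0 st FA mB).
have bhs : cbounded_measurable (fun w : FS s => h (w, s)).
  have [_ [M hM]] := bh; split; last by exists M => w; exact: hM.
  have := cmeasurable_comp (pair2_measurable (s : RR)) (ph s s0).
  by rewrite /comp /= minxx.
rewrite (cintegral_indep ind bhs bphi); congr (_ * _).
rewrite /cintegral /Rintegral; congr (fine _ +i* fine _);
by apply: eq_measure_integral => A mA _; exact: (rb_gaussian rW s0 st).
Qed.

End RegularBrownianMotion.

(** * The characteristic function of a Gaussian law *)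

Section GaussianCharacteristicFunction.
Variable R : realType.
Notation RR := (measurableTypeR R).
Notation gauss s := (normal_prob 0 s : probability RR R).

Definition charfun (nu s : R) : R[i] := cintegral (gauss s) setT (fun y => cis (nu * y)).

(** Two independent copies of the Gaussian of standard deviation [s] fall into
    two given intervals of length [s / 4], at a distance between [s / 2] and
    [s], with a probability at least the squared factor; there, for the [nu] of
    [charfun_gap], the cosine in [charfun_sqr] is at most [cos 2^-1]. *)
Definition gauss_gap : R := (1 - cos 2^-1) * (expR (- 8^-1) / (4 * Num.sqrt (pi *+ 2))) ^+ 2.

Let pi_ge2' : 2 <= pi :> R. Proof. exact: pi_ge2. Qed.

Lemma cos_half_lt1 : cos (2^-1) < 1 :> R.
Proof.
rewrite -[ltRHS]cos0 ltr_cos ?in_itv /= ?invr_gt0 ?ltr0n ?lexx ?pi_ge0//.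
have := pi_ge2'; lra.
Qed.

Lemma gauss_gap_gt0 : 0 < gauss_gap.
Proof.
rewrite /gauss_gap mulr_gt0 ?subr_gt0 ?cos_half_lt1// exprn_gt0//.
by rewrite divr_gt0 ?expR_gt0// mulr_gt0// sqrtr_gt0 mulrn_wgt0// pi_gt0.
Qed.

Lemma gauss_interval (s a : R) : 0 < s -> - (s / 2) <= a -> a + s / 4 <= s / 2 ->
  ((expR (- 8^-1) / (4 * Num.sqrt (pi *+ 2)))%:E <= gauss s `[a, (a + s / 4)%R]%classic)%E.
Proof.
move=> s0 la lb; rewrite /= /normal_prob.
have pk : normal_peak s = (s * Num.sqrt (pi *+ 2))^-1.
  by rewrite /normal_peak -mulrnAr sqrtrM ?sqr_ge0// sqrtr_sqr gtr0_norm.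
have sp : 0 < Num.sqrt (pi *+ 2 : R) by rewrite sqrtr_gt0 mulrn_wgt0// pi_gt0.
apply: (@le_trans _ _ (\int[lebesgue_measure]_(x in `[a, (a + s / 4)%R]%classic)
    (normal_peak s * expR (- 8^-1))%R%:E)%E).
  rewrite integral_cst//= lebesgue_measure_itv /= lte_fin ltrDl divr_gt0//.
  rewrite -EFinB -EFinM lee_fin pk addrAC subrr add0r le_eqVlt; apply/orP; left; apply/eqP.
  by field; rewrite !gt_eqF.
apply: ge0_le_integral => //.
- by move=> x _; rewrite lee_fin mulr_ge0 ?normal_peak_ge0 ?expR_ge0.
- by apply/measurable_EFinP; apply: measurable_funTS; exact: measurable_normal_pdf.
move=> x; rewrite /= in_itv /= => /andP[ax xb]; rewrite lee_fin normal_pdfE ?gt_eqF//.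
rewrite ler_pM2l ?normal_peak_gt0 ?gt_eqF// /normal_fun ler_expR subr0 mulNr lerN2.
rewrite ler_pdivrMr ?mulrn_wgt0 ?exprn_gt0//.
have h1 : 0 <= s / 2 - x by lra.
have h2 : 0 <= s / 2 + x by lra.
have := mulr_ge0 h1 h2; rewrite -mulr_natr; nra.
Qed.

(** The squared modulus is the characteristic function of the difference of
    two independent copies. *)
Lemma charfun_sqr nu s : modulus (charfun nu s) ^+ 2 =
  \int[finite_product (gauss s) (gauss s)]_z cos (nu * (z.1 - z.2)).
Proof.
have bc (c : R) : cbounded_measurable (fun y : RR => cis (c * y) : R[i]).
  by apply: cbounded_cis; exact: mulrl_measurable.
have bz : cbounded_measurable (fun z : RR * RR => cis (nu * z.1) * cis (- nu * z.2) : R[i]).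
  apply: cboundedM; first exact: (cbounded_comp measurable_fst (bc nu)).
  exact: (cbounded_comp measurable_snd (bc (- nu))).
have E : (modulus (charfun nu s) ^+ 2)%:C =
    cintegral (finite_product (gauss s) (gauss s)) setT
    (fun z => cis (nu * z.1) * cis (- nu * z.2)).
  rewrite (cintegral_prod _ _ bz) -mul_conj.
  transitivity (\cint[gauss s]_x (cis (nu * x) * (charfun nu s)^*%C)).
    by rewrite cintegralZr//; exact: cbounded_integrable.
  apply: eq_cintegral => x /=; rewrite cintegralZl; last exact: cbounded_integrable.
  congr (_ * _); rewrite /charfun -cintegral_conj; last exact: cbounded_integrable.
  by apply: eq_cintegral => y; rewrite conj_cis mulNr.
apply: etrans (congr1 (@complex.Re R) E) _.
apply: eq_Rintegral => z _; rewrite -cisD /cis /=; congr cos; ring.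
Qed.

(** At the scale where [nu ^+ 2 * s ^+ 2] is of order one, [nu * (y - y')]
    stays away from the multiples of [2 * pi] with a probability bounded from
    below; this costs a fixed fraction of the mass. *)
Lemma charfun_gap (nu s : R) : 0 < s -> 1 <= nu ^+ 2 * s ^+ 2 <= 2 ->
  modulus (charfun nu s) ^+ 2 <= 1 - gauss_gap.
Proof.
move=> s0 /andP[ns1 ns2].
set D := finite_product (gauss s) (gauss s).
pose J : set RR := `[s / 4, (s / 4 + s / 4)]%classic.
pose J' : set RR := `[(- (s / 2)), (- (s / 2) + s / 4)]%classic.
have mcos : measurable_fun setT (fun z : RR * RR => cos (nu * (z.1 - z.2)) : R).
  apply: measurableT_comp; first by apply: continuous_measurable_fun; exact: continuous_cos.
  apply: measurable_funM => //.
  by apply: measurable_funB; [exact: measurable_fst|exact: measurable_snd].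
have icos : D.-integrable setT (EFin \o (fun z : RR * RR => cos (nu * (z.1 - z.2)))).
  by apply: (@bounded_integrable _ _ _ _ _ 1) => // z; rewrite ler_norml cos_geN1 cos_le1.
have DT : fine (D setT) = 1.
  by rewrite /D /= /finite_product -setXTT product_measure1E//= !probability_setT mule1.
have mJ : measurable J by exact: measurable_itv.
have mJ' : measurable J' by exact: measurable_itv.
have mJJ : measurable (J `*` J') by exact: measurableX.
have iind : D.-integrable setT (EFin \o (fun z => (1 - cos 2^-1) * \1_(J `*` J') z)).
  apply: (@bounded_integrable _ _ _ _ _ (1 - cos 2^-1)).
    by apply: measurable_funM => //; exact: measurable_indic.
  move=> z; rewrite normrM ger0_norm ?subr_ge0 ?(ltW cos_half_lt1)//.
  rewrite ler_piMr ?subr_ge0 ?(ltW cos_half_lt1)// indicE.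
  by case: (_ \in _); rewrite ?normr1 ?normr0.
have key : (1 - cos 2^-1) * fine (D (J `*` J')) <= 1 - modulus (charfun nu s) ^+ 2.
  have -> : 1 - modulus (charfun nu s) ^+ 2 =
      \int[D]_z (1 - cos (nu * (z.1 - z.2))).
    rewrite RintegralB//; last exact: finite_measure_integrable_cst.
    by rewrite Rintegral_cst// DT mul1r charfun_sqr.
  have -> : (1 - cos 2^-1) * fine (D (J `*` J')) =
      \int[D]_z ((1 - cos 2^-1) * \1_(J `*` J') z).
    rewrite RintegralZl//; last first.
      apply: (@bounded_integrable _ _ _ _ _ 1); first exact: measurable_indic.
      by move=> z; rewrite indicE; case: (_ \in _); rewrite ?normr1 ?normr0.
    congr (_ * _); rewrite /Rintegral; congr fine; apply/esym.
    exact: etrans (integral_indic _ measurableT mJJ) (congr1 _ (setIT _)).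
  apply: le_Rintegral => //.
    rewrite (_ : EFin \o _ = (cst 1%:E \- (EFin \o (fun z : RR * RR => cos (nu * (z.1 - z.2))))))%E//.
    by apply: integrableB => //; exact: finite_measure_integrable_cst.
  move=> [y y'] _; rewrite indicE; have [|_] := boolP ((y, y') \in _); last first.
    by rewrite mulr0 subr_ge0 cos_le1.
  rewrite inE => -[]; rewrite /J /J' /= !in_itv /= => /andP[y1 y2] /andP[y3 y4].
  rewrite mulr1 lerD2l lerN2.
  have -> : cos (nu * (y - y')) = cos (`|nu| * (y - y')).
    by have [n0|n0] := ger0P nu; rewrite // mulNr cosN.
  have nus : 1 <= `|nu| * s.
    by rewrite -(@ler_pXn2r _ 2)// ?nnegrE ?mulr_ge0 ?(ltW s0)// expr1n exprMn real_normK ?num_real.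
  have nus2 : `|nu| * s <= 2.
    rewrite -(@ler_pXn2r _ 2)// ?nnegrE ?mulr_ge0 ?(ltW s0)// exprMn real_normK ?num_real//.
    by apply: le_trans ns2 _; rewrite expr2 -natrM ler_nat.
  have h1 : 2^-1 <= `|nu| * (y - y').
    apply: (@le_trans _ _ (`|nu| * (s / 2))); first by rewrite mulrA; lra.
    by rewrite ler_wpM2l//; lra.
  have h2 : `|nu| * (y - y') <= 2.
    apply: le_trans nus2; rewrite ler_wpM2l//; lra.
  rewrite leNgt ltr_cos -?leNgt// in_itv /=; have := pi_ge2'; lra.
have J1 := @gauss_interval s (s / 4) s0.
have J2 := @gauss_interval s (- (s / 2)) s0.
rewrite lerBrDl -lerBrDr; apply: le_trans key; rewrite /gauss_gap.
rewrite ler_pM2l ?subr_gt0 ?cos_half_lt1// /D /= /finite_product product_measure1E//.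
have f1 : gauss s J \is a fin_num by apply: fin_num_measure.
have f2 : gauss s J' \is a fin_num by apply: fin_num_measure.
have pp : 0 <= expR (- 8^-1) / (4 * Num.sqrt (pi *+ 2)) :> R.
  by rewrite divr_ge0 ?expR_ge0// mulr_ge0 ?sqrtr_ge0.
have q1 : expR (- 8^-1) / (4 * Num.sqrt (pi *+ 2)) <= fine (gauss s J).
  by rewrite -lee_fin fineK//; apply: J1; lra.
have q2 : expR (- 8^-1) / (4 * Num.sqrt (pi *+ 2)) <= fine (gauss s J').
  by rewrite -lee_fin fineK//; apply: J2; lra.
by rewrite fineM// expr2; exact: ler_pM.
Qed.

Lemma charfun_le1 nu s : modulus (charfun nu s) <= 1.
Proof.
have := @modulus_cintegral_le _ _ _ (gauss s) (fun y : RR => cis (nu * y)) 1.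
rewrite [X in fine X]probability_setT mulr1; apply.
  by apply: cmeasurable_cis; exact: mulrl_measurable.
by move=> y; rewrite modulus_cis.
Qed.

End GaussianCharacteristicFunction.

(** * Weights of the gaps and decay of characteristic functions *)

Section PowerSums.
Variable R : realType.

(** Dyadic blocks: the sum over [2 ^ m <= k < 2 ^ m.+1] is at most
    [(2 `^ (1 - p)) ^+ m]. *)
Lemma power_sum_bounded (p : R) : 1 < p ->
  exists S : R, forall M, \sum_(1 <= k < M) k%:R `^ (- p) <= S.
Proof.
move=> p1; pose q : R := 2 `^ (1 - p).
have q0 : 0 < q by rewrite powR_gt0.
have q1 : q < 1.
  rewrite /q -opprB powRN invf_lt1 ?powR_gt0//.
  have := @gt0_ltr_powR R (p - 1) _ 1 2; rewrite powR1; apply; rewrite ?nnegrE//.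
    by rewrite subr_gt0.
  by rewrite ltr1n.
have dy m : \sum_(1 <= k < 2 ^ m) k%:R `^ (- p) <= \sum_(j < m) q ^+ j.
  elim: m => [|m IH]; first by rewrite expn0 big_geq// big_ord0.
  have e1 : (1 <= 2 ^ m)%N by rewrite expn_gt0.
  have e2 : (2 ^ m <= 2 ^ m.+1)%N by rewrite leq_exp2l.
  rewrite (big_cat_nat e1 e2) /= big_ord_recr /=; apply: lerD => //.
  apply: (@le_trans _ _ (\sum_(2 ^ m <= k < 2 ^ m.+1) (2 ^ m)%:R `^ (- p))).
    rewrite big_nat [leRHS]big_nat; apply: ler_sum => k /andP[k1 _].
    rewrite !powRN lef_pV2 ?posrE ?powR_gt0 ?ltr0n ?expn_gt0//; last exact: leq_trans k1.
    by rewrite ge0_ler_powR ?nnegrE ?ler_nat//; lra.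
  rewrite sumr_const_nat expnS mul2n -addnn addnK -[_ *+ _]mulr_natl.
  rewrite natrX -powR_mulrn// -powRrM /q -powR_mulrn ?powR_ge0// -powRrM.
  by rewrite -powRD ?pnatr_eq0 ?implybT// le_eqVlt; apply/orP; left; apply/eqP; congr (_ `^ _); ring.
have geo m : \sum_(j < m) q ^+ j <= (1 - q)^-1.
  have : (1 - q) * \sum_(j < m) q ^+ j = 1 - q ^+ m.
    rewrite -[X in X - q ^+ m](expr1n _ m) subrXX; congr (_ * _).
    by apply: eq_bigr => j _; rewrite expr1n mul1r.
  move=> E; rewrite -[leRHS]mul1r ler_pdivlMr ?subr_gt0// mulrC E.
  by rewrite gerBl exprn_ge0// ltW.
exists ((1 - q)^-1) => M; apply: le_trans (geo M); apply: le_trans (dy M).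
case: (leqP 1 M) => [M1|]; last by rewrite ltnS leqn0 => /eqP->; rewrite !big_geq.
rewrite (big_cat_nat M1 (ltnW (ltn_expl _ _)))//= lerDl.
by apply: sumr_ge0 => k _; exact: powR_ge0.
Qed.

(** The value 0 at the gap 0 leaves out the resonant quadruples in the Schur
    test. *)
Definition gap_weight (p : R) (n : int) : R := if n == 0 then 0 else (`|n|%N)%:R `^ (- p).

Lemma gap_weight_ge0 p n : 0 <= gap_weight p n.
Proof. by rewrite /gap_weight; case: ifP => // _; exact: powR_ge0. Qed.

Lemma gap_weightN p n : gap_weight p (- n) = gap_weight p n.
Proof. by rewrite /gap_weight oppr_eq0 abszN. Qed.

Lemma gap_weight_sum (p : R) : 1 < p -> exists Z : R,
  forall (I : finType) (g : I -> int), injective g -> \sum_i gap_weight p (g i) <= Z.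
Proof.
move=> p1; have [S SP] := power_sum_bounded p1.
exists (2 * S) => I g injg.
pose M := (\max_i `|g i|%N).+1.
have gM i : (`|g i| < M)%N by rewrite ltnS; exact: (leq_bigmax i).
pose w (k : 'I_M) : R := if k == ord0 then 0 else (k : nat)%:R `^ (- p).
have w0 k : 0 <= w k by rewrite /w; case: ifP => // _; exact: powR_ge0.
have wS : \sum_k w k <= S.
  rewrite big_ord_recl /w eqxx add0r; apply: le_trans (SP M).
  rewrite big_add1 /= big_mkord; apply: ler_sum => k _.
  by rewrite /bump leq0n add1n.
have gw i : gap_weight p (g i) = w (Ordinal (gM i)).
  rewrite /gap_weight /w -absz_eq0 -val_eqE /=.
  by case: ifP.
rewrite (bigID (fun i => 0 <= g i)) /= mulr_natl mulr2n; apply: lerD.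
- under eq_bigr do rewrite gw.
  apply: le_trans wS; apply: (ler_sum_inj (pi := fun i => Ordinal (gM i))) => // i j.
  by rewrite !unfold_in => i0 j0 [] E; apply: injg; rewrite -(gez0_abs i0) -(gez0_abs j0) E.
- under eq_bigr do rewrite gw.
  apply: le_trans wS; apply: (ler_sum_inj (pi := fun i => Ordinal (gM i))) => // i j.
  rewrite !unfold_in -!ltNge => i0 j0 [] E; apply: injg.
  by apply: oppr_inj; rewrite -(ltz0_abs i0) -(ltz0_abs j0) E.
Qed.

End PowerSums.

Section CharacteristicDecay.
Context d (Omega : measurableType d) (R : realType).
Notation RR := (measurableTypeR R).
Variables (P : probability Omega R) (F : R -> set (set Omega)) (W : R -> Omega -> R).
Hypothesis rW : regular_brownian P F W.
Notation FS s := (g_sigma_algebraType (F s)).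
Notation delta := (gauss_gap R).

Lemma progressive_cst (c : R[i]) : progressive F (fun _ : Omega * RR => c).
Proof. by split=> [|s s0]; [exact: cbounded_cst|exact: cmeasurable_cst]. Qed.

Lemma progressive_cis0 (c : R) : progressive F (fun z : Omega * RR => cis (c * W 0 z.1)).
Proof.
split.
  apply: cbounded_cis; apply: measurable_funM => //.
  apply: (measurableT_comp (f := W 0)); last exact: measurable_fst.
  exact: (measurableT_comp (rb_measurable rW) (pair2_measurable (0 : RR))).
move=> s s0; apply: cmeasurable_cis; apply: measurable_funM => //.
have m1 : measurable_fun setT (fun z : FS s * RR => (z.1, 0 : RR)).
  by apply: measurable_fun_pair => //; exact: measurable_fst.
have := measurableT_comp (rb_progressive rW s0) m1.
by apply: eq_measurable_fun => z _ /=; rewrite (min_idPl s0).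
Qed.

(** An increment over the time [u * n.+1] is a sum of [n.+1] independent
    increments over the time [u]. *)
Lemma charfunX (nu u : R) (n : nat) : 0 < u ->
  charfun nu (Num.sqrt (u * n.+1%:R)) = charfun nu (Num.sqrt u) ^+ n.+1.
Proof.
move=> u0.
have bphi : cbounded_measurable (fun y : RR => cis (nu * y) : R[i]).
  by apply: cbounded_cis; exact: mulrl_measurable.
have one : \cint[P]_w (1 : R[i]) = 1.
  have := cintegral_real P (fun _ => 1); rewrite Rintegral_cst// => E1.
  by apply: etrans E1 _; rewrite [X in fine X]probability_setT mulr1.
have E t : 0 < t -> \cint[P]_w cis (nu * (W t w - W 0 w)) = charfun nu (Num.sqrt t).
  move=> t0; have := increment_factor rW (lexx 0) t0 (progressive_cst 1) bphi.
  rewrite subr0 one mul1r /charfun => <-.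
  by apply: eq_cintegral => w; rewrite mul1r.
elim: n => [|n IH]; first by rewrite mulr1 expr1.
have un0 : 0 < u * n.+1%:R by rewrite mulr_gt0.
have unn : u * n.+1%:R < u * n.+2%:R by rewrite ltr_pM2l// ltr_nat.
rewrite exprSr -IH -E ?mulr_gt0// -E//.
have ph := progressiveM (progressive_cis rW nu) (progressive_cis0 (- nu)).
have E2 := increment_factor rW (ltW un0) unn ph bphi.
transitivity (\cint[P]_w (cis (nu * W (u * n.+1%:R) w) * cis (- nu * W 0 w) *
    cis (nu * increment W (u * n.+1%:R) (u * n.+2%:R) w))).
  by apply: eq_cintegral => w; rewrite -!cisD /increment; congr cis; ring.
have uE : u = u * n.+2%:R - u * n.+1%:R by rewrite -mulrBr -natrB// subSnn mulr1.
have E3 : \cint[P]_w cis (nu * (W (u * n.+1%:R) w - W 0 w)) =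
    \cint[P]_w (cis (nu * W (u * n.+1%:R) w) * cis (- nu * W 0 w)).
  by apply: eq_cintegral => w; rewrite -cisD; congr cis; ring.
by rewrite E3 [X in charfun nu (Num.sqrt X)]uE; exact: E2.
Qed.

(** For [nu ^+ 2 * t >= 1] the time [t] is cut into the integer part of
    [nu ^+ 2 * t] equal steps, which have the size that [charfun_gap] asks for;
    the factor in front takes care of the shorter times and of the integer
    part. *)
Lemma charfun_decay (nu t : R) : 0 < t ->
  modulus (charfun nu (Num.sqrt t)) <= expR (delta / 2) * expR (- (delta / 2 * nu ^+ 2 * t)).
Proof.
move=> t0; have d0 := gauss_gap_gt0 R.
rewrite -(@ler_pXn2r _ 2)// ?nnegrE ?modulus_ge0 ?mulr_ge0 ?expR_ge0//.
rewrite -expRD -expRM_natl.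
have -> : 2%:R * (delta / 2 + - (delta / 2 * nu ^+ 2 * t)) = delta * (1 - nu ^+ 2 * t) by field.
have [small|big] := ltP (nu ^+ 2 * t) 1.
  apply: (@le_trans _ _ 1); first by rewrite expr_le1// ?modulus_ge0// charfun_le1.
  by rewrite -[leLHS]expR0 ler_expR mulr_ge0 ?(ltW d0)// subr_ge0 ltW.
pose n := Num.trunc (nu ^+ 2 * t).
have x0 : 0 <= nu ^+ 2 * t by exact: le_trans big.
have /andP[n1 n2] := truncn_itv x0; rewrite -/n in n1 n2.
have ngt0 : (0 < n)%N by rewrite /n truncn_gt0.
have nR : 0 < n%:R :> R by rewrite ltr0n.
pose u := t / n%:R.
have u0 : 0 < u by rewrite divr_gt0.
have tE : t = u * n.-1.+1%:R by rewrite prednK// /u divfK// gt_eqF.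
have su : nu ^+ 2 * Num.sqrt u ^+ 2 = nu ^+ 2 * t / n%:R by rewrite sqr_sqrtr ?ltW// /u mulrA.
have gap : modulus (charfun nu (Num.sqrt u)) ^+ 2 <= 1 - delta.
  apply: charfun_gap; first by rewrite sqrtr_gt0.
  rewrite su ler_pdivlMr// mul1r n1 /= ler_pdivrMr//.
  apply: (le_trans (ltW n2)); rewrite -natrM ler_nat mul2n -addnn -addn1 leq_add2l//.
have r0 : 0 <= 1 - delta by exact: le_trans (sqr_ge0 _) gap.
have modX (z : R[i]) m : modulus (z ^+ m) = modulus z ^+ m.
  elim: m => [|m IHm]; first by rewrite !expr0 /modulus ComplexField.Normc.normc1.
  by rewrite !exprS modulusM IHm.
rewrite {1}tE charfunX// prednK// modX -exprM mulnC exprM.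
apply: (@le_trans _ _ ((1 - delta) ^+ n)); first by apply: lerXn2r; rewrite ?nnegrE ?sqr_ge0.
apply: (@le_trans _ _ (expR (- delta) ^+ n)).
  by apply: lerXn2r; rewrite ?nnegrE ?expR_ge0//; apply: expR_ge1Dx.
rewrite -expRM_natl ler_expR.
have h : 0 <= n%:R - (nu ^+ 2 * t - 1).
  by rewrite subr_ge0 lerBlDr natr1 ltW.
rewrite -subr_ge0 (_ : _ - _ = delta * (n%:R - (nu ^+ 2 * t - 1))); last by ring.
by rewrite mulr_ge0// ltW.
Qed.

End CharacteristicDecay.

(** * Decay of the nonresonant interactions *)

Section TimeMeasure.
Variables (R : realType) (T : R).
Notation RR := (measurableTypeR R).
Hypothesis T0 : 0 < T.

Definition time_itv : set RR := `[0, T]%classic.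

Lemma measurable_time : measurable time_itv.
Proof. exact: measurable_itv. Qed.

Lemma leb_time : lebesgue_measure time_itv = T%:E.
Proof. by rewrite /time_itv lebesgue_measure_itv /= lte_fin T0 oppr0 adde0. Qed.

Lemma leb_time_lty : (lebesgue_measure time_itv < +oo)%E.
Proof. by rewrite leb_time ltry. Qed.

Definition time_measure : {finite_measure set RR -> \bar R} :=
  @restricted_measure _ _ R lebesgue_measure _ measurable_time leb_time_lty.
Notation lam := time_measure.

Lemma time_measureT : fine (lam setT) = T.
Proof. by rewrite /= /mfrestr /mrestr setTI leb_time. Qed.

Lemma time_measure_atomless (s : R) : lam [set s] = 0.
Proof.
rewrite /= /mfrestr /mrestr; apply/eqP; rewrite -measure_le0 -(lebesgue_measure_set1 s).
by apply: le_measure; rewrite ?inE//; apply: measurableI => //; exact: measurable_time.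
Qed.

Lemma bounded_step_exp (c s t : R) : 0 < c ->
  0 <= step s t * expR (- (c * (t - s))) <= 1.
Proof.
move=> c0; rewrite mulr_ge0 ?step_ge0 ?expR_ge0//= /step.
case: ifPn => [/andP[s0 st]|]; last by rewrite mul0r.
by rewrite mul1r -[leRHS]expR0 ler_expR oppr_le0 mulr_ge0 ?(ltW c0)// subr_ge0.
Qed.

Lemma measurable_step_exp (c s : R) :
  measurable_fun setT (fun t : RR => step s t * expR (- (c * (t - s)))).
Proof.
apply: measurable_funM.
  exact: (measurableT_comp (@measurable_step R) (pair1_measurable (s : RR))).
apply: measurableT_comp => //; apply: measurableT_comp => //.
apply: measurable_funM => //; exact: measurable_funB.
Qed.

Lemma step_exp_integral_leT (c s : R) : 0 < c ->
  \int[lam]_t (step s t * expR (- (c * (t - s)))) <= T.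
Proof.
move=> c0; apply: le_trans (ler_norm _) _.
rewrite -[leRHS]mul1r -[X in 1 * X]time_measureT; apply: Rintegral_le_bound.
  exact: measurable_step_exp.
by move=> t; have /andP[? ?] := bounded_step_exp s t c0; rewrite ger0_norm.
Qed.

Lemma step_exp_integral_leV (c s : R) : 0 < c ->
  \int[lam]_t (step s t * expR (- (c * (t - s)))) <= c^-1.
Proof.
move=> c0; pose b := Num.max T s + 1.
have Tb : T <= b by rewrite /b ler_wpDr// le_max lexx.
have sb : s < b by rewrite /b ltr_pwDr// le_max lexx orbT.
pose f (t : R) := expR (- (c * (t - s))); pose G (t : R) := - c^-1 * f t.
have dlin (t : R) : is_derive t (1 : R) (fun t => - (c * (t - s)) : R) (- c).
  rewrite (_ : (fun t : R => _) = (fun t => (- c) * t + c * s)); last by apply/funext => y; ring.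
  have := @is_deriveD R R R _ _ t 1 _ _ (@is_deriveZ R R R id (- c) t 1 _ (is_derive_id _ _)) (is_derive_cst (c * s) t 1).
  by rewrite /GRing.scale /= mulr1 addr0.
have df (t : R) : is_derive t (1 : R) f (f t * - c).
  exact: is_derive1_comp (is_derive_expR _) (dlin t).
have dG (t : R) : is_derive t (1 : R) G (f t).
  have := @is_deriveZ R R R _ (- c^-1) t 1 _ (df t).
  by rewrite /GRing.scale /= mulrCA mulrNN mulVf ?mulr1// gt_eqF.
have cf : continuous f.
  by move=> t; apply: differentiable_continuous; apply/derivable1_diffP.
have cG : continuous G.
  by move=> t; apply: differentiable_continuous; apply/derivable1_diffP.
have ftc : (\int[lebesgue_measure]_(t in `[s, b]) (f t)%:E)%E = (G b - G s)%:E.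
  rewrite EFinB; apply: continuous_FTC2 => //.
  - exact: continuous_subspaceT.
  - split; first by move=> x _; have [] := dG x.
    + by apply: cvg_at_right_filter; exact: cG.
    + by apply: cvg_at_left_filter; exact: cG.
  - by move=> x _; rewrite derive1E; apply: derive_val.
have Gle : G b - G s <= c^-1.
  have -> : G s = - c^-1 by rewrite /G /f subrr mulr0 oppr0 expR0 mulr1.
  by rewrite opprK /G mulNr -[leRHS]add0r lerD2r oppr_le0 mulr_ge0 ?expR_ge0// invr_ge0 ltW.
rewrite -lee_fin; apply: le_trans (_ : _ <= (G b - G s)%:E)%E _; last by rewrite lee_fin.
have mse := measurable_step_exp c s.
rewrite /Rintegral fineK; last first.
  apply: integrable_fin_num => //; apply: (@bounded_integrable _ _ _ _ _ 1) => //.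
  by move=> t; have /andP[? ?] := bounded_step_exp s t c0; rewrite ger0_norm.
rewrite ge0_integral_mfrestr; last 2 first.
- exact/measurable_EFinP.
- by move=> t; rewrite lee_fin; have /andP[] := bounded_step_exp s t c0.
have mr (D : set RR) (g : RR -> \bar R) : measurable D -> measurable_fun setT g ->
    measurable_fun setT (g \_ D).
  by move=> mD mg; exact: ((measurable_restrictT g mD).1 (measurable_funTS mg)).
rewrite -ftc integral_mkcond [leRHS]integral_mkcond; apply: ge0_le_integral => //.
- by move=> t _; rewrite patchE; case: ifP => // _; rewrite lee_fin; have /andP[] := bounded_step_exp s t c0.
- by apply: mr; [exact: measurable_time|exact/measurable_EFinP].
- apply: mr; first exact: measurable_itv.
  by apply/measurable_EFinP; exact: continuous_measurable_fun.
move=> t _; rewrite !patchE; case: ifPn => [|_]; last first.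
  by case: ifP => // _; rewrite lee_fin expR_ge0.
rewrite inE /time_itv /= in_itv /= => /andP[t0 tT]; rewrite /step.
case: ifPn => [/andP[s0 st]|_]; last first.
  by rewrite mul0r; case: ifP => // _; rewrite lee_fin expR_ge0.
by rewrite mem_set ?mul1r//= in_itv /= st (le_trans tT Tb).
Qed.

(** Interpolation between the two bounds on the time integral. *)
Lemma step_exp_integral_le (alpha c s : R) : 0 <= alpha <= 1 -> 0 < c ->
  \int[lam]_t (step s t * expR (- (c * (t - s)))) <= T `^ (1 - alpha) * c `^ (- alpha).
Proof.
move=> /andP[a0 a1] c0; set X := Rintegral _ _ _.
have X0 : 0 <= X.
  by apply: Rintegral_ge0 => t _; have /andP[] := bounded_step_exp s t c0.
have XT : X <= T by exact: step_exp_integral_leT.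
have Xc : X <= c^-1 by exact: step_exp_integral_leV.
have -> : X = X `^ (1 - alpha) * X `^ alpha.
  by rewrite -powRD ?subrK ?powRr1//; rewrite oner_eq0.
have -> : c `^ (- alpha) = (c^-1) `^ alpha.
  by rewrite -powR_inv1 ?(ltW c0)// -powRrM mulN1r.
by apply: ler_pM; rewrite ?powR_ge0// ge0_ler_powR ?nnegrE ?subr_ge0 ?invr_ge0 ?(ltW T0) ?(ltW c0).
Qed.

End TimeMeasure.

Section NonresonantExpectation.
Context d (Omega : measurableType d) (R : realType).
Notation RR := (measurableTypeR R).
Variables (P : probability Omega R) (F : R -> set (set Omega)) (W : R -> Omega -> R).
Hypothesis rW : regular_brownian P F W.
Variables (T : R) (T0 : 0 < T).
Notation lam := (time_measure T0).
Notation kappa := (gauss_gap R / 2).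

(** The process multiplying the oscillating factor is a primitive of an
    adapted density; averaging the factor over the increment of [W] from the
    time of the density onwards produces exponential decay in time. *)
Lemma nonresonant_expectation (alpha nu : R) (H : Omega * RR -> R[i]) :
  0 <= alpha <= 1 -> nu != 0 -> progressive F H ->
  modulus (\cint[P]_w \cint[lam]_t (cis (nu * W t w) *
    primitive lam (fun s => H (w, s)) t)) <=
  expR kappa * (T `^ (1 - alpha) * (kappa * nu ^+ 2) `^ (- alpha)) *
  \int[P]_w mass lam (fun s => H (w, s)).
Proof.
move=> al nu0 pH; have [bH _] := pH.
have c0 : 0 < kappa * nu ^+ 2.
  by rewrite mulr_gt0 ?divr_gt0 ?gauss_gap_gt0// exprn_even_gt0.
set c := kappa * nu ^+ 2 in c0 *.
pose D := finite_product lam lam.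
pose k (z : Omega * (RR * RR)) : R[i] :=
  (step z.2.2 z.2.1)%:C * (cis (nu * W z.2.1 z.1) * H (z.1, z.2.2)).
have m12 : measurable_fun setT (fun z : Omega * (RR * RR) => (z.1, z.2.1)).
  apply: measurable_fun_pair; first exact: measurable_fst.
  by apply: (measurableT_comp measurable_fst); exact: measurable_snd.
have m13 : measurable_fun setT (fun z : Omega * (RR * RR) => (z.1, z.2.2)).
  apply: measurable_fun_pair; first exact: measurable_fst.
  by apply: (measurableT_comp measurable_snd); exact: measurable_snd.
have m32 : measurable_fun setT (fun z : Omega * (RR * RR) => (z.2.2, z.2.1)).
  apply: measurable_fun_pair.
    by apply: (measurableT_comp measurable_snd); exact: measurable_snd.
  by apply: (measurableT_comp measurable_fst); exact: measurable_snd.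
have bk : cbounded_measurable k.
  apply: cboundedM; first exact: (cbounded_comp m32 (cbounded_step R)).
  apply: cboundedM; last exact: (cbounded_comp m13 bH).
  exact: (cbounded_comp m12 (progressive_cis rW nu).1).
pose m (s : RR) : R := \int[P]_w modulus (H (w, s)).
have [M HM] := bH.2.
have [N mH HN] := cbounded_modulusE bH.
have mHs : measurable_fun setT (fun z : RR * Omega => modulus (H (z.2, z.1))).
  by apply: (measurableT_comp mH (g := fun z : RR * Omega => (z.2, z.1))); exact: measurable_fun_pair.
have mm : measurable_fun setT m by exact: (measurable_Rintegral_section P mHs).
have m0 s : 0 <= m s by apply: Rintegral_ge0 => w _; exact: modulus_ge0.
have mN s : `|m s| <= N.
  have := @Rintegral_le_bound _ _ _ P (fun w => modulus (H (w, s))) N.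
  rewrite [X in fine X]probability_setT mulr1; apply => //.
  exact: (measurableT_comp mH (pair2_measurable (s : RR))).
have -> : \cint[P]_w \cint[lam]_t (cis (nu * W t w) * primitive lam (fun s => H (w, s)) t) =
    \cint[D]_z \cint[P]_w (k (w, z)).
  rewrite -(cintegral_swap P D bk); apply: eq_cintegral => w.
  rewrite (cintegral_prod _ _ (cbounded_section1 bk w)); apply: eq_cintegral => t.
  rewrite /primitive -cintegralZl; last first.
    apply: cbounded_integrable; apply: cboundedM; first exact: cbounded_step1.
    exact: (cbounded_section1 bH w).
  by apply: eq_cintegral => s; rewrite /k /= mulrCA.
have bk2 : cbounded_measurable (fun z => \cint[P]_w (k (w, z))).
  apply: (cbounded_cintegral P (g := fun z : (RR * RR) * Omega => k (z.2, z.1))).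
  by apply: (cbounded_comp (phi := fun z : (RR * RR) * Omega => (z.2, z.1)) _ bk); exact: measurable_fun_pair.
apply: le_trans (modulus_cintegral _ bk2) _.
pose B (z : RR * RR) : R := expR kappa * m z.2 * (step z.2 z.1 * expR (- (c * (z.1 - z.2)))).
have mB : measurable_fun setT B.
  apply: measurable_funM.
    by apply: measurable_funM => //; apply: (measurableT_comp mm); exact: measurable_snd.
  apply: measurable_funM.
    apply: (measurableT_comp (@measurable_step R) (g := fun z : RR * RR => (z.2, z.1))).
    exact: measurable_fun_pair.
  apply: measurableT_comp => //; apply: measurableT_comp => //.
  apply: measurable_funM => //.
  by apply: measurable_funB; [exact: measurable_fst|exact: measurable_snd].
have BN z : `|B z| <= expR kappa * N.
  have /andP[e0 e1] := bounded_step_exp z.2 z.1 c0.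
  have h1 : `|expR kappa * m z.2| <= expR kappa * N.
    by rewrite normrM ger0_norm ?expR_ge0// ler_pM2l ?expR_gt0.
  by rewrite /B normrM (ger0_norm e0); apply: le_trans h1; rewrite ler_piMr.
apply: (@le_trans _ _ (\int[D]_z B z)).
  apply: le_Rintegral => //.
  - exact: modulus_integrable.
  - exact: (@bounded_integrable _ _ _ _ _ (expR kappa * N)).
  move=> [t s] _; rewrite /B /k /= /step.
  case: ifPn => [/andP[s0]|_]; last first.
    rewrite mul0r mulr0 (_ : \cint[P]_w _ = 0) ?modulus0//.
    by rewrite -[RHS](cintegral0 P); apply: eq_cintegral => w; rewrite mul0r.
  have bHs : cbounded_measurable (fun w => H (w, s)) by exact: (cbounded_section2 bH s).
  rewrite le_eqVlt => /orP[/eqP <-|st].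
    rewrite subrr mulr0 oppr0 expR0 !mulr1.
    have bks : cbounded_measurable (fun w => cis (nu * W s w) * H (w, s) : R[i]).
      apply: cboundedM => //; exact: (cbounded_section2 (progressive_cis rW nu).1 s).
    have -> : \cint[P]_w (1%:C * (cis (nu * W s w) * H (w, s))) =
        \cint[P]_w (cis (nu * W s w) * H (w, s)).
      by apply: eq_cintegral => w; rewrite mul1r.
    apply: le_trans (modulus_cintegral _ bks) _.
    under eq_Rintegral do rewrite modulusM modulus_cis mul1r.
    rewrite -/(m s) ler_peMl//.
    by rewrite -[leLHS]expR0 ler_expR divr_ge0// ltW// gauss_gap_gt0.
  have ph := progressiveM (progressive_cis rW nu) pH.
  have bphi : cbounded_measurable (fun y : RR => cis (nu * y) : R[i]).
    by apply: cbounded_cis; exact: mulrl_measurable.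
  have E := increment_factor rW s0 st ph bphi.
  have -> : \cint[P]_w (1%:C * (cis (nu * W t w) * H (w, s))) =
      \cint[P]_w (cis (nu * W s w) * H (w, s)) * charfun nu (Num.sqrt (t - s)).
    rewrite -[RHS]E; apply: eq_cintegral => w /=.
    by rewrite mul1r mulrAC -cisD /increment; congr (cis _ * _); ring.
  rewrite modulusM mul1r [expR kappa * m s]mulrC -mulrA.
  apply: ler_pM; rewrite ?modulus_ge0//.
    have bks : cbounded_measurable (fun w => cis (nu * W s w) * H (w, s) : R[i]).
      apply: cboundedM => //; exact: (cbounded_section2 (progressive_cis rW nu).1 s).
    apply: le_trans (modulus_cintegral _ bks) _.
    by under eq_Rintegral do rewrite modulusM modulus_cis mul1r.
  have ts : 0 < t - s by rewrite subr_gt0.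
  exact: (charfun_decay rW nu ts).
rewrite /D (Rintegral_prod21 _ _ mB BN) /B /=.
have lemi (r : R) : lam.-integrable setT (EFin \o (fun s => r * m s)).
  apply: (@bounded_integrable _ _ _ _ _ (`|r| * N)); first exact: measurable_funM.
  by move=> s; rewrite normrM ler_wpM2l.
apply: (@le_trans _ _ (\int[lam]_s (expR kappa * (T `^ (1 - alpha) * c `^ (- alpha)) * m s))).
  apply: le_Rintegral => //.
  - apply: (@bounded_integrable _ _ _ _ _ (expR kappa * N * fine (lam setT))).
      apply: (measurable_Rintegral_section lam (f := fun z : RR * RR => B (z.2, z.1))).
      by apply: (measurableT_comp mB (g := fun z : RR * RR => (z.2, z.1))); exact: measurable_fun_pair.
    move=> s; apply: Rintegral_le_bound; last by move=> t; exact: (BN (t, s)).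
    exact: (measurableT_comp mB (pair2_measurable s)).
  move=> s _; rewrite RintegralZl//; last first.
    apply: (@bounded_integrable _ _ _ _ _ 1); first exact: measurable_step_exp.
    by move=> t; have /andP[? ?] := bounded_step_exp s t c0; rewrite ger0_norm.
  rewrite mulrAC; apply: ler_wpM2r => //.
  by rewrite ler_pM2l ?expR_gt0//; exact: step_exp_integral_le.
rewrite RintegralZl//; last first.
  by have := lemi 1; apply: eq_integrable => // s _ /=; rewrite mul1r.
rewrite le_eqVlt; apply/orP; left; apply/eqP; congr (_ * _).
have mHN (z : RR * Omega) : `|modulus (H (z.2, z.1))| <= N by exact: HN.
exact: (Rintegral_swap lam P mHs mHN).
Qed.

End NonresonantExpectation.

(** * The estimate for bounded adapted sources *)

Section InteractionDensity.
Variables (R : realType) (I : finType) (e : I -> int).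
Notation RR := (measurableTypeR R).
Variable lam : {finite_measure set RR -> \bar R}.
Hypothesis atomless : forall s : R, lam [set s] = 0.
Variable f : RR * RR -> R[i].
Hypothesis bf : cbounded_measurable f.
Variable W : RR -> R.
Hypothesis mW : measurable_fun setT W.
Notation h i := (twisted_coef f W (e i)).
Notation hc i := (fun s => (twisted_coef f W (e i) s)^*%C).

Let bh i : cbounded_measurable (h i). Proof. exact: cbounded_twisted_coef. Qed.
Let bhc i : cbounded_measurable (hc i). Proof. by apply: cbounded_conj. Qed.

Definition interaction_density (q : (I * I) * (I * I)) : RR -> R[i] :=
  leibniz lam (leibniz lam (h q.1.1) (hc q.1.2)) (leibniz lam (h q.2.1) (hc q.2.2)).

Definition phase (q : (I * I) * (I * I)) : int :=
  e q.1.1 ^+ 2 - e q.1.2 ^+ 2 + (e q.2.1 ^+ 2 - e q.2.2 ^+ 2).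

Lemma interaction_primitive q t :
  interaction (fun i => duhamel lam f W (e i) t) q =
  cis ((phase q)%:~R * W t) * primitive lam (interaction_density q) t.
Proof.
have pair i j : duhamel lam f W (e i) t * (duhamel lam f W (e j) t)^*%C =
    cis ((e i ^+ 2 - e j ^+ 2)%:~R * W t) * primitive lam (leibniz lam (h i) (hc j)) t.
  rewrite /duhamel conjM conj_cis mulrACA -cisD primitive_conj// primitiveM//.
  by congr (cis _ * _); rewrite intrB !rmorphXn /=; ring.
apply: etrans (congr2 *%R (pair q.1.1 q.1.2) (pair q.2.1 q.2.2)) _.
rewrite /interaction_density.
rewrite -(primitiveM atomless t (cbounded_leibniz lam (bh q.1.1) (bhc q.1.2))
  (cbounded_leibniz lam (bh q.2.1) (bhc q.2.2))).
by rewrite /phase [in RHS]intrD mulrDl cisD mulrACA.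
Qed.

Lemma mass_conj g : mass lam (fun s => (g s)^*%C) = mass lam g.
Proof. by apply: eq_Rintegral => s _; rewrite modulus_conj. Qed.

Lemma mass_interaction_density q : mass lam (interaction_density q) <=
  2 * (mass lam (coef f (e q.1.1)) ^+ 4 + mass lam (coef f (e q.1.2)) ^+ 4 +
       mass lam (coef f (e q.2.1)) ^+ 4 + mass lam (coef f (e q.2.2)) ^+ 4).
Proof.
have arith (x y a b c z : R) : 0 <= x -> 0 <= y -> x <= 2 * a * b -> y <= 2 * c * z ->
    2 * x * y <= 2 * (a ^+ 4 + b ^+ 4 + c ^+ 4 + z ^+ 4).
  move=> x0 y0 xab ycz; have := ler_pM x0 y0 xab ycz; have := amgm4 a b c z.
  set S := _ + _ => amgm xy.
  apply: (@le_trans _ _ (8 * (a * b * c * z))).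
    by rewrite (_ : 8 * _ = 2 * (2 * a * b * (2 * c * z))); [rewrite -mulrA ler_pM2l|ring].
  by rewrite (_ : 2 * S = 8 * (S / 4)); [rewrite ler_pM2l|field].
have pair i j : mass lam (leibniz lam (h i) (hc j)) <=
    2 * mass lam (coef f (e i)) * mass lam (coef f (e j)).
  apply: le_trans (mass_leibniz _ (bh i) (bhc j)) _.
  by rewrite mass_conj !mass_twisted_coef.
apply: le_trans (mass_leibniz _ (cbounded_leibniz _ (bh _) (bhc _))
  (cbounded_leibniz _ (bh _) (bhc _))) _.
exact: arith (mass_ge0 _ _) (mass_ge0 _ _) (pair q.1.1 q.1.2) (pair q.2.1 q.2.2).
Qed.

End InteractionDensity.

Section BoundedEstimate.
Variables (R : realType) (alpha : R).
Notation RR := (measurableTypeR R).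
Notation kappa := (gauss_gap R / 2).
Notation c0 := ((2 * pi)^-1 : R).
Hypothesis al : 2^-1 < alpha <= 1.

Section Process.
Context d (Omega : measurableType d).
Variables (P : probability Omega R) (F : R -> set (set Omega)) (W : R -> Omega -> R).
Hypothesis rW : regular_brownian P F W.
Notation FS s := (g_sigma_algebraType (F s)).
Variables (T : R) (T0 : 0 < T).
Notation lam := (time_measure T0).
Notation mc := (circle_measure R).
Variable f : (Omega * RR) * RR -> R[i].

(** A bounded source, adapted to the filtration jointly in time and space. *)
Definition progressive_source : Prop :=
  cbounded_measurable f /\ forall s : R, 0 <= s ->
  cmeasurable_fun setT (fun z : (FS s * RR) * RR => f ((z.1.1, Num.min z.1.2 s), z.2)).

Hypothesis pf : progressive_source.

Definition path_source (w : Omega) (z : RR * RR) : R[i] := f ((w, z.1), z.2).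
Notation fw := path_source.
Notation Ww := (fun w t => W t w).

Lemma measurable_assoc d1 d2 d3 (T1 : measurableType d1) (T2 : measurableType d2)
  (T3 : measurableType d3) :
  measurable_fun setT (fun z : T1 * (T2 * T3) => ((z.1, z.2.1), z.2.2)).
Proof.
apply: measurable_fun_pair.
  apply: measurable_fun_pair; first exact: measurable_fst.
  by apply: (measurableT_comp measurable_fst); exact: measurable_snd.
by apply: (measurableT_comp measurable_snd); exact: measurable_snd.
Qed.

Lemma cbounded_path_source w : cbounded_measurable (fw w).
Proof.
apply: (cbounded_comp (phi := fun z : RR * RR => ((w, z.1), z.2)) _ pf.1).
apply: measurable_fun_pair; last exact: measurable_snd.
by apply: measurable_fun_pair => //; exact: measurable_fst.
Qed.

Lemma measurable_path w : measurable_fun setT (Ww w : RR -> R).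
Proof. exact: (measurableT_comp (rb_measurable rW) (pair1_measurable w)). Qed.

Lemma progressive_coef k : progressive F (fun z : Omega * RR => coef (fw z.1) k z.2).
Proof.
have mphase d1 (X : measurableType d1) :
    measurable_fun setT (fun z : X * RR => - (k%:~R * z.2) : R).
  by apply: measurable_funN; apply: measurable_funM => //; exact: measurable_snd.
have [bf sf] := pf; split.
  apply: cboundedM; first exact: cbounded_cst.
  apply: (cbounded_cintegral mc (g := fun z : (Omega * RR) * RR =>
    cis (- (k%:~R * z.2)) * f ((z.1.1, z.1.2), z.2))).
  apply: cboundedM; last by under eq_fun do rewrite -!surjective_pairing.
  apply: cbounded_cis; exact: mphase.
move=> s s0; apply: cmeasurableM; first exact: cmeasurable_cst.
apply: (cmeasurable_cintegral_section mc (g := fun z : (FS s * RR) * RR =>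
    cis (- (k%:~R * z.2)) * f ((z.1.1, Num.min z.1.2 s), z.2))).
apply: cmeasurableM; last exact: sf.
by apply: cmeasurable_cis; exact: mphase.
Qed.

Lemma progressive_twisted_coef k :
  progressive F (fun z : Omega * RR => twisted_coef (fw z.1) (Ww z.1) k z.2).
Proof.
apply: progressiveM; last exact: progressive_coef.
by under eq_fun do rewrite -mulNr; exact: (progressive_cis rW).
Qed.

Lemma progressive_duhamel k :
  progressive F (fun z : Omega * RR => duhamel lam (fw z.1) (Ww z.1) k z.2).
Proof.
apply: progressiveM; first exact: (progressive_cis rW).
exact: (progressive_primitive lam (progressive_twisted_coef k)).
Qed.

Variables (I : finType) (e : I -> int).
Hypothesis inje : injective e.

Lemma progressive_interaction_density q :
  progressive F (fun z : Omega * RR => interaction_density e lam (fw z.1) (Ww z.1) q z.2).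
Proof.
have ph i := progressive_twisted_coef (e i).
have pl i j := progressive_leibniz lam (ph i) (progressive_conj (ph j)).
exact: (progressive_leibniz lam (pl q.1.1 q.1.2) (pl q.2.1 q.2.2)).
Qed.

Lemma cbounded_interaction_process q : cbounded_measurable (fun z : Omega * RR =>
  interaction (fun i => duhamel lam (fw z.1) (Ww z.1) (e i) z.2) q).
Proof.
have bd i := (progressive_duhamel (e i)).1.
by do 2 apply: cboundedM => //; exact: cbounded_conj.
Qed.

Lemma cbounded_field_process : cbounded_measurable (fun z : (Omega * RR) * RR =>
  field e lam (fw z.1.1) (Ww z.1.1) z.1.2 z.2).
Proof.
apply: cbounded_sum => i; apply: cboundedM.
  exact: (cbounded_comp measurable_fst (progressive_duhamel (e i)).1).
apply: cbounded_cis; apply: measurable_funM => //; exact: measurable_snd.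
Qed.

Lemma cbounded_mass (h : Omega * RR -> R[i]) : cbounded_measurable h ->
  exists2 M : R, measurable_fun setT (fun w => mass lam (fun s => h (w, s))) &
  forall w, `|mass lam (fun s => h (w, s))| <= M.
Proof.
move=> bh; have [M mh hM] := cbounded_modulusE bh; exists (M * fine (lam setT)).
  exact: (measurable_Rintegral_section lam mh).
move=> w; apply: Rintegral_le_bound; first exact: (measurableT_comp mh (pair1_measurable w)).
by move=> s; exact: (hM (w, s)).
Qed.

Lemma mass_coef_bounded k n : exists2 M : R,
  measurable_fun setT (fun w => mass lam (coef (fw w) k) ^+ n) &
  forall w, `|mass lam (coef (fw w) k) ^+ n| <= M.
Proof.
have [M mm mM] := cbounded_mass (progressive_coef k).1; exists (M ^+ n).
  exact: measurable_funX.
by move=> w; rewrite normrX; apply: lerXn2r; rewrite ?nnegrE ?(le_trans _ (mM w)).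
Qed.

Lemma source43_bounded : exists2 M : R, measurable_fun setT (fun w => source43 lam (fw w)) &
  forall w, `|source43 lam (fw w)| <= M.
Proof.
have [[mf [M fM]] _] := pf.
have M0 : 0 <= M.
  exact: le_trans (modulus_ge0 _) (fM ((point, 0), 0)).
have mp : measurable_fun setT (fun z : Omega * (RR * RR) => modulus (fw z.1 z.2) `^ (4 / 3)).
  apply: (measurableT_comp (@measurable_powR R (4 / 3))).
  apply: (measurableT_comp (measurable_modulus mf)
    (g := fun z : Omega * (RR * RR) => ((z.1, z.2.1), z.2.2))).
  exact: measurable_assoc.
have pM w z : `|modulus (fw w z) `^ (4 / 3)| <= M `^ (4 / 3).
  rewrite ger0_norm ?powR_ge0// ge0_ler_powR ?nnegrE ?modulus_ge0//.
  exact: fM.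
exists ((M `^ (4 / 3) * fine (finite_product lam mc setT)) ^+ 3).
  apply: measurable_funX.
  exact: (measurable_Rintegral_section (finite_product lam mc) mp).
move=> w; rewrite /source43 normrX; apply: lerXn2r; rewrite ?nnegrE//.
  by apply: mulr_ge0; [exact: powR_ge0|exact: fine_ge0].
apply: Rintegral_le_bound => //.
exact: (measurableT_comp mp (pair1_measurable w)).
Qed.

Lemma field4_bounded : exists2 M : R,
  measurable_fun setT (fun w => field4 e lam (fw w) (Ww w)) &
  forall w, `|field4 e lam (fw w) (Ww w)| <= M.
Proof.
have b := cbounded_comp (@measurable_assoc _ _ _ Omega RR RR) cbounded_field_process.
have [M m4 M4] := cbounded_modulusX 4 b.
exists (M * fine (finite_product lam mc setT)).
  exact: (measurable_Rintegral_section (finite_product lam mc) m4).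
move=> w; apply: Rintegral_le_bound.
  exact: (measurableT_comp m4 (pair1_measurable w)).
by move=> z; exact: (M4 (w, z)).
Qed.

Definition mean_mass4 (i : I) : R := \int[P]_w (mass lam (coef (fw w) (e i)) ^+ 4).

Let mass4_integrable i : P.-integrable setT
  (EFin \o (fun w => mass lam (coef (fw w) (e i)) ^+ 4)).
Proof. by have [M m4 M4] := mass_coef_bounded (e i) 4; exact: (@bounded_integrable _ _ _ _ _ M). Qed.

Let source43_integrable : P.-integrable setT (EFin \o (fun w => source43 lam (fw w))).
Proof. by have [M m4 M4] := source43_bounded; exact: (@bounded_integrable _ _ _ _ _ M). Qed.

Let c0_gt0 : 0 < c0. Proof. by rewrite invr_gt0 mulr_gt0 ?pi_gt0. Qed.

Lemma mean_mass4_ge0 i : 0 <= mean_mass4 i.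
Proof. by apply: Rintegral_ge0 => w _; rewrite exprn_ge0 ?mass_ge0. Qed.

Lemma sum_mean_mass4 : \sum_i mean_mass4 i <=
  c0 ^+ 4 * (2 * pi) * T * \int[P]_w source43 lam (fw w).
Proof.
rewrite /mean_mass4 -Rintegral_sum// -RintegralZl//.
apply: le_Rintegral => //.
- exact: integrable_sumR.
- exact: integrable_scaleR.
move=> w _; rewrite -[X in _ * X * _](time_measureT T0).
by apply: mass_coef_l4 => //; exact: cbounded_path_source.
Qed.

(** The decay of order [- alpha] in the squared phase becomes one of order
    [- (2 * alpha)] in each gap, which is summable. *)
Lemma phase_weight (q : (I * I) * (I * I)) : nonresonant e q ->
  (kappa * (phase e q)%:~R ^+ 2) `^ (- alpha) =
  (4 * kappa) `^ (- alpha) * (gap_weight (2 * alpha) (e q.1.1 - e q.1.2) *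
    gap_weight (2 * alpha) (e q.1.1 - e q.2.2)).
Proof.
move=> /andP[bq /andP[ne1 ne2]].
rewrite /phase balanced_phase// /gap_weight !subr_eq0 !(inj_eq inje) (negbTE ne1) (negbTE ne2).
set n := e q.1.1 - e q.1.2; set m := e q.1.1 - e q.2.2.
have sq (k : int) : (k%:~R : R) ^+ 2 = (`|k|%N)%:R `^ 2.
  by rewrite powR_mulrn// natr_absz intr_norm real_normK ?num_real.
have k0 : 0 <= 4 * kappa :> R by rewrite mulr_ge0// divr_ge0// ltW// gauss_gap_gt0.
rewrite (_ : kappa * _ = 4 * kappa * ((`|n|%N)%:R `^ 2 * (`|m|%N)%:R `^ 2)); last first.
  by rewrite -!sq !intrM; ring.
rewrite (powRM _ k0 (mulr_ge0 (powR_ge0 _ _) (powR_ge0 _ _))).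
by rewrite (powRM _ (powR_ge0 _ _) (powR_ge0 _ _)) -!powRrM mulrN.
Qed.

Lemma mean_interaction_le q : nonresonant e q ->
  modulus (\cint[P]_w \cint[lam]_t
    interaction (fun i => duhamel lam (fw w) (Ww w) (e i) t) q) <=
  expR kappa * T `^ (1 - alpha) * (4 * kappa) `^ (- alpha) * 2 *
  (gap_weight (2 * alpha) (e q.1.1 - e q.1.2) *
   gap_weight (2 * alpha) (e q.1.1 - e q.2.2) *
   (mean_mass4 q.1.1 + mean_mass4 q.1.2 + mean_mass4 q.2.1 + mean_mass4 q.2.2)).
Proof.
move=> nq; have al01 : 0 <= alpha <= 1 by move/andP: al => [? ->]; rewrite andbT; lra.
have nu0 : (phase e q)%:~R != 0 :> R.
  rewrite intr_eq0 /phase; move: nq => /andP[bq /andP[ne1 ne2]].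
  by rewrite balanced_phase// !mulf_neq0// subr_eq0 (inj_eq inje).
have -> : \cint[P]_w \cint[lam]_t interaction (fun i => duhamel lam (fw w) (Ww w) (e i) t) q =
    \cint[P]_w \cint[lam]_t (cis ((phase e q)%:~R * W t w) *
      primitive lam (fun s => interaction_density e lam (fw w) (Ww w) q s) t).
  apply: eq_cintegral => w; apply: eq_cintegral => t.
  apply: interaction_primitive; first exact: time_measure_atomless.
    exact: cbounded_path_source.
  exact: measurable_path.
have pd := progressive_interaction_density q.
apply: le_trans (nonresonant_expectation rW T0 al01 nu0 pd) _.
rewrite phase_weight//.
have mq : \int[P]_w mass lam (fun s => interaction_density e lam (fw w) (Ww w) q s) <=
    2 * (mean_mass4 q.1.1 + mean_mass4 q.1.2 + mean_mass4 q.2.1 + mean_mass4 q.2.2).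
  rewrite /mean_mass4 -!RintegralD//; try by do ?apply: integrable_addR.
  rewrite -RintegralZl//; last by do ?apply: integrable_addR.
  apply: le_Rintegral => //.
  - have [M mm mM] := cbounded_mass pd.1; exact: (@bounded_integrable _ _ _ _ _ M).
  - by apply: integrable_scaleR; do ?apply: integrable_addR.
  move=> w _; apply: mass_interaction_density; first exact: cbounded_path_source.
  exact: measurable_path.
move: mq; set S := _ + _ + _ + _; set gg := gap_weight _ _ * gap_weight _ _.
set m := Rintegral _ _ _; set D := expR kappa * _ => mS.
have gg0 : 0 <= gg by rewrite mulr_ge0 ?gap_weight_ge0.
have D0 : 0 <= D by rewrite /D mulr_ge0 ?expR_ge0// mulr_ge0 ?powR_ge0// mulr_ge0 ?powR_ge0.
apply: le_trans (ler_wpM2l D0 mS) _.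
by rewrite le_eqVlt /D; apply/orP; left; apply/eqP; ring.
Qed.

Variable Z : R.
Hypothesis gapZ : forall (J : finType) (g : J -> int), injective g ->
  \sum_i gap_weight (2 * alpha) (g i) <= Z.

Definition resonant_constant : R := 256 * pi ^+ 2 * c0 ^+ 4.
Definition nonresonant_constant : R :=
  4 * pi * (expR kappa * (4 * kappa) `^ (- alpha) * 2 * (4 * Z ^+ 2 * (c0 ^+ 4 * (2 * pi)))).

(** The decay of the single interactions in the gaps is summed by the Schur
    test; the remaining sum over one mode is that of [mass_coef_l4]. *)
Lemma mean_nonresonant_le :
  modulus (\cint[P]_w \cint[lam]_t (\sum_(q | nonresonant e q)
    interaction (fun i => duhamel lam (fw w) (Ww w) (e i) t) q)) <=
  expR kappa * T `^ (1 - alpha) * (4 * kappa) `^ (- alpha) * 2 *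
  (4 * Z ^+ 2 * (c0 ^+ 4 * (2 * pi) * T * \int[P]_w source43 lam (fw w))).
Proof.
have bI := cbounded_interaction_process.
have -> : \cint[P]_w \cint[lam]_t (\sum_(q | nonresonant e q)
    interaction (fun i => duhamel lam (fw w) (Ww w) (e i) t) q) =
    \sum_(q | nonresonant e q) \cint[P]_w \cint[lam]_t
      interaction (fun i => duhamel lam (fw w) (Ww w) (e i) t) q.
  rewrite -cintegral_sum; last first.
    by move=> q; apply: cbounded_integrable; exact: (cbounded_cintegral lam (bI q)).
  apply: eq_cintegral => w; rewrite cintegral_sum// => q.
  by apply: cbounded_integrable; exact: (cbounded_section1 (bI q) w).
apply: le_trans (modulus_sum _ _ _) _.
set D := expR kappa * _ * _ * 2.
have D0 : 0 <= D.
  by rewrite mulr_ge0// mulr_ge0 ?powR_ge0// mulr_ge0 ?powR_ge0 ?expR_ge0.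
apply: (@le_trans _ _ (\sum_(q | balanced e q) D *
  (gap_weight (2 * alpha) (e q.1.1 - e q.1.2) *
   gap_weight (2 * alpha) (e q.1.1 - e q.2.2) *
   (mean_mass4 q.1.1 + mean_mass4 q.1.2 + mean_mass4 q.2.1 + mean_mass4 q.2.2)))).
  rewrite big_mkcond [leRHS]big_mkcond; apply: ler_sum => q _.
  case: ifPn => [nq|_].
    by have /andP[-> _] := nq; exact: mean_interaction_le.
  case: ifP => // _; apply: mulr_ge0 D0 _.
  apply: mulr_ge0; first exact: mulr_ge0 (gap_weight_ge0 _ _) (gap_weight_ge0 _ _).
  by do ![apply: addr_ge0]; exact: mean_mass4_ge0.
rewrite -mulr_sumr; apply: ler_wpM2l => //.
have Zj n : \sum_j gap_weight (2 * alpha) (n - e j) <= Z.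
  by apply: gapZ => i j /addrI /oppr_inj /inje.
apply: le_trans (balanced_schur inje (gap_weight_ge0 _) (gap_weightN _) mean_mass4_ge0 Zj) _.
by apply: ler_wpM2l sum_mean_mass4; rewrite mulr_ge0 ?sqr_ge0.
Qed.

Lemma mean_field4_le : \int[P]_w field4 e lam (fw w) (Ww w) <=
  (resonant_constant * T ^+ 2 + nonresonant_constant * T `^ (2 - alpha)) *
  \int[P]_w source43 lam (fw w).
Proof.
have bI := cbounded_interaction_process.
pose Y w := \cint[lam]_t (\sum_(q | nonresonant e q)
  interaction (fun i => duhamel lam (fw w) (Ww w) (e i) t) q).
have bY : cbounded_measurable Y.
  have bS : cbounded_measurable (fun z : Omega * RR => \sum_(q | nonresonant e q)
      interaction (fun i => duhamel lam (fw z.1) (Ww z.1) (e i) z.2) q).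
    by apply: cbounded_sum => q; exact: bI.
  exact: (cbounded_cintegral lam bS).
have [iY _] := cbounded_integrable P bY.
have [M m4 M4] := field4_bounded.
apply: (@le_trans _ _ (\int[P]_w (resonant_constant * T ^+ 2 * source43 lam (fw w) +
    4 * pi * complex.Re (Y w)))).
  apply: le_Rintegral => //.
  - exact: (@bounded_integrable _ _ _ _ _ M).
  - by apply: integrable_addR; exact: integrable_scaleR.
  move=> w _; have := field4_le inje (time_measure_atomless T0) (cbounded_path_source w) (measurable_path w).
  by rewrite time_measureT.
rewrite RintegralD//; [|exact: integrable_scaleR|exact: integrable_scaleR].
rewrite !RintegralZl// [leRHS]mulrDl; apply: lerD => //.
have -> : \int[P]_w complex.Re (Y w) = complex.Re (\cint[P]_w Y w) by [].
apply: (@le_trans _ _ (4 * pi * (expR kappa * T `^ (1 - alpha) * (4 * kappa) `^ (- alpha) * 2 *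
  (4 * Z ^+ 2 * (c0 ^+ 4 * (2 * pi) * T * \int[P]_w source43 lam (fw w)))))).
  rewrite ler_pM2l ?mulr_gt0 ?pi_gt0//.
  exact: le_trans (Re_le_modulus _) mean_nonresonant_le.
have -> : T `^ (2 - alpha) = T `^ (1 - alpha) * T.
  rewrite -[X in _ * X](powRr1 (ltW T0)) -powRD; first by congr (_ `^ _); ring.
  by rewrite (gt_eqF T0) implybT.
by rewrite /nonresonant_constant le_eqVlt; apply/orP; left; apply/eqP; ring.
Qed.

End Process.
End BoundedEstimate.

(** * A jointly measurable version of the Brownian path *)

Section CountableSelection.
Context d (Z : measurableType d) (R : realType).

(** Only the pieces whose index is attained need to be measurable: for a
    stopped process these are the ones that precede the stopping time. *)
Lemma measurable_selection (K : Z -> nat) (V : nat -> Z -> R) :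
  measurable_fun setT (fun z => (K z)%:R : R) ->
  (forall z, measurable_fun setT (V (K z))) ->
  measurable_fun setT (fun z => V (K z) z).
Proof.
move=> mK mV _ B mB; rewrite setTI.
have -> : (fun z => V (K z) z) @^-1` B =
    \bigcup_j ([set z | K z = j] `&` [set z | V j z \in B /\ exists y, K y = j]).
  apply/seteqP; split => z /=.
    by move=> Bz; exists (K z) => //; split => //; split; [exact: mem_set|exists z].
  by move=> [j _ [/= <-]] [] /set_mem.
apply: bigcup_measurable => j _; apply: measurableI.
  have -> : [set z | K z = j] = (fun z => (K z)%:R : R) @^-1` [set j%:R].
    by apply/seteqP; split => z /=; [move=> ->|move=> /eqP; rewrite eqr_nat => /eqP].
  by rewrite -[X in measurable X]setTI; exact: mK.
have [[y <-]|nex] := pselect (exists y, K y = j).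
  have -> : [set z | V (K y) z \in B /\ exists y0, K y0 = K y] = V (K y) @^-1` B.
    by apply/seteqP; split => z /=; [move=> [] /set_mem|move=> Bz; split; [exact: mem_set|exists y]].
  by rewrite -[X in measurable X]setTI; exact: mV.
rewrite (_ : [set z | _ ] = set0)//.
by apply/seteqP; split => z //= [_].
Qed.

End CountableSelection.

Section RegularVersion.
Context d (Omega : measurableType d) (R : realType).
Notation RR := (measurableTypeR R).
Variables (P : probability Omega R) (F : R -> set (set Omega)) (W : R -> Omega -> R).
Hypothesis bW : is_brownian_motion P F W.
Notation FS s := (g_sigma_algebraType (F s)).

Definition grid (n : nat) (t : R) : R := (Num.trunc (t * n.+1%:R))%:R / n.+1%:R.

(** The grid point lies to the left of [t], so the upper limit of the values at
    the grid points is adapted; it is jointly measurable, each of its terms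
    being constant in time between grid points, and it is [W t w] whenever the
    path is continuous. *)
Definition regular_path (t : R) (w : Omega) : R :=
  fine (limn_esup (fun n => (W (grid n t) w)%:E)).

Lemma grid_ge0 n t : 0 <= grid n t.
Proof. by rewrite /grid divr_ge0. Qed.

Lemma grid_le n t : 0 <= t -> grid n t <= t.
Proof.
by move=> t0; rewrite /grid ler_pdivrMr// truncn_le mulr_ge0.
Qed.

Lemma grid_gt n t : 0 <= t -> t - n.+1%:R^-1 < grid n t.
Proof.
move=> t0; have /andP[_] := truncn_itv (mulr_ge0 t0 (ler0n R n.+1)).
by rewrite ltrBlDr /grid -[X in _ < _ + X]mul1r -mulrDl ltr_pdivlMr// natr1.
Qed.

Lemma cvg_grid t : 0 <= t -> grid n t @[n --> \oo] --> t.
Proof.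
move=> t0; apply: (@squeeze_cvgr _ _ _ _ (fun n => t - n.+1%:R^-1) (fun=> t)).
- by apply: nearW => n; rewrite (ltW (grid_gt n t0)) grid_le.
- rewrite -[X in _ --> X]subr0; apply: cvgB; first exact: cvg_cst.
  exact: cvg_harmonic.
- exact: cvg_cst.
Qed.

Lemma measurable_grid_index d' (S : measurableType d') n (psi : S -> RR) :
  measurable_fun setT psi ->
  measurable_fun setT (fun z => (Num.trunc (psi z * n.+1%:R))%:R : R).
Proof.
move=> mpsi.
have mtr : measurable_fun setT (fun x : R => (Num.trunc x)%:R : R).
  by apply: nondecreasing_measurable => // x y xy; rewrite ler_nat le_truncn.
by apply: (measurableT_comp mtr (g := fun z => psi z * n.+1%:R)); exact: measurable_funM.
Qed.

Lemma measurable_regular_path d' (S : measurableType d') (p : S -> Omega) (psi : S -> RR) :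
  measurable_fun setT psi ->
  (forall n z, measurable_fun setT (fun y => W (grid n (psi z)) (p y))) ->
  measurable_fun setT (fun z => regular_path (psi z) (p z)).
Proof.
move=> mpsi mW; apply: measurableT_comp => //.
apply: (measurable_fun_limn_esup (f := fun n z => (W (grid n (psi z)) (p z))%:E)) => n.
apply/measurable_EFinP.
apply: (measurable_selection (K := fun z => Num.trunc (psi z * n.+1%:R))
  (V := fun j z => W (j%:R / n.+1%:R) (p z))).
  exact: measurable_grid_index.
by move=> z; exact: mW.
Qed.

Let Fm t : 0 <= t -> sigma_algebra setT (F t) /\ F t `<=` measurable.
Proof. exact: (bm_filtration bW).1. Qed.

Lemma adapted_at (r s : R) : 0 <= r -> r <= s -> measurable_fun setT (W r : FS s -> R).
Proof.
move=> r0 rs _ B mB; rewrite setTI.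
have FB := bm_adapted bW r0 mB.
have := (bm_filtration bW).2 _ _ r0 rs _ FB.
by rewrite /measurable /= sigma_algebra_id//; have [] := Fm (le_trans r0 rs).
Qed.

Lemma measurable_at (r : R) : 0 <= r -> measurable_fun setT (W r).
Proof.
move=> r0 _ B mB; rewrite setTI; apply: (Fm r0).2.
exact: (bm_adapted bW r0 mB).
Qed.

Lemma regular_pathE : {ae P, forall w, forall t, 0 <= t -> regular_path t w = W t w}.
Proof.
have := bm_continuous bW; apply: filterS => w /subspace_continuousP cW t t0.
have cv : W (grid n t) w @[n --> \oo] --> W t w.
  have Wt := cW t _; rewrite /= in_itv /= andbT in Wt.
  apply: (cvg_comp _ _ _ (Wt t0)).
  move=> A /= [e e0 /= Ae].
  have /cvgrPdist_lt/(_ e e0) := cvg_grid t0; apply: filterS => n ge.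
  by apply: Ae => //=; rewrite in_itv /= andbT grid_ge0.
have cvE : (W (grid n t) w)%:E @[n --> \oo] --> (W t w)%:E.
  by apply: cvg_EFin => //; exact: nearW.
by rewrite /regular_path (cvg_limn_einf_sup cvE).2.
Qed.

Lemma measurable_regular : measurable_fun setT (fun z : Omega * RR => regular_path z.2 z.1).
Proof.
apply: measurable_regular_path; first exact: measurable_snd.
move=> n z; apply: (measurableT_comp (measurable_at (grid_ge0 n z.2))).
exact: measurable_fst.
Qed.

Lemma progressive_regular s : 0 <= s ->
  measurable_fun setT (fun z : FS s * RR => regular_path (Num.min z.2 s) z.1).
Proof.
move=> s0.
apply: (measurable_regular_path (p := fun z : FS s * RR => z.1) (psi := fun z => Num.min z.2 s)).
  by apply: measurable_minr => //; exact: measurable_snd.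
move=> n z; set r := Num.min z.2 s.
have rs : grid n r <= s.
  have [r0|r0] := leP 0 r; first by rewrite (le_trans (grid_le n r0))// ge_min lexx orbT.
  rewrite /grid (_ : Num.trunc _ = 0%N) ?mul0r//.
  by apply/eqP; rewrite -leqn0 leqNgt truncn_gt0 -ltNge (lt_trans _ (ltr01 : 0 < 1 :> R))// pmulr_llt0.
apply: (measurableT_comp (adapted_at (grid_ge0 n r) rs)); exact: measurable_fst.
Qed.

Lemma ae_eq_measure (A B : set Omega) : measurable A -> measurable B ->
  {ae P, forall w, A w <-> B w} -> P A = P B.
Proof.
move=> mA mB [N [mN N0 subN]].
have le (X Y : set Omega) : measurable X -> measurable Y ->
    (forall w, ~ N w -> X w -> Y w) -> (P X <= P Y)%E.
  move=> mX mY XY; apply: (@le_trans _ _ (P (Y `|` N))).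
    apply: le_measure; rewrite ?inE//; first exact: measurableU.
    by move=> w Xw; have [Nw|Nw] := pselect (N w); [right|left; exact: XY].
  apply: le_trans (measureU2 _ mY mN) _.
  by rewrite [X in (_ + X)%E](N0 : P N = 0%E) adde0.
have AB w : ~ N w -> (A w <-> B w) by move=> Nw; apply: contrapT => h; apply: Nw; exact: subN.
by apply/eqP; rewrite eq_le !le// => w /AB[].
Qed.

Lemma regular_brownian_regular : regular_brownian P F regular_path.
Proof.
have mreg t : measurable_fun setT (regular_path t).
  exact: (measurableT_comp measurable_regular (pair2_measurable (t : RR))).
have minc (V : R -> Omega -> R) s t B : measurable_fun setT (V s) -> measurable_fun setT (V t) ->
    measurable B -> measurable (increment V s t @^-1` B).
  move=> ms mt mB; rewrite -[X in measurable X]setTI.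
  by apply: (measurable_funB mt ms).
have aeinc s t B : 0 <= s -> s < t -> {ae P, forall w,
    (increment regular_path s t @^-1` B) w <-> (increment W s t @^-1` B) w}.
  move=> s0 st; have := regular_pathE; apply: filterS => w E.
  by rewrite /increment /= !E// (le_trans s0)// ltW.
split.
- exact: bm_filtration bW.
- exact: measurable_regular.
- exact: progressive_regular.
- move=> s t s0 st B mB; rewrite -(bm_gaussian bW s0 st mB).
  have t0 := le_trans s0 (ltW st).
  by apply: ae_eq_measure; [exact: minc|by apply: minc => //; exact: measurable_at|exact: aeinc].
- move=> s t s0 st A B FA mB.
  have t0 := le_trans s0 (ltW st); have mA : measurable A by exact: (Fm s0).2.
  have m1 : measurable (increment regular_path s t @^-1` B) by exact: minc.
  have m2 : measurable (increment W s t @^-1` B) by apply: minc => //; exact: measurable_at.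
  rewrite (ae_eq_measure m1 m2 (aeinc s t B s0 st)) -(bm_independent bW s0 st FA mB).
  apply: ae_eq_measure; [exact: measurableI|exact: measurableI|].
  by have := aeinc s t B s0 st; apply: filterS => w [h1 h2]; split => -[Aw Iw]; split => //; [exact: h1|exact: h2].
Qed.

End RegularVersion.

(** * Predictable sources and their truncations *)

Section PredictableSource.
Context d (Omega : measurableType d) (R : realType).
Notation RR := (measurableTypeR R).
Variables (F : R -> set (set Omega)).
Hypothesis fF : is_filtration F.
Notation FS s := (g_sigma_algebraType (F s)).
Notation PT := (g_sigma_algebraType (predictable_rectangle F)).

Let sF s : 0 <= s -> sigma_algebra setT (F s). Proof. by move=> s0; exact: (fF.1 s s0).1. Qed.

Let FST s : 0 <= s -> F s setT.
Proof.
move=> s0; have [F0 FC _] := sF s0.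
by have := FC _ F0; rewrite setD0.
Qed.

Let FSm s (A : set Omega) : 0 <= s -> F s A -> measurable (A : set (FS s)).
Proof. by move=> s0 FA; rewrite /measurable /= sigma_algebra_id//; exact: sF. Qed.

(** Stopping the time variable at [s] turns a predictable set into a set that
    is measurable for [F s]: a generating rectangle that starts after [s]
    becomes empty, any other has its base in [F s]. *)
Lemma measurable_stop (s : R) : 0 <= s ->
  measurable_fun setT (fun z : FS s * RR => (z.1, Num.min z.2 s) : PT).
Proof.
move=> s0; apply: (measurability (predictable_rectangle F : set (set PT)) erefl).
have mmin : measurable_fun setT (fun r : RR => Num.min r s : R) by exact: measurable_minr.
move=> _ [Q PQ <-]; rewrite setTI; case: PQ => [[A FA ->]|[a [b [A [a0 ab FA ->]]]]].
  have -> : (fun z : FS s * RR => (z.1, Num.min z.2 s)) @^-1` (A `*` [set 0]) =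
      A `*` ((fun r : RR => Num.min r s : R) @^-1` [set 0]) by [].
  apply: measurableX; first by apply: FSm => //; exact: (fF.2 0 s).
  by rewrite -[X in measurable X]setTI; exact: mmin.
have [as'|sa] := ltP a s.
  have -> : (fun z : FS s * RR => (z.1, Num.min z.2 s)) @^-1` (A `*` `]a, b]) =
      A `*` ((fun r : RR => Num.min r s : R) @^-1` `]a, b]) by [].
  apply: measurableX; first by apply: FSm => //; exact: (fF.2 a s a0 (ltW as')).
  by rewrite -[X in measurable X]setTI; exact: mmin.
rewrite (_ : _ @^-1` _ = set0)//; apply/seteqP; split => -[w r] //= [_].
by rewrite in_itv /= => /andP[]; rewrite ltNge ge_min sa orbT.
Qed.

Lemma measurable_predictable_id : measurable_fun setT (id : Omega * RR -> PT).
Proof.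
apply: (measurability (predictable_rectangle F : set (set PT)) erefl).
move=> _ [Q PQ <-]; rewrite setTI preimage_id; case: PQ => [[A FA ->]|[a [b [A [a0 ab FA ->]]]]].
  by apply: measurableX => //; exact: (fF.1 0 (lexx 0)).2.
by apply: measurableX; [exact: (fF.1 a a0).2|exact: measurable_itv].
Qed.

Variables (T : R) (T0 : 0 < T).

Lemma measurable_sample : @measurable _ (PT * R)%type (@sample_spacetime d Omega R T).
Proof.
apply: measurableX; last exact: measurable_circle.
have -> : [set: Omega] `*` `[0, T]%classic = ([set: Omega] `*` [set 0]) `|` ([set: Omega] `*` `]0, T]%classic).
  apply/seteqP; split => -[w r] /=.
    rewrite in_itv /= => -[_ /andP[r0 rT]].
    move: r0; rewrite le_eqVlt => /orP[/eqP <-|r0]; first by left.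
    by right; rewrite in_itv /= r0.
  move=> [[_ ->]|[_]]; first by rewrite in_itv /= lexx ltW.
  by rewrite !in_itv /= => /andP[/ltW -> ->].
apply: measurableU; apply: sub_sigma_algebra.
  by left; exists setT => //; exact: FST.
by right; exists 0, T, setT; split => //; [exact: ltW|exact: FST].
Qed.

Variable f : Omega -> R -> R -> R[i].
Hypothesis pf : predictable F T f.

Definition source (z : (Omega * RR) * RR) : R[i] :=
  if z \in sample_spacetime T then f z.1.1 z.1.2 z.2 else 0.

(** Truncation in size keeps the source adapted, makes it bounded, and at each
    point is the identity from some [M] on. *)
Definition truncated (M : nat) (z : (Omega * RR) * RR) : R[i] :=
  if modulus (source z) <= M%:R then source z else 0.

Lemma cmeasurable_predictable_source :
  @cmeasurable_fun _ (PT * RR)%type R setT source.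
Proof.
have [pf1 pf2] := pf; split.
- have := (measurable_restrictT _ measurable_sample).1 pf1.
  by apply: eq_measurable_fun => z _; rewrite patchE /source; case: ifP.
- have := (measurable_restrictT _ measurable_sample).1 pf2.
  by apply: eq_measurable_fun => z _; rewrite patchE /source; case: ifP.
Qed.

Lemma cmeasurable_truncated d' (S : measurableType d') (g : S -> R[i]) (M : R) :
  cmeasurable_fun setT g ->
  cmeasurable_fun setT (fun z => if modulus (g z) <= M then g z else 0).
Proof.
move=> mg; have mle : measurable_fun setT (fun z => modulus (g z) <= M).
  by apply: measurable_fun_ler => //; exact: measurable_modulus.
have [g1 g2] := mg; split.
- by under eq_fun do rewrite (fun_if (@complex.Re R)); exact: measurable_fun_ifT.
- by under eq_fun do rewrite (fun_if (@complex.Im R)); exact: measurable_fun_ifT.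
Qed.

Lemma cmeasurable_source : cmeasurable_fun setT source.
Proof.
have m : measurable_fun setT (fun z : (Omega * RR) * RR => (z.1, z.2) : PT * RR).
  apply: measurable_fun_pair; last exact: measurable_snd.
  by apply: (measurableT_comp measurable_predictable_id); exact: measurable_fst.
have := cmeasurable_comp m cmeasurable_predictable_source.
by rewrite /comp /=; under [X in cmeasurable_fun _ X -> _]eq_fun do rewrite -surjective_pairing.
Qed.

Lemma progressive_truncated M : progressive_source F (truncated M).
Proof.
split.
  split; first exact: cmeasurable_truncated cmeasurable_source.
  by exists M%:R => z; rewrite /truncated; case: ifP => //; rewrite modulus0.
move=> s s0; apply: (cmeasurable_truncated M%:R (g := fun z : (FS s * RR) * RR =>
  source ((z.1.1, Num.min z.1.2 s), z.2))).
have m : measurable_fun setT (fun z : (FS s * RR) * RR =>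
    ((z.1.1, Num.min z.1.2 s), z.2) : PT * RR).
  apply: measurable_fun_pair; last exact: measurable_snd.
  by apply: (measurableT_comp (measurable_stop s0)); exact: measurable_fst.
exact: (cmeasurable_comp m cmeasurable_predictable_source).
Qed.

Lemma modulus_truncated_le M z : modulus (truncated M z) <= modulus (source z).
Proof. by rewrite /truncated; case: ifP => // _; rewrite modulus0 modulus_ge0. Qed.

Lemma truncated_eq z : \forall M \near \oo, truncated M z = source z.
Proof.
exists (Num.truncn (modulus (source z))).+1 => // M /= hM.
rewrite /truncated ifT//; have /andP[_ /ltW h] := truncn_itv (modulus_ge0 (source z)).
by apply: le_trans h _; rewrite ler_nat.
Qed.

End PredictableSource.

(** * Limit theorems for complex integrals *)

Section ComplexLimits.
Variable R : realType.
Implicit Types (u v : nat -> R[i]) (l m : R[i]).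

(** Convergence in [R[i]], componentwise. *)
Definition ccvg u l : Prop :=
  (complex.Re (u n) @[n --> \oo] --> complex.Re l) /\
  (complex.Im (u n) @[n --> \oo] --> complex.Im l).

Lemma ccvg_cst l : ccvg (fun _ => l) l.
Proof. by split; exact: cvg_cst. Qed.

Lemma ccvg_near u l : (\forall n \near \oo, u n = l) -> ccvg u l.
Proof.
move=> ul; split.
- apply: cvg_near_cst.
  by near=> n; rewrite (near ul n).
- apply: cvg_near_cst.
  by near=> n; rewrite (near ul n).
Unshelve. all: by end_near. Qed.

Lemma ccvgD u v l m : ccvg u l -> ccvg v m -> ccvg (fun n => u n + v n) (l + m).
Proof.
move=> [u1 u2] [v1 v2]; split.
- by rewrite ReD; under eq_cvg do rewrite ReD; exact: cvgD.
- by rewrite ImD; under eq_cvg do rewrite ImD; exact: cvgD.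
Qed.

Lemma ccvgM u v l m : ccvg u l -> ccvg v m -> ccvg (fun n => u n * v n) (l * m).
Proof.
move=> [u1 u2] [v1 v2]; split.
- by rewrite ReM; under eq_cvg do rewrite ReM; apply: cvgB; exact: cvgM.
- by rewrite ImM; under eq_cvg do rewrite ImM; apply: cvgD; exact: cvgM.
Qed.

Lemma ccvg_sum (I : Type) (r : seq I) (u : I -> nat -> R[i]) (l : I -> R[i]) :
  (forall i, ccvg (u i) (l i)) ->
  ccvg (fun n => \sum_(i <- r) u i n) (\sum_(i <- r) l i).
Proof.
move=> ul; elim: r => [|i r IH].
  by rewrite big_nil; under eq_fun do rewrite big_nil; exact: ccvg_cst.
by rewrite big_cons; under eq_fun do rewrite big_cons; exact: ccvgD.
Qed.

Lemma ccvg_modulus u l : ccvg u l -> modulus (u n) @[n --> \oo] --> modulus l.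
Proof.
have E z : modulus z = Num.sqrt (complex.Re z * complex.Re z + complex.Im z * complex.Im z).
  by case: z => a b; rewrite -!expr2.
move=> [u1 u2]; rewrite E; under eq_cvg do rewrite E.
apply: continuous_cvg; first exact: sqrt_continuous.
by apply: cvgD; apply: cvgM.
Qed.

Lemma ccvg_unique u l m : ccvg u l -> ccvg u m -> l = m.
Proof.
move=> [u1 u2] [v1 v2]; apply: complex_ext.
- exact: (cvg_unique _ u1 v1).
- exact: (cvg_unique _ u2 v2).
Qed.

End ComplexLimits.

Section LimitTheorems.
Context d (T : measurableType d) (R : realType).

(** A limit of real functions that is measurable in the parameter even where
    the sequence diverges. *)
Definition measurable_limit (v : nat -> T -> R) (x : T) : R :=
  fine (limn_esup (fun n => (v n x)%:E)).

Lemma measurable_limit_measurable (v : nat -> T -> R) :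
  (forall n, measurable_fun setT (v n)) -> measurable_fun setT (measurable_limit v).
Proof.
move=> mv; apply: (measurableT_comp (fine_measurable _)) => //.
by apply: measurable_fun_limn_esup => n; exact/measurable_EFinP.
Qed.

Lemma measurable_limitE (v : nat -> T -> R) x l :
  v n x @[n --> \oo] --> l -> measurable_limit v x = l.
Proof.
move=> vl; have : (v n x)%:E @[n --> \oo] --> l%:E by apply: cvg_EFin => //; exact: nearW.
by move=> /cvg_limn_einf_sup[_]; rewrite /measurable_limit => ->.
Qed.

Definition cmeasurable_limit (v : nat -> T -> R[i]) (x : T) : R[i] :=
  measurable_limit (fun n x => complex.Re (v n x)) x +i*
  measurable_limit (fun n x => complex.Im (v n x)) x.

Lemma cmeasurable_limit_measurable (v : nat -> T -> R[i]) :
  (forall n, cmeasurable_fun setT (v n)) -> cmeasurable_fun setT (cmeasurable_limit v).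
Proof. by move=> mv; split; apply: measurable_limit_measurable => n; case: (mv n). Qed.

Lemma cmeasurable_limitE (v : nat -> T -> R[i]) x l :
  ccvg (v ^~ x) l -> cmeasurable_limit v x = l.
Proof.
move=> [v1 v2]; apply: complex_ext => /=.
- exact: (measurable_limitE v1).
- exact: (measurable_limitE v2).
Qed.

Variable mu : {measure set T -> \bar R}.

Lemma ae_fatou (v : nat -> T -> R) (w : T -> R) (B : \bar R) :
  (forall n, measurable_fun setT (v n)) -> measurable_fun setT w ->
  (forall n x, 0 <= v n x) ->
  {ae mu, forall x, v n x @[n --> \oo] --> w x} ->
  (forall n, (\int[mu]_x (v n x)%:E <= B)%E) -> (\int[mu]_x (w x)%:E <= B)%E.
Proof.
move=> mv mw v0 vw vB.
have mv' n : measurable_fun setT (fun x => (v n x)%:E) by exact/measurable_EFinP.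
rewrite (ae_eq_integral (fun x => limn_einf (fun n => (v n x)%:E))) //; last 3 first.
- exact/measurable_EFinP.
- rewrite (_ : (fun x => _) = fun x => oppe (limn_esup (fun n => oppe (v n x)%:E))); last first.
    by apply/funext => x; rewrite [X in oppe X](limn_esupN (fun n => (v n x)%:E)) oppeK.
  apply: measurableT_comp => //; apply: measurable_fun_limn_esup => n.
  exact: measurableT_comp.
- apply: filterS vw => x vwx _.
  have : (v n x)%:E @[n --> \oo] --> (w x)%:E by apply: cvg_EFin => //; exact: nearW.
  by move=> /cvg_limn_einf_sup[-> _].
apply: le_trans (fatou mu measurableT mv' _) _.
  by move=> n x _; rewrite lee_fin.
rewrite limn_einf_lim; apply: lime_le; first exact: is_cvg_einfs.
apply: nearW => n; apply: le_trans (vB n).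
by apply: ereal_inf_lbound; exists n => /=.
Qed.

Lemma dominated_Rintegral (v : nat -> T -> R) (w : T -> R) (h : T -> \bar R) :
  (forall n, measurable_fun setT (v n)) -> measurable_fun setT w ->
  {ae mu, forall x, v n x @[n --> \oo] --> w x} ->
  mu.-integrable setT h ->
  {ae mu, forall x n, (`|v n x|%:E <= h x)%E} ->
  mu.-integrable setT (EFin \o w) /\
  \int[mu]_x v n x @[n --> \oo] --> \int[mu]_x w x.
Proof.
move=> mv mw vw ih vh.
have mv' n : measurable_fun setT (fun x => (v n x)%:E) by exact/measurable_EFinP.
have mw' : measurable_fun setT (fun x => (w x)%:E) by exact/measurable_EFinP.
have vw' : {ae mu, forall x, setT x -> (v n x)%:E @[n --> \oo] --> (w x)%:E}.
  by apply: filterS vw => x vwx _; apply: cvg_EFin => //; exact: nearW.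
have vh' : {ae mu, forall x n, setT x -> (`|(v n x)%:E| <= h x)%E}.
  by apply: filterS vh => x vhx n _; exact: vhx.
have [iw _ cv] := dominated_convergence measurableT mv' mw' vw' ih vh'.
split => //; apply: fine_cvg; rewrite fineK//; exact: integrable_fin_num.
Qed.

Lemma dominated_cintegral (v : nat -> T -> R[i]) (w : T -> R[i]) (h : T -> \bar R) :
  (forall n, cmeasurable_fun setT (v n)) -> cmeasurable_fun setT w ->
  {ae mu, forall x, ccvg (v ^~ x) (w x)} ->
  mu.-integrable setT h ->
  {ae mu, forall x n, ((modulus (v n x))%:E <= h x)%E} ->
  cintegrable mu setT w /\ ccvg (fun n => cintegral mu setT (v n)) (cintegral mu setT w).
Proof.
move=> mv [w1 w2] vw ih vh.
have c1 : mu.-integrable setT (EFin \o (fun x => complex.Re (w x))) /\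
    \int[mu]_x complex.Re (v n x) @[n --> \oo] --> \int[mu]_x complex.Re (w x).
  apply: (dominated_Rintegral (h := h)) => //.
  - by move=> n; case: (mv n).
  - by apply: filterS vw => x [].
  - apply: filterS vh => x vhx n; apply: le_trans (vhx n).
    by rewrite lee_fin; exact: normr_Re_le.
have c2 : mu.-integrable setT (EFin \o (fun x => complex.Im (w x))) /\
    \int[mu]_x complex.Im (v n x) @[n --> \oo] --> \int[mu]_x complex.Im (w x).
  apply: (dominated_Rintegral (h := h)) => //.
  - by move=> n; case: (mv n).
  - by apply: filterS vw => x [].
  - apply: filterS vh => x vhx n; apply: le_trans (vhx n).
    by rewrite lee_fin; exact: normr_Im_le.
by split; split; [exact: c1.1|exact: c2.1|exact: c1.2|exact: c2.2].
Qed.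

End LimitTheorems.

Lemma integral_finite_product d1 d2 (T1 : measurableType d1) (T2 : measurableType d2)
  (R : realType) (m1 : {finite_measure set T1 -> \bar R})
  (m2 : {finite_measure set T2 -> \bar R}) (g : T1 * T2 -> \bar R) :
  measurable_fun setT g -> (forall z, 0 <= g z)%E ->
  (\int[finite_product m1 m2]_z g z = \int[m1]_x \int[m2]_y g (x, y))%E.
Proof. by move=> mg g0; rewrite -fubini_tonelli1. Qed.

(** * A jointly measurable Riesz-Fischer theorem *)

Section Modes.

(** An enumeration of the integers, so that the partial sums of a Fourier
    series form a sequence. *)
Definition mode (n : nat) : int := if odd n then Negz n./2 else Posz n./2.

Lemma mode_inj : injective mode.
Proof.
move=> m n; have := odd_double_half m; have := odd_double_half n; rewrite /mode.
by case: (odd m); case: (odd n) => // e1 e2 [e3]; rewrite -e1 -e2 e3.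
Qed.

Lemma mode_surj k : exists n, mode n = k.
Proof.
case: k => m; first by exists m.*2; rewrite /mode odd_double doubleK.
by exists m.*2.+1; rewrite /mode /= odd_double /= uphalf_double.
Qed.

End Modes.

Lemma Re_sum (R : realType) (I : Type) (s : seq I) (F : I -> R[i]) :
  complex.Re (\sum_(i <- s) F i) = \sum_(i <- s) complex.Re (F i).
Proof. by elim/big_rec2: _ => // i x y _ <-; rewrite ReD. Qed.

Lemma Im_sum (R : realType) (I : Type) (s : seq I) (F : I -> R[i]) :
  complex.Im (\sum_(i <- s) F i) = \sum_(i <- s) complex.Im (F i).
Proof. by elim/big_rec2: _ => // i x y _ <-; rewrite ImD. Qed.

Section RieszFischer.
Variable R : realType.
Notation RR := (measurableTypeR R).
Notation mc := (circle_measure R).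

Lemma trigpoly_coef (I : finType) (e : I -> int) (inje : injective e) (a : I -> R[i]) i :
  \cint[mc]_x (cis (- ((e i)%:~R * x)) * trigpoly e a x) = (2 * pi)%:C * a i.
Proof.
have E (x : RR) : cis (- ((e i)%:~R * x)) * trigpoly e a x =
    \sum_j a j * cis ((e j - e i)%:~R * x).
  rewrite mulr_sumr; apply: eq_bigr => j _.
  by rewrite mulrCA -cisD; congr (_ * cis _); rewrite intrD mulrDl addrC rmorphN mulNr.
have ic (k : int) : cintegrable mc setT (fun x => cis (k%:~R * x : R)).
  by apply: (cbounded_integrable mc); apply: cbounded_cis; exact: mulrl_measurable.
transitivity (\cint[mc]_x (\sum_j a j * cis ((e j - e i)%:~R * x))).
  exact: eq_cintegral.
rewrite cintegral_sum; last first.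
  move=> j; apply: (cbounded_integrable mc); apply: cboundedM; first exact: cbounded_cst.
  by apply: cbounded_cis; exact: mulrl_measurable.
rewrite (bigD1 i)//= big1 ?addr0 => [|j ji].
  by rewrite cintegralZl// cintegral_character subrr eqxx mulrC.
by rewrite cintegralZl// cintegral_character subr_eq0 (inj_eq inje) (negbTE ji) mulr0.
Qed.

Context d (S : measurableType d).
Variable mu : {finite_measure set S -> \bar R}.
Variable C : int -> S -> R[i].
Hypothesis mC : forall k, cmeasurable_fun setT (C k).
Variable B : R.
Notation nu := (finite_product mu mc).
Hypothesis L4_bound : forall (I : finType) (e : I -> int), injective e ->
  (\int[nu]_z (modulus (trigpoly e (fun i => C (e i) z.1) z.2) ^+ 4)%:E <= B%:E)%E.

Let block (p q : nat) (z : S * RR) : R[i] :=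
  \sum_(p <= n < q) C (mode n) z.1 * cis ((mode n)%:~R * z.2).

Let shifted p i := mode (p + i).

Let shifted_inj p q : injective (fun i : 'I_q => shifted p i).
Proof. by move=> i j /mode_inj/addnI/val_inj. Qed.

Let blockE p q z : block p q z =
  trigpoly (fun i : 'I_(q - p) => shifted p i) (fun i => C (shifted p i) z.1) z.2.
Proof.
rewrite /block -{1}[p]add0n big_addn big_mkord.
by apply: eq_bigr => i _; rewrite /shifted addnC.
Qed.

Let cmeasurable_block p q : cmeasurable_fun setT (block p q).
Proof.
apply: cmeasurable_sum => n; apply: cmeasurableM.
  exact: (cmeasurable_comp measurable_fst (mC _)).
by apply: cmeasurable_cis; apply: measurable_funM => //; exact: measurable_snd.
Qed.

Let energy_mode n : \bar R := (\int[mu]_s (modulus (C (mode n) s) ^+ 2)%:E)%E.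

Let mmodX n k : measurable_fun setT (fun s => (modulus (C (mode n) s) ^+ k)%:E).
Proof. by apply/measurable_EFinP; apply: measurable_funX; exact: measurable_modulus. Qed.

Let mblockX p q k : measurable_fun setT (fun z => (modulus (block p q z) ^+ k)%:E).
Proof. by apply/measurable_EFinP; apply: measurable_funX; exact: measurable_modulus. Qed.

Let modX_ge0 (z : R[i]) k : (0 <= (modulus z ^+ k)%:E)%E.
Proof. by rewrite lee_fin exprn_ge0// modulus_ge0. Qed.

Let block_energy p q :
  (\int[nu]_z (modulus (block p q z) ^+ 2)%:E =
   (2 * pi)%:E * \sum_(p <= n < q) energy_mode n)%E.
Proof.
rewrite integral_finite_product//.
have E s : (\int[mc]_x (modulus (block p q (s, x)) ^+ 2)%:E =
    (2 * pi)%:E * \sum_(p <= n < q) (modulus (C (mode n) s) ^+ 2)%:E)%E.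
  have b : cbounded_measurable (fun x : RR => block p q (s, x)).
    rewrite (_ : (fun x : RR => _) = (trigpoly (fun i : 'I_(q - p) => shifted p i)
      (fun i => C (shifted p i) s) : RR -> R[i])); first exact: cbounded_trigpoly.
    by apply/funext => x; rewrite blockE.
  have [M mM bM] := cbounded_modulusX 2 b.
  have i2 := @bounded_integrable _ _ _ mc _ M mM bM.
  rewrite -[LHS]fineK; last exact: integrable_fin_num i2.
  rewrite sumEFin -EFinM; congr EFin.
  transitivity (\int[mc]_x (modulus (trigpoly (fun i : 'I_(q - p) => shifted p i)
     (fun i => C (shifted p i) s) x) ^+ 2)).
    by apply: eq_Rintegral => x _; rewrite blockE.
  rewrite (trigpoly_L2 (@shifted_inj p _)); congr (_ * _).
  rewrite -[X in _ = \sum_(X <= _ < _) _]add0n big_addn big_mkord.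
  by apply: eq_bigr => i _; rewrite /shifted addnC.
under eq_integral do rewrite E.
rewrite ge0_integralZl//.
- by congr (_ * _)%E; rewrite ge0_integral_sum.
- by apply: emeasurable_sum => n.
- by move=> s _; exact: sume_ge0.
- by rewrite lee_fin mulr_ge0// pi_ge0.
Qed.

Let total := fine (nu setT).

Let total_ge0 : 0 <= total. Proof. exact: fine_ge0. Qed.

Let nuT : nu setT = total%:E. Proof. by rewrite fineK//; exact: fin_num_measure. Qed.

Let block_L4 q : (\int[nu]_z (modulus (block 0 q z) ^+ 4)%:E <= B%:E)%E.
Proof.
apply: le_trans (L4_bound (@shifted_inj 0 (q - 0)%N)).
by rewrite le_eqVlt; apply/orP; left; apply/eqP; apply: eq_integral => z _; rewrite blockE.
Qed.

Let energy_mode_ge0 n : (0 <= energy_mode n)%E.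
Proof. exact: integral_ge0. Qed.

Let pi2_gt0 : (0 : R) < 2 * pi. Proof. by rewrite mulr_gt0// pi_gt0. Qed.

(** Parseval's identity in space, and [L^4] into [L^2] on a finite measure
    space. *)
Let energy_bound q : (\sum_(0 <= n < q) energy_mode n <= ((total + B) / (2 * pi))%:E)%E.
Proof.
have : (\int[nu]_z (modulus (block 0 q z) ^+ 2)%:E <= (total + B)%:E)%E.
  apply: (@le_trans _ _ (\int[nu]_z (1 + (modulus (block 0 q z) ^+ 4)%:E))%E).
    apply: ge0_le_integral => //.
    - by apply: emeasurable_funD.
    - move=> z _; rewrite -EFinD lee_fin; move: (modulus _) => r.
      have : 0 <= (r ^+ 2 - 1) ^+ 2 by exact: sqr_ge0.
      have : 0 <= r ^+ 4 by rewrite (exprM r 2 2); exact: sqr_ge0.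
      by rewrite (exprM r 2 2); move: (r ^+ 2) => s; nra.
  rewrite ge0_integralD// integral_cst// mul1e EFinD -nuT; exact: leeD.
rewrite block_energy => h; rewrite -(@lee_pmul2l _ (2 * pi)%:E)// ?lte_fin//.
rewrite -EFinM (_ : 2 * pi * ((total + B) / (2 * pi)) = total + B)//.
by rewrite mulrCA divff ?mulr1// gt_eqF.
Qed.

Let r n : R := fine (energy_mode n).

Let rE n : energy_mode n = (r n)%:E.
Proof.
rewrite fineK// ge0_fin_numE//; apply: le_lt_trans (ltry ((total + B) / (2 * pi))).
apply: le_trans (energy_bound n.+1); rewrite big_nat_recr//=.
by rewrite leeDr// sume_ge0.
Qed.

Let r_ge0 n : 0 <= r n. Proof. exact: fine_ge0. Qed.

Let tail (eps : R) : 0 < eps -> exists N, forall p q, (N <= p)%N ->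
  \sum_(p <= n < q) r n <= eps.
Proof.
move=> eps0; have cr : cvgn (series r).
  apply: nondecreasing_is_cvgn.
    by apply/nondecreasing_seqP => n; rewrite /series/= big_nat_recr//= lerDl.
  exists ((total + B) / (2 * pi)) => _ [q _ <-]; rewrite -lee_fin; apply: le_trans (energy_bound q).
  by rewrite /series/= -sumEFin; under [leRHS]eq_bigr do rewrite rE.
have /cauchy_cvgP/cauchy_seriesP/(_ eps eps0)[[A1 A2] [[N1 _ h1] [N2 _ h2]] h] := cr.
exists (maxn N1 N2) => p q Np; have [qp|pq] := leqP q p.
  by rewrite big_geq// ltW.
apply: le_trans (ler_norm _) (ltW _); apply: (h (p, q)); split => /=.
- by apply: h1 => /=; apply: leq_trans Np; rewrite leq_maxl.
- by apply: h2 => /=; apply: leq_trans (ltnW pq); apply: leq_trans Np; rewrite leq_maxr.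
Qed.

(** The tails decrease like [4^-1 ^+ j] to outweigh the factor [2 ^+ j] that the
    passage from [L^2] to [L^1] costs in [trig_series_limit]. *)
Let cutoffs : exists K : nat -> nat, [/\ forall j, (K j <= K j.+1)%N, forall j, (j <= K j)%N &
  forall j q, \sum_(K j <= n < q) r n <= 4^-1 ^+ j].
Proof.
have h j : exists N, forall p q, (N <= p)%N -> \sum_(p <= n < q) r n <= 4^-1 ^+ j.
  by apply: tail; rewrite exprn_gt0.
have {h}[N hN] := choice h.
exists (fun j => j + \sum_(0 <= i < j.+1) N i)%N; split=> [j|j|j q].
- by rewrite [in X in (_ <= X)%N]big_nat_recr//=; lia.
- exact: leq_addr.
- by apply: hN; rewrite big_nat_recr//=; lia.
Qed.

(** The increments of the partial sums along the cutoffs are summable in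
    [L^1], so that the series of their moduli is integrable: it dominates the
    partial sums and forces their convergence wherever it is finite. *)
Let trig_series_limit : exists (K : nat -> nat) (H : S * RR -> \bar R),
  [/\ forall j, (j <= K j)%N,
      measurable_fun setT H /\ (forall z, 0 <= H z)%E,
      (\int[nu]_z H z < +oo)%E,
      forall j z, ((modulus (block 0 (K j) z))%:E <= H z)%E &
      forall z, H z \is a fin_num -> exists l, ccvg (fun j => block 0 (K j) z) l].
Proof.
have [K [K1 K2 K3]] := cutoffs.
pose D j := block (K j) (K j.+1).
have VE j z : block 0 (K j) z = block 0 (K 0%N) z + \sum_(0 <= i < j) D i z.
  elim: j => [|j IH]; first by rewrite big_nil addr0.
  by rewrite big_nat_recr//= addrA -IH /block -big_cat_nat.
pose H z := ((modulus (block 0 (K 0%N) z))%:E + \sum_(0 <= j <oo) (modulus (D j z))%:E)%E.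
have m0 (z : R[i]) : (0 <= (modulus z)%:E)%E by rewrite lee_fin modulus_ge0.
have mB p q : measurable_fun setT (fun z => (modulus (block p q z))%:E).
  by apply/measurable_EFinP; exact: measurable_modulus.
have mS : measurable_fun setT (fun z => \sum_(0 <= j <oo) (modulus (D j z))%:E)%E.
  exact: (@ge0_emeasurable_sum _ _ R setT (fun j z => (modulus (D j z))%:E) predT
    (fun j z _ _ => m0 _) (fun j _ => mB _ _)).
have S0 z : (0 <= \sum_(0 <= j <oo) (modulus (D j z))%:E)%E by apply: nneseries_ge0 => j _ _; exact: m0.
(* the arithmetic-geometric mean inequality bounds the modulus by
   eps + modulus ^+ 2 / eps *)
have le_half p q (eps : R) : 0 < eps ->
    (\int[nu]_z (modulus (block p q z))%:E <=
    (eps * total)%:E + (eps^-1)%:E * \int[nu]_z (modulus (block p q z) ^+ 2)%:E)%E.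
  move=> eps0; apply: (@le_trans _ _ (\int[nu]_z (eps%:E + (eps^-1)%:E * (modulus (block p q z) ^+ 2)%:E))%E).
    apply: ge0_le_integral => //.
    - by apply: emeasurable_funD => //; exact: measurable_funeM.
    - move=> z _; rewrite -EFinM -EFinD lee_fin; move: (modulus _) => y.
      have e1 : eps * eps^-1 = 1 by rewrite divff// gt_eqF.
      rewrite -(@ler_pM2l _ eps)// mulrDr mulrA e1 mul1r.
      have := sqr_ge0 (y - eps); have := sqr_ge0 (y + eps); nra.
  rewrite ge0_integralD//.
  - rewrite integral_cst// EFinM -nuT ge0_integralZl//.
    by rewrite lee_fin invr_ge0 ltW.
  - by move=> z _; rewrite lee_fin ltW.
  - by move=> z _; rewrite mule_ge0// lee_fin invr_ge0 ltW.
  - exact: measurable_funeM.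
have D1 j : (\int[nu]_z (modulus (D j z))%:E <= ((2 * (total + 2 * pi)) / (2 ^ j.+1)%:R)%:E)%E.
  apply: le_trans (le_half _ _ (2^-1 ^+ j) _) _; first by rewrite exprn_gt0.
  rewrite block_energy; under eq_bigr do rewrite rE.
  rewrite sumEFin -!EFinM -EFinD lee_fin.
  have h := K3 j (K j.+1); set s := \sum_(_ <= n < _) r n in h *.
  have -> : (2 * (total + 2 * pi)) / (2 ^ j.+1)%:R = 2^-1 ^+ j * (total + 2 * pi).
    by rewrite natrX exprS exprVn; field; exact: expf_neq0.
  rewrite [leRHS]mulrDr lerD2l [leLHS]mulrCA [leRHS]mulrC ler_pM2l//.
  apply: (@le_trans _ _ ((2^-1 ^+ j)^-1 * 4^-1 ^+ j)).
    by rewrite ler_pM2l// invr_gt0 exprn_gt0.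
  have -> : (4^-1 : R) = 2^-1 * 2^-1 by field.
  by rewrite exprMn mulKf// expf_neq0.
exists K, H; split => //.
- split; first exact: emeasurable_funD.
  by move=> z; exact: adde_ge0.
- rewrite ge0_integralD//.
  apply: lte_add_pinfty.
    apply: le_lt_trans (le_half _ _ 1 ltr01) _.
    rewrite block_energy; under eq_bigr do rewrite rE.
    by rewrite sumEFin -!EFinM -EFinD ltry.
  rewrite integral_nneseries//; last by move=> n; exact: mB.
  apply: (@le_lt_trans _ _ (2 * (total + 2 * pi))%:E); last exact: ltry.
  apply: le_trans (lee_nneseries _ (fun j _ => D1 j)) _.
    by move=> j _ _; exact: integral_ge0.
  by apply: epsilon_trick0; rewrite mulr_ge0 ?addr_ge0// ltW.
- move=> j z; rewrite VE; apply: le_trans (_ : _ <= (modulus (block 0 (K 0%N) z) +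
     \sum_(0 <= i < j) modulus (D i z))%:E)%E _.
    by rewrite lee_fin; apply: le_trans (modulusD _ _) _; rewrite lerD2l modulus_sum.
  rewrite EFinD leeD2l// -sumEFin; exact: nneseries_lim_ge.
- move=> z Hfin.
  have Sfin : (\sum_(0 <= j <oo) (modulus (D j z))%:E)%E \is a fin_num.
    by move: Hfin; rewrite /H fin_numD => /andP[].
  have cD : cvgn (series (fun j => modulus (D j z))).
    apply: nondecreasing_is_cvgn.
      by apply/nondecreasing_seqP => n; rewrite /series/= big_nat_recr//= lerDl modulus_ge0.
    exists (fine (\sum_(0 <= j <oo) (modulus (D j z))%:E)%E) => _ [q _ <-].
    rewrite -lee_fin fineK// /series/= -sumEFin; exact: nneseries_lim_ge.
  have cab (g : nat -> R) : (forall j, `|g j| <= modulus (D j z)) -> cvgn (series g).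
    move=> gD; apply: normed_cvg; apply: series_le_cvg cD => //= j.
    exact: modulus_ge0.
  have c1 := cab _ (fun j => normr_Re_le (D j z)).
  have c2 := cab _ (fun j => normr_Im_le (D j z)).
  exists (block 0 (K 0%N) z + (limn (series (fun j => complex.Re (D j z))) +i*
    limn (series (fun j => complex.Im (D j z))))).
  under eq_fun do rewrite VE; apply: ccvgD; first exact: ccvg_cst.
  split => /=.
  + by rewrite (_ : (fun n => _) = series (fun j => complex.Re (D j z)))//; apply/funext => n; exact: Re_sum.
  + by rewrite (_ : (fun n => _) = series (fun j => complex.Im (D j z)))//; apply/funext => n; exact: Im_sum.
Qed.

(** The subsequence of partial sums converges in [L^1] on almost every fibre,
    hence keeps its Fourier coefficients in the limit, while Fatou's lemma
    transfers the bound of the [L^4] norm. *)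
Lemma riesz_fischer : exists u : S * RR -> R[i],
  [/\ cmeasurable_fun setT u,
      (\int[nu]_z (modulus (u z) ^+ 4)%:E <= B%:E)%E &
      {ae mu, forall s, cintegrable mc setT (fun x => u (s, x)) /\
        forall k, \cint[mc]_x (cis (- (k%:~R * x)) * u (s, x)) = (2 * pi)%:C * C k s}].
Proof.
have [K [H [Kj [mH H0] iH VH Vcv]]] := trig_series_limit.
pose V j := block 0 (K j); pose u := cmeasurable_limit V.
have mV j : cmeasurable_fun setT (V j) by exact: cmeasurable_block.
have mu' : cmeasurable_fun setT u by exact: cmeasurable_limit_measurable.
have Vu z : H z \is a fin_num -> ccvg (V ^~ z) (u z).
  by move=> /Vcv[l Vl]; rewrite /u (cmeasurable_limitE Vl).
have integrable_ge0 d' (X : measurableType d') (m : {measure set X -> \bar R}) (h : X -> \bar R) :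
    measurable_fun setT h -> (forall x, 0 <= h x)%E -> (\int[m]_x h x < +oo)%E ->
    m.-integrable setT h.
  by move=> mh h0 hoo; apply/integrableP; split => //; under eq_integral do rewrite gee0_abs//.
exists u; split => //.
- apply: (ae_fatou (v := fun j z => modulus (V j z) ^+ 4)) => //.
  + by move=> j; apply: measurable_funX; exact: measurable_modulus.
  + by apply: measurable_funX; exact: measurable_modulus.
  + by move=> j z; rewrite exprn_ge0// modulus_ge0.
  + have /integrable_ae/= := integrable_ge0 _ _ nu _ mH H0 iH.
    move=> /(_ measurableT); apply: filterS => z /(_ I)/Vu/ccvg_modulus cv.
    have E (y : R) : y ^+ 4 = y * y * (y * y) by rewrite !exprS expr0; ring.
    rewrite E; under eq_cvg do rewrite E.
    by apply: cvgM; apply: cvgM.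
  + by move=> j; exact: block_L4.
pose G s := (\int[mc]_x H (s, x))%E.
have mG : measurable_fun setT G by exact: (measurable_integral_section mc mH).
have G0 s : (0 <= G s)%E by exact: integral_ge0.
have iG : (\int[mu]_s G s < +oo)%E by rewrite -integral_finite_product.
have /integrable_ae/= := integrable_ge0 _ _ mu _ mG G0 iG.
move=> /(_ measurableT); apply: filterS => s /(_ I); rewrite ge0_fin_numE// => Gs.
have mHs : measurable_fun setT (fun x => H (s, x)).
  exact: (measurableT_comp mH (pair1_measurable s)).
have iHs := integrable_ge0 _ _ mc _ mHs (fun x => H0 (s, x)) Gs.
have aeV : {ae mc, forall x, ccvg (fun j => V j (s, x)) (u (s, x))}.
  have /integrable_ae/= := iHs.
  by move=> /(_ measurableT); apply: filterS => x /(_ I)/Vu.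
have mVs j : cmeasurable_fun setT (fun x => V j (s, x)).
  exact: (cmeasurable_comp (pair1_measurable s) (mV j)).
have mus : cmeasurable_fun setT (fun x => u (s, x)).
  exact: (cmeasurable_comp (pair1_measurable s) mu').
have aeH : {ae mc, forall x j, ((modulus (V j (s, x)))%:E <= H (s, x))%E}.
  by apply: aeW => x j; exact: VH.
split; first exact: (dominated_cintegral mVs mus aeV iHs aeH).1.
move=> k; have [m mk] := mode_surj k.
pose ph (x : RR) := cis (- (k%:~R * x)).
have mph : cmeasurable_fun setT ph.
  by apply: cmeasurable_cis; apply: measurable_funN; exact: mulrl_measurable.
have aeV' : {ae mc, forall x, ccvg (fun j => ph x * V j (s, x)) (ph x * u (s, x))}.
  by apply: filterS aeV => x; apply: ccvgM; exact: ccvg_cst.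
have aeH' : {ae mc, forall x j, ((modulus (ph x * V j (s, x)))%:E <= H (s, x))%E}.
  by apply: aeW => x j; rewrite modulusM modulus_cis mul1r; exact: VH.
have [_ cv] := dominated_cintegral (fun j => cmeasurableM mph (mVs j))
  (cmeasurableM mph mus) aeV' iHs aeH'.
apply: ccvg_unique cv _; apply: ccvg_near.
exists m.+1 => // j /= mj.
have mK : (m < K j - 0)%N by rewrite subn0; exact: leq_trans mj (Kj j).
have := trigpoly_coef (@shifted_inj 0 (K j - 0)%N) (fun i => C (shifted 0 i) s) (Ordinal mK).
rewrite /= /shifted add0n mk => <-.
by apply: eq_cintegral => x; rewrite /V blockE.
Qed.

End RieszFischer.

(** * The coefficients of the stochastic Duhamel integral *)

Section Untruncation.
Variable R : realType.
Notation RR := (measurableTypeR R).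
Variable lam : {finite_measure set RR -> \bar R}.
Notation mc := (circle_measure R).
Notation nu := (finite_product lam mc).
Notation c0 := ((2 * pi)^-1 : R).
Implicit Types (g : RR * RR -> R[i]) (W : RR -> R).

(** The coefficient of the Duhamel integral, for a source that is merely
    integrable; on bounded sources it agrees with [duhamel]. *)
Definition propagated g W (k : int) (t : RR) : R[i] :=
  \cint[lam]_s ((step s t)%:C * (cis (k%:~R ^+ 2 * (W t - W s)) * coef g k s)).

Let cmeasurable_step t : cmeasurable_fun setT (fun s : RR => (step s t)%:C).
Proof.
apply: cmeasurable_real.
exact: (measurableT_comp (@measurable_step R) (pair2_measurable (t : RR))).
Qed.

Let cmeasurable_phase W k t : measurable_fun setT W ->
  cmeasurable_fun setT (fun s : RR => cis (k%:~R ^+ 2 * (W t - W s))).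
Proof.
move=> mW; apply: cmeasurable_cis; apply: measurable_funM => //.
exact: measurable_funB.
Qed.

Let modulus_step (s t : R) : modulus ((step s t)%:C) <= 1.
Proof. by rewrite modulus_real /step; case: ifP; rewrite ?normr1 ?normr0. Qed.

Lemma duhamelE g W k t : cbounded_measurable g -> measurable_fun setT W ->
  duhamel lam g W k t = propagated g W k t.
Proof.
move=> bg mW; rewrite /duhamel /primitive /propagated -cintegralZl.
  apply: eq_cintegral => s; rewrite mulrCA /twisted_coef; congr (_ * _).
  by rewrite mulrA -cisD; congr (cis _ * _); ring.
apply: (cbounded_integrable lam).
apply: cboundedM; last exact: cbounded_twisted_coef.
by split => //; exists 1 => s; exact: modulus_step.
Qed.

Let cmeasurable_coef g k : cmeasurable_fun setT g -> cmeasurable_fun setT (coef g k).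
Proof.
move=> mg; apply: cmeasurableM; first exact: cmeasurable_cst.
apply: (cmeasurable_cintegral_section mc (g := fun z : RR * RR => cis (- (k%:~R * z.2)) * g z)).
apply: cmeasurableM => //; apply: cmeasurable_cis.
by apply: measurable_funN; apply: measurable_funM => //; exact: measurable_snd.
Qed.

(** Dominated convergence, first in space on almost every time slice, then in
    time, where the space integral of the modulus of the source dominates. *)
Lemma propagated_cvg (v : nat -> RR * RR -> R[i]) g W k t :
  (forall M, cbounded_measurable (v M)) -> cmeasurable_fun setT g ->
  (forall M z, modulus (v M z) <= modulus (g z)) ->
  (forall z, \forall M \near \oo, v M z = g z) ->
  measurable_fun setT W -> (\int[nu]_z (modulus (g z))%:E < +oo)%E ->
  ccvg (fun M => duhamel lam (v M) W k t) (propagated g W k t).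
Proof.
move=> bv mg vg veq mW ig.
have c00 : 0 <= c0 by rewrite invr_ge0 mulr_ge0// pi_ge0.
have m0 (z : R[i]) : (0 <= (modulus z)%:E)%E by rewrite lee_fin modulus_ge0.
have mmg : measurable_fun setT (fun z => (modulus (g z))%:E).
  by apply/measurable_EFinP; exact: measurable_modulus.
pose G s := (\int[mc]_x (modulus (g (s, x)))%:E)%E.
have mG : measurable_fun setT G by exact: (measurable_integral_section mc mmg).
have G0 s : (0 <= G s)%E by exact: integral_ge0.
have iG : lam.-integrable setT G.
  apply/integrableP; split => //; under eq_integral do rewrite gee0_abs//.
  apply: le_lt_trans ig; rewrite le_eqVlt; apply/orP; left; apply/eqP.
  by rewrite integral_finite_product.
have coef_le M s : ((modulus (coef (v M) k s))%:E <= c0%:E * G s)%E.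
  rewrite modulusM modulus_real ger0_norm// EFinM; apply: lee_wpmul2l; first by rewrite lee_fin.
  have b : cbounded_measurable (fun x : RR => cis (- (k%:~R * x)) * v M (s, x)).
    apply: cboundedM; last exact: (cbounded_section1 (bv M) s).
    by apply: cbounded_cis; apply: measurable_funN; exact: mulrl_measurable.
  have := modulus_cintegral mc b; rewrite -lee_fin => /le_trans; apply.
  rewrite fineK; last exact: integrable_fin_num (modulus_integrable mc b).
  apply: ge0_le_integral => //.
  - by apply/measurable_EFinP; apply: measurable_modulus; exact: b.1.
  - exact: (measurableT_comp mmg (pair1_measurable s)).
  - by move=> x _; rewrite lee_fin modulusM modulus_cis mul1r.
under eq_fun do rewrite duhamelE//.
pose w s := (step s t)%:C * (cis (k%:~R ^+ 2 * (W t - W s)) * coef g k s).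
pose h s := (c0%:E * G s)%E.
apply: (@dominated_cintegral _ RR R lam (fun M s => (step s t)%:C *
  (cis (k%:~R ^+ 2 * (W t - W s)) * coef (v M) k s)) w h _ _ _ _ _).2.
- move=> M; apply: cmeasurableM => //; apply: cmeasurableM; first exact: cmeasurable_phase.
  by apply: cmeasurable_coef; exact: (bv M).1.
- apply: cmeasurableM => //; apply: cmeasurableM; first exact: cmeasurable_phase.
  exact: cmeasurable_coef.
- have /= := integrable_ae measurableT iG.
  apply: filterS => s /(_ I); rewrite ge0_fin_numE// => Gs.
  apply: ccvgM; first exact: ccvg_cst.
  apply: ccvgM; first exact: ccvg_cst.
  apply: ccvgM; first exact: ccvg_cst.
  have mph : cmeasurable_fun setT (fun x : RR => cis (- (k%:~R * x))).
    by apply: cmeasurable_cis; apply: measurable_funN; exact: mulrl_measurable.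
  have mgs : measurable_fun setT (fun x : RR => (modulus (g (s, x)))%:E).
    exact: (measurableT_comp mmg (pair1_measurable s)).
  apply: (@dominated_cintegral _ RR R mc (fun M x => cis (- (k%:~R * x)) * v M (s, x))
    (fun x => cis (- (k%:~R * x)) * g (s, x)) (fun x => (modulus (g (s, x)))%:E) _ _ _ _ _).2.
  + move=> M; apply: cmeasurableM => //.
    exact: (cmeasurable_comp (pair1_measurable s) (bv M).1).
  + by apply: cmeasurableM => //; exact: (cmeasurable_comp (pair1_measurable s) mg).
  + apply: aeW => x; apply: ccvgM; first exact: ccvg_cst.
    exact: ccvg_near (veq (s, x)).
  + by apply/integrableP; split => //; under eq_integral do rewrite gee0_abs//.
  + by apply: aeW => x M; rewrite lee_fin modulusM modulus_cis mul1r.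
- exact: integrableZl.
- apply: aeW => s M; apply: le_trans (coef_le M s); rewrite lee_fin !modulusM modulus_cis mul1r.
  by rewrite ler_piMl ?modulus_step// mulr_ge0 ?modulus_ge0.
Qed.

End Untruncation.

Section Coefficients.
Variables (R : realType) (alpha Z : R).
Notation RR := (measurableTypeR R).
Hypothesis al : 2^-1 < alpha <= 1.
Hypothesis gapZ : forall (J : finType) (g : J -> int), injective g ->
  \sum_i gap_weight (2 * alpha) (g i) <= Z.
Context d (Omega : measurableType d).
Variables (P : probability Omega R) (F : R -> set (set Omega)) (W : R -> Omega -> R).
Hypothesis bW : is_brownian_motion P F W.
Variables (T : R) (T0 : 0 < T).
Notation lam := (time_measure T0).
Notation mc := (circle_measure R).
Notation nu := (finite_product lam mc).
Variable f : Omega -> R -> R -> R[i].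
Hypothesis pf : predictable F T f.
Notation W' := (regular_path W).
Notation src := (source T f).

Let rW : regular_brownian P F W'. Proof. exact: regular_brownian_regular. Qed.

Definition source_mass (w : Omega) : \bar R :=
  (\int[nu]_z (modulus (path_source src w z) `^ (4 / 3))%:E)%E.

Definition coefficient (k : int) (z : Omega * RR) : R[i] :=
  propagated lam (path_source src z.1) (fun t => W' t z.1) k z.2.

Let cmeasurable_src : cmeasurable_fun setT src.
Proof. exact: (cmeasurable_source bW.(bm_filtration) T0 pf). Qed.

Let cmeasurable_kernel k : cmeasurable_fun setT (fun z : (Omega * RR) * RR =>
  (step z.2 z.1.2)%:C * (cis (k%:~R ^+ 2 * (W' z.1.2 z.1.1 - W' z.2 z.1.1)) *
    coef (path_source src z.1.1) k z.2)).
Proof.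
have mW := rb_measurable rW.
have mcoef : cmeasurable_fun setT (fun z : Omega * RR => coef (path_source src z.1) k z.2).
  apply: cmeasurableM; first exact: cmeasurable_cst.
  apply: (cmeasurable_cintegral_section mc (g := fun z : (Omega * RR) * RR =>
    cis (- (k%:~R * z.2)) * src ((z.1.1, z.1.2), z.2))).
  apply: cmeasurableM; last by under eq_fun do rewrite -!surjective_pairing.
  by apply: cmeasurable_cis; apply: measurable_funN; apply: measurable_funM => //; exact: measurable_snd.
have ms : measurable_fun setT (fun z : (Omega * RR) * RR => (z.1.1, z.2)).
  apply: measurable_fun_pair; last exact: measurable_snd.
  exact: measurableT_comp measurable_fst measurable_fst.
apply: cmeasurableM.
  apply: cmeasurable_real; apply: (measurableT_comp (@measurable_step R)
    (g := fun z : (Omega * RR) * RR => (z.2, z.1.2))).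
  apply: measurable_fun_pair; first exact: measurable_snd.
  exact: measurableT_comp measurable_snd measurable_fst.
apply: cmeasurableM; last exact: (cmeasurable_comp ms mcoef).
apply: cmeasurable_cis; apply: measurable_funM => //; apply: measurable_funB.
  exact: (measurableT_comp mW measurable_fst).
exact: (measurableT_comp mW ms).
Qed.

Lemma cmeasurable_coefficient k : cmeasurable_fun setT (coefficient k).
Proof. exact: (cmeasurable_cintegral_section lam (cmeasurable_kernel k)). Qed.

(** The kernel [step] turns the integral over [[0, t]] into one over
    [[0, T]]. *)
Lemma coefficientE w t k : (forall s, 0 <= s -> W' s w = W s w) -> t \in `[0, T] ->
  stochastic_duhamel W f w t k = coefficient k (w, t).
Proof.
move=> WW; rewrite in_itv /= => /andP[t0 tT].
have sE s : 0 <= s <= T -> fourier_coef (f w s) k = coef (path_source src w) k s.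
  move=> /andP[s0 sT]; rewrite /fourier_coef /coef; congr (_ * _).
  rewrite cintegral_mfrestr; last first.
    apply: cmeasurableM.
      by apply: cmeasurable_cis; apply: measurable_funN; exact: mulrl_measurable.
    apply: (cmeasurable_comp (phi := fun x : RR => ((w, s), x)) _ cmeasurable_src).
    by apply: measurable_fun_pair => //; exact: measurable_cst.
  have E x : x \in @circle R -> f w s x = path_source src w (s, x).
    move=> /set_mem xc; rewrite /path_source /source /= ifT//; apply/mem_set.
    by split => //=; split => //=; rewrite in_itv /= s0.
  by rewrite /cintegral; congr (_ +i* _); apply: eq_Rintegral => x xc; rewrite E.
rewrite /stochastic_duhamel /coefficient /propagated.
rewrite cintegral_mfrestr; last first.
  exact: (cmeasurable_comp (pair1_measurable (w, t)) (cmeasurable_kernel k)).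
have E s : s \in `[0, t] ->
    schrodinger (increment W s t w) (fourier_coef (f w s)) k =
    (step s t)%:C * (cis (k%:~R ^+ 2 * (W' t w - W' s w)) * coef (path_source src w) k s).
  rewrite in_itv /= => /andP[s0 st].
  rewrite /schrodinger /fourier_multiplier /increment !WW// sE ?s0 ?(le_trans st)//.
  by rewrite /step s0 st mul1r.
have E0 s : s \notin `[0, t] ->
    (step s t)%:C * (cis (k%:~R ^+ 2 * (W' t w - W' s w)) * coef (path_source src w) k s) = 0.
  by rewrite in_itv /= /step => /negbTE ->; rewrite mul0r.
have half (p : R[i] -> R) : p 0 = 0 ->
    Rintegral leb `[0, t] (fun s : RR => p (schrodinger (increment W s t w) (fourier_coef (f w s)) k)) =
    Rintegral leb (time_itv T) (fun s : RR => p ((step s t)%:C *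
      (cis (k%:~R ^+ 2 * (W' t w - W' s w)) * coef (path_source src w) k s))).
  move=> p0; rewrite /Rintegral integral_mkcond [in RHS]integral_mkcond; congr fine.
  apply: eq_integral => s _; rewrite !patchE.
  have [st|st] := boolP (s \in `[0, t]).
    rewrite ifT; last exact/mem_set; rewrite ifT ?E//; apply/mem_set.
    by move: st; rewrite /time_itv /= !in_itv /= => /andP[-> /le_trans->].
  rewrite ifF; last by apply/negbTE; apply: contra st => /set_mem.
  by case: ifP => // _; rewrite E0// p0.
by rewrite /cintegral !half.
Qed.

End Coefficients.

(** * The bound for the coefficients of an untruncated source *)

Lemma ae_fst d1 d2 (T1 : measurableType d1) (T2 : measurableType d2)
  (R : realType) (m1 : {measure set T1 -> \bar R})
  (m2 : {sigma_finite_measure set T2 -> \bar R}) (Q : T1 -> Prop) :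
  {ae m1, forall x, Q x} -> {ae (m1 \x m2)%E, forall z, Q z.1}.
Proof.
move=> [N [mN N0 QN]]; exists (N `*` setT); split.
- exact: measurableX.
- by rewrite product_measure1E//= N0 mul0e.
- by move=> [x y] /= Qx; split => //; exact: QN.
Qed.

Lemma le_one_powR (R : realType) (y r : R) : 0 <= y -> 1 <= r -> y <= 1 + y `^ r.
Proof.
move=> y0 r1; have [y1|/ltW y1] := leP y 1.
  by rewrite (le_trans y1)// lerDl powR_ge0.
by rewrite -[leLHS]powRr1// (le_trans (ler_powR y1 r1))// lerDr.
Qed.

Lemma resonant_constant_ge0 (R : realType) : 0 <= resonant_constant R.
Proof.
have pi0 := pi_ge0 R; rewrite /resonant_constant; apply: mulr_ge0.
  by apply: mulr_ge0; [exact: ler0n|exact: exprn_ge0].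
by apply: exprn_ge0; rewrite invr_ge0; exact: mulr_ge0.
Qed.

Lemma nonresonant_constant_ge0 (R : realType) (alpha Z : R) : 0 <= nonresonant_constant alpha Z.
Proof.
have pi0 := pi_ge0 R; rewrite /nonresonant_constant; apply: mulr_ge0; first exact: mulr_ge0.
apply: mulr_ge0.
  apply: mulr_ge0 => //; apply: mulr_ge0; [exact: expR_ge0|exact: powR_ge0].
apply: mulr_ge0; first by apply: mulr_ge0 => //; exact: sqr_ge0.
by apply: mulr_ge0; [apply: exprn_ge0; rewrite invr_ge0|]; exact: mulr_ge0.
Qed.

Section CoefficientBound.
Variables (R : realType) (alpha Z : R).
Notation RR := (measurableTypeR R).
Hypothesis al : 2^-1 < alpha <= 1.
Hypothesis gapZ : forall (J : finType) (g : J -> int), injective g ->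
  \sum_i gap_weight (2 * alpha) (g i) <= Z.
Context d (Omega : measurableType d).
Variables (P : probability Omega R) (F : R -> set (set Omega)) (W : R -> Omega -> R).
Hypothesis bW : is_brownian_motion P F W.
Variables (T : R) (T0 : 0 < T).
Notation lam := (time_measure T0).
Notation mc := (circle_measure R).
Notation nu := (finite_product lam mc).
Variable f : Omega -> R -> R -> R[i].
Hypothesis pf : predictable F T f.
Notation W' := (regular_path W).
Notation src := (source T f).

Let rW : regular_brownian P F W'. Proof. exact: regular_brownian_regular. Qed.

Notation src_mass := (source_mass T0 f).
Notation coefs := (coefficient W T0 f).
Notation trunc := (truncated T f).

Let cmeasurable_src : cmeasurable_fun setT src.
Proof. exact: (cmeasurable_source bW.(bm_filtration) T0 pf). Qed.

Let pt M : progressive_source F (trunc M).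
Proof. exact: (progressive_truncated bW.(bm_filtration) T0 pf). Qed.

Let measurable_power : measurable_fun setT
  (fun z : Omega * (RR * RR) => (modulus (path_source src z.1 z.2) `^ (4 / 3))%:E).
Proof.
apply/measurable_EFinP; apply: (measurableT_comp (@measurable_powR R (4 / 3))).
exact: (measurableT_comp (measurable_modulus cmeasurable_src)
  (@measurable_assoc _ _ _ Omega RR RR)).
Qed.

Lemma measurable_source_mass : measurable_fun setT src_mass.
Proof. exact: (measurable_integral_section nu measurable_power). Qed.

Lemma source_mass_ge0 w : (0 <= src_mass w)%E.
Proof. by apply: integral_ge0 => z _; rewrite lee_fin powR_ge0. Qed.

Let cmeasurable_path w : cmeasurable_fun setT (path_source src w).
Proof.
apply: (cmeasurable_comp (phi := fun z : RR * RR => ((w, z.1), z.2)) _ cmeasurable_src).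
apply: measurable_fun_pair; last exact: measurable_snd.
by apply: measurable_fun_pair => //; exact: measurable_fst.
Qed.

Lemma source_mass_integrable w : (src_mass w < +oo)%E ->
  (\int[nu]_z (modulus (path_source src w z))%:E < +oo)%E.
Proof.
move=> woo; have m1 := measurable_modulus (cmeasurable_path w).
have m2 : measurable_fun setT (fun z => (modulus (path_source src w z) `^ (4 / 3))%:E).
  exact: (measurableT_comp measurable_power (pair1_measurable w)).
apply: (@le_lt_trans _ _ (\int[nu]_z (1 + (modulus (path_source src w z) `^ (4 / 3))%:E))%E).
  apply: ge0_le_integral => //.
  - by move=> z _; rewrite lee_fin modulus_ge0.
  - exact/measurable_EFinP.
  - exact: emeasurable_funD.
  - move=> z _; rewrite -EFinD lee_fin; apply: le_one_powR; first exact: modulus_ge0.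
    by rewrite ler_pdivlMr// mul1r ler_nat.
rewrite ge0_integralD//; last by move=> z _; rewrite lee_fin powR_ge0.
rewrite lte_add_pinfty// integral_cst// mul1e.
by rewrite ltey_eq fin_num_measure.
Qed.

Definition source_energy : \bar R := (\int[P]_w (src_mass w `^ 3))%E.
Hypothesis energy_fin : (source_energy < +oo)%E.

Let measurable_cube : measurable_fun setT (fun w => (src_mass w `^ 3)%E).
Proof. exact: (measurableT_comp (@measurable_poweR R 3) measurable_source_mass). Qed.

Lemma source_mass_ae : {ae P, forall w, (src_mass w < +oo)%E}.
Proof.
have i : P.-integrable setT (fun w => (src_mass w `^ 3)%E).
  apply/integrableP; split => //.
  by under eq_integral do rewrite gee0_abs ?poweR_ge0//.
have /= := integrable_ae measurableT i; apply: filterS => w /(_ I).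
rewrite ltey; apply: contraL => /eqP ->.
by rewrite poweRE/= pnatr_eq0.
Qed.

Lemma mean_source43_le M :
  ((\int[P]_w source43 lam (path_source (trunc M) w))%:E <= source_energy)%E.
Proof.
have [K m4 M4] := source43_bounded T0 (pt M).
rewrite fineK; last exact: integrable_fin_num (@bounded_integrable _ _ _ _ _ K m4 M4).
apply: ge0_le_integral => //.
- by move=> w _; rewrite lee_fin source43_ge0.
- exact/measurable_EFinP.
move=> w _; have b := cbounded_path_source (pt M) w.
pose h z := modulus (path_source (trunc M) w z) `^ (4 / 3).
have h0 z : 0 <= h z by exact: powR_ge0.
have mh : measurable_fun setT h.
  by apply: (measurableT_comp (@measurable_powR R (4 / 3))); apply: measurable_modulus; exact: b.1.
have ih : nu.-integrable setT (EFin \o h).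
  have [_ [L bL]] := b; apply: (@bounded_integrable _ _ _ _ _ (L `^ (4 / 3))) => // z.
  rewrite ger0_norm//; apply: ge0_ler_powR; rewrite ?nnegrE ?modulus_ge0//.
  exact: le_trans (modulus_ge0 _) (bL z).
have -> : (source43 lam (path_source (trunc M) w))%:E = ((\int[nu]_z h z)%:E `^ 3)%E.
  by rewrite poweR_EFin /source43 powR_mulrn// Rintegral_ge0.
apply: gt0_ler_poweR => //.
- by rewrite in_itv/= leey andbT lee_fin Rintegral_ge0.
- by rewrite in_itv/= leey andbT source_mass_ge0.
rewrite fineK; last exact: integrable_fin_num ih.
apply: ge0_le_integral => //.
- by move=> z _; rewrite lee_fin.
- exact/measurable_EFinP.
- exact: (measurableT_comp measurable_power (pair1_measurable w)).
- move=> z _; rewrite lee_fin; apply: ge0_ler_powR; rewrite ?nnegrE ?modulus_ge0//.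
  exact: modulus_truncated_le.
Qed.

Definition strichartz_constant : R :=
  resonant_constant R * T ^+ 2 + nonresonant_constant alpha Z * T `^ (2 - alpha).

(** Fatou's lemma: on almost every path the coefficients for the truncated
    sources converge, and [mean_field4_le] bounds their fourth moments
    uniformly in the truncation. *)
Lemma coefficient_L4_le (I : finType) (e : I -> int) : injective e ->
  (\int[finite_product (finite_product P lam) mc]_z
     (modulus (trigpoly e (fun i => coefs (e i) z.1) z.2) ^+ 4)%:E <=
   (strichartz_constant * fine source_energy)%:E)%E.
Proof.
move=> inje; pose V M (z : (Omega * RR) * RR) :=
  field e lam (path_source (trunc M) z.1.1) (fun t => W' t z.1.1) z.1.2 z.2.
have bV M : cbounded_measurable (V M) by exact: (cbounded_field_process rW T0 (pt M) e).
apply: (ae_fatou (v := fun M z => modulus (V M z) ^+ 4)) => //.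
- by move=> M; apply: measurable_funX; apply: measurable_modulus; exact: (bV M).1.
- apply: measurable_funX; apply: measurable_modulus; apply: cmeasurable_sum => i.
  apply: cmeasurableM; first exact: (cmeasurable_comp measurable_fst (cmeasurable_coefficient bW T0 pf (e i))).
  by apply: cmeasurable_cis; apply: measurable_funM => //; exact: measurable_snd.
- by move=> M z; rewrite exprn_ge0// modulus_ge0.
- have := ae_fst mc (ae_fst lam source_mass_ae).
  apply: filterS => z /source_mass_integrable fz.
  have cv : ccvg (V ^~ z) (trigpoly e (fun i => coefs (e i) z.1) z.2).
    apply: ccvg_sum => i; apply: ccvgM; last exact: ccvg_cst.
    apply: propagated_cvg => //.
    + by move=> M; exact: cbounded_path_source (pt M) _.
    + by move=> M y; exact: modulus_truncated_le.
    + by move=> y; exact: truncated_eq.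
    + exact: (measurable_path rW).
  have E (y : R) : y ^+ 4 = y * y * (y * y) by rewrite !exprS expr0; ring.
  rewrite E; under eq_cvg do rewrite E.
  by apply: cvgM; apply: cvgM; exact: ccvg_modulus.
move=> M; have [K mK bK] := cbounded_modulusX 4 (bV M).
have := mean_field4_le al rW T0 (pt M) inje gapZ.
have -> : \int[P]_w field4 e lam (path_source (trunc M) w) (fun t => W' t w) =
    \int[finite_product (finite_product P lam) mc]_z (modulus (V M z) ^+ 4).
  rewrite (Rintegral_prod12 _ _ mK bK).
  have mK' := measurable_Rintegral_section mc mK.
  rewrite (Rintegral_prod12 (M := K * fine (mc setT)) _ _ mK'); last first.
    move=> x; apply: Rintegral_le_bound => //; exact: (measurableT_comp mK (pair1_measurable x)).
  apply: eq_Rintegral => w _; rewrite /field4.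
  have bf := cbounded_modulusX 4 (cbounded_field e lam (cbounded_path_source (pt M) w) (measurable_path rW w)).
  have [K' mK'' bK'] := bf.
  by rewrite (Rintegral_prod12 _ _ mK'' bK').
move=> h; have i4 := @bounded_integrable _ _ _ (finite_product (finite_product P lam) mc) _ K mK bK.
rewrite -[leLHS]fineK; last exact: integrable_fin_num i4.
rewrite lee_fin; apply: le_trans h _.
have ef : source_energy \is a fin_num.
  rewrite ge0_fin_numE//; apply: integral_ge0 => w _; exact: poweR_ge0.
have := mean_source43_le M; rewrite -[X in (_ <= X)%E]fineK// lee_fin => h.
apply: ler_wpM2l h; apply: addr_ge0; apply: mulr_ge0; rewrite ?powR_ge0 ?exprn_ge0 ?(ltW T0)//.
  exact: resonant_constant_ge0.
exact: nonresonant_constant_ge0.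
Qed.

End CoefficientBound.

(** * From the coefficients to the norms *)

Section Agreement.
Local Open Scope ereal_scope.

(** The norms integrate functions that vanish off a set [D] against sigma-finite
    measures, the estimates above use finite restrictions of these measures;
    this relation between the two passes to products. *)
Definition agree_on d (T : measurableType d) (R : realType)
    (m n : {measure set T -> \bar R}) (D : set T) : Prop :=
  forall g : T -> \bar R, measurable_fun setT g -> (forall x, 0 <= g x) ->
  (forall x, ~ D x -> g x = 0) -> \int[m]_x g x = \int[n]_x g x.

Lemma agree_on_restricted d (T : measurableType d) (R : realType)
    (m : {measure set T -> \bar R}) (D : set T) (mD : measurable D) (mDoo : m D < +oo) :
  agree_on m (restricted_measure mD mDoo) D.
Proof.
move=> g mg g0 gD; rewrite ge0_integral_mfrestr// [RHS]integral_mkcond.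
apply: eq_integral => x _; rewrite patchE; case: ifPn => // /negP xD.
by apply: gD => /mem_set.
Qed.

Lemma agree_on_product d1 d2 (T1 : measurableType d1) (T2 : measurableType d2) (R : realType)
    (m1 : {sigma_finite_measure set T1 -> \bar R}) (m2 : {sigma_finite_measure set T2 -> \bar R})
    (n1 : {finite_measure set T1 -> \bar R}) (n2 : {finite_measure set T2 -> \bar R})
    (D1 : set T1) (D2 : set T2) :
  agree_on m1 n1 D1 -> agree_on m2 n2 D2 ->
  agree_on (m1 \x m2) (finite_product n1 n2) (D1 `*` D2).
Proof.
move=> a1 a2 g mg g0 gD; rewrite integral_finite_product// fubini_tonelli1//.
rewrite /fubini_F.
have mgx x : measurable_fun setT (fun y => g (x, y)) by exact: (measurableT_comp mg (pair1_measurable x)).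
have Dx x : ~ D1 x -> \int[m2]_y g (x, y) = 0.
  by move=> xD; rewrite integral0_eq// => y _; apply: gD => -[].
rewrite a1//; last by move=> x; exact: integral_ge0.
  apply: eq_integral => x _.
  have [xD|xD] := pselect (D1 x); last first.
    rewrite Dx// integral0_eq// => y _; by apply: gD => -[].
  by apply: a2 => // y yD; apply: gD => -[].
exact: (measurable_integral_section m2 mg).
Qed.

End Agreement.

Lemma ae_agree d (T : measurableType d) (R : realType)
    (m n : {measure set T -> \bar R}) (D : set T) (Q : T -> Prop) :
  measurable D -> agree_on m n D -> {ae n, forall x, Q x} -> {ae m, forall x, D x -> Q x}.
Proof.
move=> mD a [N [mN N0 QN]]; exists (N `&` D); split.
- exact: measurableI.
- have mI : measurable (N `&` D) by exact: measurableI.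
  apply/eqP; rewrite -measure_le0 -N0.
  apply: (@le_trans _ _ (n (N `&` D))); last by apply: le_measure; rewrite ?inE.
  have E (k : {measure set T -> \bar R}) : k (N `&` D) = (\int[k]_x (\1_(N `&` D) x)%:E)%E.
    by rewrite integral_indic// setIT.
  rewrite [leLHS](E m) [leRHS](E n) (a (fun x => (\1_(N `&` D) x)%:E))//.
  + by apply/measurable_EFinP; exact: measurable_indic.
  + by move=> x xD; rewrite indicE memNset// => -[].
- move=> x /= /not_implyP[Dx nQ]; split => //; exact: QN.
Qed.

Section SigmaFiniteProduct.
Local Open Scope ereal_scope.
Context d1 d2 (T1 : measurableType d1) (T2 : measurableType d2) (R : realType).
Variable m1 : {finite_measure set T1 -> \bar R}.
Variable m2 : {sigma_finite_measure set T2 -> \bar R}.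

(** A copy of [m1 \x m2] that is canonically sigma-finite. *)
Definition sigma_product : set (T1 * T2) -> \bar R := m1 \x m2.

HB.instance Definition _ := Measure.on sigma_product.

Let sigma_product_sigma_finite : sigma_finite setT sigma_product.
Proof.
have [G TG Goo] := sigma_finiteT m2.
exists (fun n => setT `*` G n).
  rewrite -setXTT TG predeqE => -[x y]; split => [[_ [n Gn Gy]]|[n Gn [_ Gy]]].
    by exists n.
  by split => //; exists n.
move=> n; have [mG Gn] := Goo n; split; first exact: measurableX.
rewrite /sigma_product product_measure1E// lte_mul_pinfty//.
by rewrite fin_num_measure.
Qed.

HB.instance Definition _ := Measure_isSigmaFinite.Build _ _ _ sigma_product
  sigma_product_sigma_finite.

End SigmaFiniteProduct.

Section LnormIntegral.
Local Open Scope ereal_scope.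
Context d (T : measurableType d) (R : realType).
Variables (m : {measure set T -> \bar R}) (p : R) (h : T -> \bar R) (I : \bar R).

Lemma Lnorm_integral : \int[m]_x (`|h x| `^ p) = I -> Lnorm m p%:E h = I `^ p^-1.
Proof. by rewrite unlock => ->. Qed.

Lemma Lnorm_integral_le : (0 < p)%R ->
  \int[m]_x (`|h x| `^ p) <= I -> Lnorm m p%:E h <= I `^ p^-1.
Proof.
move=> p0; rewrite unlock => hI.
have h0 : 0 <= \int[m]_x (`|h x| `^ p) by apply: integral_ge0 => x _; exact: poweR_ge0.
apply: gt0_ler_poweR => //; rewrite ?invr_ge0 ?(ltW p0)// in_itv/= leey andbT//.
exact: le_trans hI.
Qed.

End LnormIntegral.

Lemma Lnorm4_agree d (T : measurableType d) (R : realType)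
    (m n : {measure set T -> \bar R}) (D : set T) (u : T -> R[i]) (B : \bar R) :
  measurable D -> agree_on m n D -> cmeasurable_fun setT u ->
  (\int[n]_z (modulus (u z) ^+ 4)%:E <= B)%E ->
  (Lnorm m 4%:E ((fun z => (modulus (u z))%:E) \_ D) <= B `^ 4^-1)%E.
Proof.
move=> mD a mu uB; apply: Lnorm_integral_le; first exact: ltr0n.
apply: le_trans uB; pose h := (fun z => (modulus (u z) ^+ 4)%:E) \_ D.
have m4 : measurable_fun setT (fun z => (modulus (u z) ^+ 4)%:E).
  by apply/measurable_EFinP; apply: measurable_funX; exact: measurable_modulus.
have h0 z : (0 <= h z)%E.
  by rewrite /h patchE; case: ifP => // _; rewrite lee_fin exprn_ge0// modulus_ge0.
have mh : measurable_fun setT h by exact: (measurable_restrictT _ mD).1 (measurable_funTS m4).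
apply: (@le_trans _ _ (\int[n]_z h z)%E).
  rewrite -a//; last by move=> z zD; rewrite /h patchE memNset.
  rewrite le_eqVlt; apply/orP; left; apply/eqP; apply: eq_integral => z _.
  rewrite /h !patchE; case: ifP => _.
    by rewrite gee0_abs ?lee_fin ?modulus_ge0// poweR_EFin powR_mulrn// modulus_ge0.
  by rewrite abse0 poweR_EFin powR0// pnatr_eq0.
apply: ge0_le_integral => // z _; rewrite /h patchE; case: ifP => // _.
by rewrite lee_fin exprn_ge0// modulus_ge0.
Qed.

Section Conclusion.
Variables (R : realType) (alpha Z : R).
Notation RR := (measurableTypeR R).
Hypothesis al : 2^-1 < alpha <= 1.
Hypothesis gapZ : forall (J : finType) (g : J -> int), injective g ->
  \sum_i gap_weight (2 * alpha) (g i) <= Z.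
Context d (Omega : measurableType d).
Variables (P : probability Omega R) (F : R -> set (set Omega)) (W : R -> Omega -> R).
Hypothesis bW : is_brownian_motion P F W.
Variables (T : R) (T0 : 0 < T).
Notation lam := (time_measure T0).
Notation mc := (circle_measure R).
Notation nu := (finite_product lam mc).
Variable f : Omega -> R -> R -> R[i].
Hypothesis pf : predictable F T f.
Notation W' := (regular_path W).
Notation src := (source T f).
Notation src_mass := (source_mass T0 f).
Notation coefs := (coefficient W T0 f).
Notation src_energy := (source_energy P T0 f).

Let lebRR : {sigma_finite_measure set RR -> \bar R} := lebesgue_measure.

Let agree_time : agree_on lebRR lam (time_itv T).
Proof. exact: agree_on_restricted. Qed.

Let agree_circle : agree_on lebRR mc (@circle R).
Proof. exact: agree_on_restricted. Qed.

Let agree_sample : agree_on P P setT.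
Proof. by []. Qed.

Let agree_sample_time :
  agree_on (P \x (leb : set RR -> \bar R))%E (finite_product P lam) (setT `*` time_itv T).
Proof. exact: (agree_on_product (m1 := P) (m2 := lebRR) (n1 := P) (n2 := lam) agree_sample agree_time). Qed.

Let agree_sample_spacetime :
  agree_on ((P \x (leb : set RR -> \bar R)) \x (leb : set RR -> \bar R))%E
    (finite_product (finite_product P lam) mc) ((setT `*` time_itv T) `*` @circle R).
Proof.
exact: (agree_on_product (m1 := sigma_product P lebRR) (m2 := lebRR)
  (n1 := finite_product P lam) (n2 := mc) agree_sample_time agree_circle).
Qed.

Let cmeasurable_path w : cmeasurable_fun setT (path_source src w).
Proof.
apply: (cmeasurable_comp (phi := fun z : RR * RR => ((w, z.1), z.2)) _
  (cmeasurable_source bW.(bm_filtration) T0 pf)).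
apply: measurable_fun_pair; last exact: measurable_snd.
by apply: measurable_fun_pair => //; exact: measurable_fst.
Qed.

Lemma path_norm w :
  Lnorm (leb \x leb)%E (4 / 3)%:E
    ((fun z => (modulus (f w z.1 z.2))%:E) \_ (spacetime T)) = (src_mass w `^ (3 / 4))%E.
Proof.
have -> : (3 / 4 : R) = (4 / 3)^-1 by rewrite invf_div.
apply: Lnorm_integral.
have a := agree_on_product agree_time agree_circle.
rewrite /source_mass -(a (fun z => (modulus (path_source src w z) `^ (4 / 3))%:E)).
- apply: eq_integral => z _; rewrite patchE /path_source /source.
  have E : (((w, z.1), z.2) \in @sample_spacetime _ Omega R T) = (z \in spacetime T).
    by apply/idP/idP => /set_mem h; apply/mem_set; [case: h => -[]|case: h].
  rewrite E; case: ifPn => _ /=.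
    by rewrite ger0_norm ?modulus_ge0.
  by rewrite normr0 modulus0.
- apply/measurable_EFinP; apply: (measurableT_comp (@measurable_powR R (4 / 3))).
  exact: measurable_modulus.
- by move=> z; rewrite lee_fin powR_ge0.
- move=> z zD; rewrite /path_source /source memNset ?modulus0 ?powR0//.
  by move=> -[[_ h1] h2]; exact: zD.
Qed.

Lemma norm_L4_L43E : norm_L4_L43 P T f = (src_energy `^ 4^-1)%E.
Proof.
rewrite /norm_L4_L43; under eq_fun do rewrite path_norm.
apply: Lnorm_integral; apply: eq_integral => w _.
rewrite gee0_abs ?poweR_ge0// -poweRrM; congr (_ `^ _)%E; by field.
Qed.

Lemma norm_L4_le (u : (Omega * RR) * RR -> R[i]) (B : R) : cmeasurable_fun setT u ->
  (\int[finite_product (finite_product P lam) mc]_z (modulus (u z) ^+ 4)%:E <= B%:E)%E ->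
  (norm_L4 P T (fun w t x => u ((w, t), x)) <= B%:E `^ 4^-1)%E.
Proof.
move=> mu uB.
have mD : measurable ((setT `*` time_itv T) `*` @circle R : set ((Omega * RR) * RR)).
  apply: measurableX; last exact: measurable_circle.
  by apply: measurableX; [exact: measurableT|exact: measurable_time].
have := Lnorm4_agree mD agree_sample_spacetime mu uB.
rewrite /norm_L4 (_ : (fun z : (Omega * RR) * RR => (modulus (u z))%:E) =
  fun z : (Omega * RR) * RR => (modulus (u ((z.1.1, z.1.2), z.2)))%:E) //.
by apply/funext => z; rewrite -!surjective_pairing.
Qed.

Hypothesis energy_fin : (src_energy < +oo)%E.

(** The coefficients have bounded [L^4] norms on all finite sets of modes, so
    [riesz_fischer] sums them to a function; the exceptional paths are those
    that differ from their regularisation. *)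
Lemma strichartz_version : exists u : Omega -> R -> R -> R[i],
  is_version P T (stochastic_duhamel W f) u /\
  (norm_L4 P T u <= (strichartz_constant alpha Z T * fine src_energy)%:E `^ 4^-1)%E.
Proof.
have [u [mu uB uC]] := riesz_fischer (mu := finite_product P lam) (cmeasurable_coefficient bW T0 pf)
  (coefficient_L4_le al gapZ bW pf energy_fin).
exists (fun w t x => u ((w, t), x)); split; last exact: norm_L4_le.
split.
  have [m1 m2] : cmeasurable_fun setT (fun z : (Omega * RR) * RR => u ((z.1.1, z.1.2), z.2)).
    by under eq_fun do rewrite -!surjective_pairing.
  by split; [exact: measurable_funTS m1|exact: measurable_funTS m2].
have mD : measurable (setT `*` time_itv T : set (Omega * RR)).
  by apply: measurableX; [exact: measurableT|exact: measurable_time].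
have ae1 := ae_agree mD agree_sample_time uC.
have ae2 := ae_fst lebRR (regular_pathE bW).
apply: filterS (filterI ae1 ae2) => -[w t] [/= h1 h2] tT.
have [iu uk] := h1 (conj I tT).
have mus : cmeasurable_fun setT (fun x : RR => u ((w, t), x)).
  exact: (cmeasurable_comp (pair1_measurable (w, t)) mu).
split.
  have [i1 i2] := iu; have [m1 m2] := mus; split.
  - by apply/(integrable_mfrestr _ _ _).1: i1; exact/measurable_EFinP.
  - by apply/(integrable_mfrestr _ _ _).1: i2; exact/measurable_EFinP.
move=> k; rewrite (coefficientE bW T0 pf) //.
have mph : cmeasurable_fun setT (fun x : RR => cis (- (k%:~R * x)) * u ((w, t), x)).
  apply: cmeasurableM => //; apply: cmeasurable_cis.
  by apply: measurable_funN; exact: mulrl_measurable.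
have := uk k; rewrite cintegral_mfrestr// /fourier_coef => ->.
rewrite mulrA -rmorphM/= mulVf ?mul1r//.
by rewrite gt_eqF// mulr_gt0// pi_gt0.
Qed.

End Conclusion.

Theorem theorem6 (R : realType) (alpha : R) (halpha : 2^-1 < alpha <= 1) :
  exists C : R,
  forall (d : measure_display) (Omega : measurableType d)
    (P : probability Omega R) (F : R -> set (set Omega))
    (W : R -> Omega -> R),
  is_brownian_motion P F W ->
  forall (T : R) (f : Omega -> R -> R -> R[i]),
  0 < T ->
  predictable F T f ->
  (norm_L4_L43 P T f < +oo)%E ->
  exists u : Omega -> R -> R -> R[i],
    is_version P T (stochastic_duhamel W f) u /\
    (norm_L4 P T u <=
      (C * (T ^+ 2 + T `^ (2 - alpha)) `^ 4^-1)%:E * norm_L4_L43 P T f)%E.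
Proof.
have [a1 a2] := andP halpha.
have [Z gapZ] : exists Z : R, forall (J : finType) (g : J -> int), injective g ->
    \sum_i gap_weight (2 * alpha) (g i) <= Z.
  by apply: gap_weight_sum; rewrite -ltr_pdivrMl// mulr1.
have r0 := resonant_constant_ge0 R; have n0 := nonresonant_constant_ge0 alpha Z.
set K := resonant_constant R + nonresonant_constant alpha Z.
have K0 : 0 <= K by exact: addr_ge0.
exists (K `^ 4^-1) => d Omega P F W bW T f T0 pf.
rewrite (norm_L4_L43E bW T0 pf) => foo.
have e0 : (0 <= source_energy P T0 f)%E by apply: integral_ge0 => w _; exact: poweR_ge0.
have energy_fin : (source_energy P T0 f < +oo)%E.
  move: foo; rewrite !ltey; apply: contra => /eqP ->.
  by rewrite poweRE/= invr_eq0 pnatr_eq0.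
have ef : source_energy P T0 f \is a fin_num by rewrite ge0_fin_numE.
have [u [vu nu]] := strichartz_version halpha gapZ bW pf energy_fin.
exists u; split => //; apply: le_trans nu _.
rewrite -[X in (_ <= _ * X `^ _)%E]fineK// !poweR_EFin -EFinM lee_fin.
set X := T ^+ 2 + T `^ (2 - alpha).
have X0 : 0 <= X by rewrite addr_ge0 ?powR_ge0// exprn_ge0// ltW.
have E0 := fine_ge0 e0.
rewrite -!powRM ?mulr_ge0//; apply: ge0_ler_powR; rewrite ?nnegrE ?invr_ge0 ?mulr_ge0//.
  apply: addr_ge0; apply: mulr_ge0 => //; first by rewrite exprn_ge0// ltW.
  exact: powR_ge0.
apply: ler_wpM2r => //.
rewrite /strichartz_constant /X /K mulrDr; apply: lerD; apply: ler_wpM2r.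
- by rewrite exprn_ge0// ltW.
- by rewrite lerDl.
- exact: powR_ge0.
- by rewrite lerDr.
Qed.
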